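(* Let $K$ be an arbitrary field and let $S_n$ be the symmetric group on $n$ letters. (1) If $n\ge 5$, then $\operatorname{ed}_K(S_n)\le n-3$. (2) $\operatorname{ed}_K(S_2)=\operatorname{ed}_K(S_3)=1$ and $\operatorname{ed}_K(S_4)=\operatorname{ed}_K(S_5)=2$. (3) If $\operatorname{char}K\neq 2$, then $\operatorname{ed}_K(S_6)=3$.
   Context: All fields are assumed to contain the ground field $K$. Let $L/L_0$ be a finite separable extension of fields containing $K$. For an intermediate field $K\subset E_0\subset L_0$, one says that $L/L_0$ is defined over $E_0$ if there is a field $E$ with $E_0\subset E\subset L$, $[E:E_0]=[L:L_0]$ and $L=EL_0$. The essential dimension $\operatorname{ed}_K(L/L_0)$ is the minimum of $\operatorname{trdeg}_K E_0$ (transcendence degree over $K$), where $E_0$ runs over all such fields over which $L/L_0$ is defined. For a finite group $G$, define $\operatorname{ed}_K(G)=\operatorname{ed}_K(K(V)/K(V)^G)$, where $G\to GL(V)$ is a faithful finite-dimensional representation over $K$, $K(V)=K(x_1,\ldots,x_n)$ is the rational function field in a basis $x_1,\ldots,x_n$ of the dual space of $V$ with the induced $G$-action, and $K(V)^G$ is the fixed field; this does not depend on the choice of the faithful representation. *)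

(* Defs.v *)
From HB Require Import structures.
From mathcomp Require Import all_boot all_order all_algebra.
From mathcomp Require Import all_fingroup all_character.
From mathcomp Require Import classical_sets.
From mathcomp Require Import mpoly.

Set Implicit Arguments.
Unset Strict Implicit.
Unset Printing Implicit Defensive.

Import GRing.Theory.
Local Open Scope ring_scope.
Local Open Scope classical_set_scope.

(* Subfields of L are arbitrary (not necessarily decidable) subsets of L, and
   L is a K-extension through iota : K -> L.  Degrees, transcendence degrees
   and essential dimensions are predicates "the invariant exists and equals
   the natural number d": L need not be finite-dimensional over K. *)

Definition is_subfield (L : fieldType) (A : set L) : Prop :=
  [/\ A 1, (forall x y, A x -> A y -> A (x - y))
    & (forall x y, A x -> A y -> A (x / y))].

Definition has_degree (L : fieldType) (F E : set L) (d : nat) : Prop :=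
  exists b : 'I_d -> L, (forall i, E (b i)) /\
    forall x, E x -> exists! c : {ffun 'I_d -> L},
      (forall i, F (c i)) /\ x = \sum_i c i * b i.

Definition compositum (L : fieldType) (E F : set L) : set L :=
  smallest (@is_subfield L) (E `|` F).

Definition alg_independent (K L : fieldType) (iota : {rmorphism K -> L})
    (n : nat) (b : 'I_n -> L) : Prop :=
  forall p : {mpoly K[n]}, mmap iota b p = 0 -> p = 0.

Definition has_trdeg (K L : fieldType) (iota : {rmorphism K -> L})
    (E : set L) (d : nat) : Prop :=
  (exists b : 'I_d -> L, (forall i, E (b i)) /\ alg_independent iota b) /\
  (forall n (b : 'I_n -> L),
     (forall i, E (b i)) -> alg_independent iota b -> (n <= d)%N).

(* The field L of the extension L/L0 is the whole type L.  The notion is meant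
   for finite separable L/L0; [E : E0] = [L : L0] is equality of two finite
   degrees. *)
Definition defined_over (K L : fieldType) (iota : {rmorphism K -> L})
    (L0 E0 : set L) : Prop :=
  [/\ is_subfield E0, range iota `<=` E0, E0 `<=` L0 &
      exists E : set L,
        [/\ is_subfield E, E0 `<=` E,
            (exists d, has_degree L0 [set: L] d /\ has_degree E0 E d)
          & compositum E L0 = [set: L]]].

Definition is_ed (K L : fieldType) (iota : {rmorphism K -> L})
    (L0 : set L) (d : nat) : Prop :=
  (exists E0, defined_over iota L0 E0 /\ has_trdeg iota E0 d) /\
  (forall E0 d', defined_over iota L0 E0 -> has_trdeg iota E0 d' ->
     (d <= d')%N).

Section Representation.
Variables (K : fieldType) (gT : finGroupType) (G : {group gT}).
Variables (m : nat) (rG : mx_representation K G m).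

(* V = 'rV[K]_m, with g acting by v |-> v *m rG g, and 'X_i is the i-th
   coordinate function, so the function v |-> 'X_i (v *m rG g) is the linear
   form \sum_j rG g j i *: 'X_j. *)
Definition poly_act (g : gT) (p : {mpoly K[m]}) : {mpoly K[m]} :=
  p \mPo [tuple \sum_(j < m) rG g j i *: 'X_j | i < m].

(* For g \in G, poly_act g is injective, so the value does not depend on the
   numerator and denominator representing f. *)
Definition frac_act (g : gT) (f : {fraction {mpoly K[m]}}) :
    {fraction {mpoly K[m]}} :=
  tofrac (poly_act g (\n_(generic_quotient.repr f))) / tofrac (poly_act g (\d_(generic_quotient.repr f))).

Definition fixed_field : set {fraction {mpoly K[m]}} :=
  [set f | forall g, g \in G -> frac_act g f = f].

Definition ratconst : {rmorphism K -> {fraction {mpoly K[m]}}} :=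
  (@tofrac {mpoly K[m]} \o @mpolyC m K).

End Representation.

(* As ed_K(G) does not depend on the faithful representation V chosen to
   compute it, statements about it are made for every V. *)
Definition ed_group_eq (K : fieldType) (gT : finGroupType) (G : {group gT})
    (d : nat) : Prop :=
  forall (m : nat) (rG : mx_representation K G m), mx_faithful rG ->
    is_ed (ratconst K m) (fixed_field rG) d.

Definition ed_group_le (K : fieldType) (gT : finGroupType) (G : {group gT})
    (b : nat) : Prop :=
  forall (m : nat) (rG : mx_representation K G m), mx_faithful rG ->
    exists d, is_ed (ratconst K m) (fixed_field rG) d /\ (d <= b)%N.

(* Main.v *)
Require Import Defs.
From mathcomp Require Import all_boot all_order all_algebra.
From mathcomp Require Import all_fingroup all_character.
From mathcomp Require Import classical_sets.
From mathcomp Require Import mpoly.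
From HB Require Import structures.
From mathcomp Require Import boolp.
From mathcomp Require Import ring zify.

(** The lower and the upper bounds rest on one reformulation.  Let G act
    faithfully on L with fixed field L0.

    If K <= E <= L is a subfield stable under G on which G still acts
    faithfully, then independence of the automorphisms of E
    (dedekind_basis) gives a family b in E with det (g (b i)) <> 0, and
    this one family is a basis of E over its fixed part and of L over L0
    (artin_exists, artin_unique).  Hence L / L0 is defined over the fixed
    part of E (compression_defined_over), whose transcendence degree is at
    most the number of generators of E (gen_field_indep_size).
    Conversely, if L / L0 is defined over E0 by some E, then E need not be
    Galois over E0, but the field F of all elements of L that are algebraic
    over E0 contains E, is stable under G, and G acts faithfully on it
    (defined_over_alg_closure).  Since F is algebraic over E0, the
    values of a valuation of L on F have multiples that are values on E0
    (val_alg).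

    Upper bounds.  A faithful V contains a generic orbit: elements a_i of
    K(V) that S_n permutes like its n letters and that avoid finitely many
    prescribed polynomial conditions (generic_orbit).  For n >= 5 the
    cross-ratios of the a_i generate a stable field with n - 3 generators
    (cross_compression); for n >= 3 the affine ratios
    (a_i - a_k) / (a_j - a_k) give n - 2 (affine_compression); for n = 2 the
    quotient a_0 / a_1 gives 1 (pair_compression).  Faithfulness is one of
    the polynomial conditions.

    Lower bounds.  If E0 had transcendence degree 0, then F would be algebraic
    over K, hence equal to K since K is algebraically closed in K(V)
    (alg_over_constants), and the action on F would be trivial; so the
    essential dimension is at least 1 (trdeg_gt0).

    In characteristic different from 2, the r = n./2 commuting transpositions
    (2i 2i+1) are diagonalizable on V.  In a basis of common eigenvectors the
    leading exponent of an eigenfunction in K(V) determines its character.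
    The field F contains an eigenfunction f_j that only the j-th transposition
    negates (flip_eigenvector), so the exponents of f_1, ..., f_r are
    independent modulo 2; multiples of them are exponents of elements of E0,
    which are therefore algebraically independent (trdeg_ge_half).  This gives
    2 for n = 4, 5 and 3 for n = 6.

    In characteristic 2 and for n >= 4, filter V* by the powers of the
    augmentation ideal of the Klein four-group of S_4.  The filtration is
    stable under S_4, and the Klein group acts trivially on its graded pieces.
    The corresponding weighted degree w is a valuation of K(V) invariant under
    S_4, and an element a of the Klein group acts trivially on its residue
    field.  If E0 had transcendence degree 1, then w could not be trivial on
    E0, for a would then act trivially on F (nontrivial_on_base); hence the
    residue field of w on F is K (unit_residue).  For t in F the residue of
    c t / t, where c = s1 s2 is a rotation of order 3, is 1, because the
    dihedral relations force its square and its cube to be 1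
    (rotation_residue1).  For y = f - c f the relation y + c y + c c y = 0
    then reads 3 = 0 in K unless y = 0, so c acts trivially on F: a
    contradiction (invariant_valuation_absurd, trdeg_ge2_char2). *)

Set Implicit Arguments.
Unset Strict Implicit.
Unset Printing Implicit Defensive.
Import GRing.Theory.
Local Open Scope ring_scope.
Local Open Scope classical_set_scope.

(** * Subfields and relative algebraic closure *)
(** The proof that A is a subfield is an index of the predicate, so that the
    closure properties are attached to it as a canonical structure. *)
Definition mem_of (L : fieldType) (A : set L) (_ : is_subfield A) : {pred L} :=
  fun x => `[< A x >].

Section SubfieldType.
Variables (L : fieldType) (A : set L) (hA : is_subfield A).

Local Notation sfpred := (mem_of hA).

Lemma sfpredP x : reflect (A x) (x \in sfpred).
Proof. exact: asboolP. Qed.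

Fact sfpred_divring : divring_closed sfpred.
Proof.
case: hA => A1 AB AD; split; first exact/sfpredP.
  by move=> x y /sfpredP Ax /sfpredP Ay; apply/sfpredP/AB.
by move=> x y /sfpredP Ax /sfpredP Ay; apply/sfpredP/AD.
Qed.
HB.instance Definition _ := GRing.isDivringClosed.Build L sfpred sfpred_divring.

(** A as a field in its own right: the theory of algebraic elements is about
    embeddings of fields, not about subsets. *)
Record sf_type := SfType { sf_val :> L; _ : sf_val \in sfpred }.
HB.instance Definition _ := [isSub for sf_val].
HB.instance Definition _ := [Choice of sf_type by <:].
HB.instance Definition _ := [SubChoice_isSubIntegralDomain of sf_type by <:].
HB.instance Definition _ := [SubIntegralDomain_isSubField of sf_type by <:].

Definition sf_emb : {rmorphism sf_type -> L} := \val.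

Lemma sf_embP (x : sf_type) : A (sf_emb x).
Proof. exact/sfpredP/valP. Qed.

Lemma sf_lift x : A x -> exists y : sf_type, sf_emb y = x.
Proof. by move=> /sfpredP Ax; exists (SfType Ax). Qed.

End SubfieldType.

Section SubfieldClosure.
Variables (L : fieldType) (A : set L) (hA : is_subfield A).

Lemma sf1 : A 1. Proof. by case: hA. Qed.
Lemma sfB x y : A x -> A y -> A (x - y). Proof. by case: hA => _ + _; apply. Qed.
Lemma sf_div x y : A x -> A y -> A (x / y). Proof. by case: hA => _ _; apply. Qed.
Lemma sf0 : A 0. Proof. by rewrite -(subrr 1); apply: sfB; apply: sf1. Qed.
Lemma sfN x : A x -> A (- x).
Proof. by move=> Ax; rewrite -sub0r; apply: sfB => //; apply: sf0. Qed.
Lemma sfD x y : A x -> A y -> A (x + y).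
Proof. by move=> Ax Ay; rewrite -[y]opprK; apply: sfB => //; apply: sfN. Qed.
Lemma sfV x : A x -> A x^-1.
Proof. by move=> Ax; rewrite -div1r; apply: sf_div => //; apply: sf1. Qed.
Lemma sfM x y : A x -> A y -> A (x * y).
Proof. by move=> Ax Ay; rewrite -[y]invrK; apply: sf_div => //; apply: sfV. Qed.
Lemma sfX x n : A x -> A (x ^+ n).
Proof.
move=> Ax; elim: n => [|n IHn]; first exact: sf1.
by rewrite exprS; apply: sfM.
Qed.
Lemma sf_sum (I : Type) (r : seq I) (P : pred I) (F : I -> L) :
  (forall i, P i -> A (F i)) -> A (\sum_(i <- r | P i) F i).
Proof. by move=> AF; elim/big_ind: _ => //; [exact: sf0 | exact: sfD]. Qed.
Lemma sf_prod (I : Type) (r : seq I) (P : pred I) (F : I -> L) :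
  (forall i, P i -> A (F i)) -> A (\prod_(i <- r | P i) F i).
Proof. by move=> AF; elim/big_ind: _ => //; [exact: sf1 | exact: sfM]. Qed.

Lemma sf_det n (M : 'M[L]_n) : (forall i j, A (M i j)) -> A (\det M).
Proof.
move=> AM; apply: sf_sum => s _; apply: sfM; last exact: sf_prod.
by apply/sfX/sfN/sf1.
Qed.

Lemma sf_invmx n (M : 'M[L]_n) :
  (forall i j, A (M i j)) -> forall i j, A (invmx M i j).
Proof.
move=> AM i j; rewrite /invmx; case: ifP => // _; rewrite !mxE mulrC.
apply: sf_div; last exact: sf_det.
rewrite /cofactor; apply: sfM; first by apply/sfX/sfN/sf1.
by apply: sf_det => a b; rewrite !mxE.
Qed.

End SubfieldClosure.

Definition alg_over (L : fieldType) (A : set L) : set L :=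
  [set x | exists p : {poly L}, [/\ p != 0, forall i, A p`_i & root p x]].

Section AlgebraicClosure.
Variables (L : fieldType) (A : set L) (hA : is_subfield A).

Lemma alg_overE x : alg_over A x <-> algebraicOver (sf_emb hA) x.
Proof.
split=> [[p [p0 Ap rp]] | [p p0 rp]]; last first.
  exists (map_poly (sf_emb hA) p); split=> //; first by rewrite map_poly_eq0.
  by move=> i; rewrite coef_map; apply: sf_embP.
have [q defp] : exists q, map_poly (sf_emb hA) q = p.
  have [u hu] := choice (fun i => sf_lift hA (Ap i)).
  exists (\poly_(i < size p) u i); apply/polyP => i.
  rewrite coef_map coef_poly; case: ltnP => [_|le]; first exact: hu.
  by rewrite [LHS](rmorph0 (sf_emb hA)) nth_default.
exists q; last by rewrite defp.
by rewrite -(map_poly_eq0 (sf_emb hA)) defp.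
Qed.

Lemma alg_over_base x : A x -> alg_over A x.
Proof. by case/(sf_lift hA) => y <-; apply/alg_overE/algebraic_id. Qed.

Lemma alg_over_subfield : is_subfield (alg_over A).
Proof.
split=> [|x y /alg_overE ax /alg_overE ay|x y /alg_overE ax /alg_overE ay].
- by apply: alg_over_base; apply: (sf1 hA).
- by apply/alg_overE; apply: algebraic_sub.
- by apply/alg_overE; apply: algebraic_div.
Qed.

(** Multiplication by x in E has a matrix M over A in the basis b, and x is an
    eigenvalue of M, hence a root of its characteristic polynomial. *)
Lemma has_degree_alg (E : set L) d : is_subfield E -> A `<=` E ->
  has_degree A E d -> E `<=` alg_over A.
Proof.
move=> hE AE [b [Eb bE]] x Ex; apply/alg_overE.
have /choice[u hu] : forall i, exists u : 'I_d -> sf_type hA,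
    x * b i = \sum_j sf_emb hA (u j) * b j.
  move=> i; have [c [[Ac ->] _]] := bE _ (sfM hE Ex (Eb i)).
  have /choice[v hv] := fun j => sf_lift hA (Ac j).
  by exists v; apply: eq_bigr => j _; rewrite hv.
pose M := \matrix_(i, j) u j i.
have b_neq0 : (\row_j b j) != 0.
  apply: contraT; rewrite negbK => /eqP b0.
  have [c [[_ one] _]] := bE _ (sf1 hE).
  have := oner_neq0 L; rewrite one big1 ?eqxx // => j _.
  by move/rowP/(_ j): b0; rewrite !mxE => ->; rewrite mulr0.
exists (char_poly M); first exact/monic_neq0/char_poly_monic.
rewrite map_char_poly -eigenvalue_root_char; apply/eigenvalueP.
exists (\row_j b j) => //; apply/rowP => i; rewrite !mxE hu.
by apply: eq_bigr => j _; rewrite !mxE mulrC.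
Qed.

End AlgebraicClosure.

(** * Independence of automorphisms and Artin's theorem *)
Section Dedekind.
Variables (L : fieldType) (I : finType) (s : I -> {rmorphism L -> L}).
Variable E : set L.
Hypotheses (E1 : E 1) (EM : forall x y, E x -> E y -> E (x * y)).
Hypothesis s_distinct : forall i j, i != j -> exists2 x, E x & s i x != s j x.

(** Dedekind's argument: subtracting from a relation u its image under
    multiplication by s k y kills the term k, so every term i of a shortest
    relation satisfies s i y = s k y for all y, that is i = k. *)
Lemma dedekind_indep (u : I -> L) :
  (forall x, E x -> \sum_i u i * s i x = 0) -> forall i, u i = 0.
Proof.
have [n] := ubnP #|[pred i | u i != 0]|.
elim: n u => // n IHn u lt_u u_ann i0; apply/eqP/contraT => ui0.
pose v k y i := u i * (s i y - s k y).
have v0 k y : E y -> u k != 0 -> forall i, v k y i = 0.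
  move=> Ey uk; apply: IHn => [|x Ex]; last first.
    transitivity (\sum_i u i * s i (x * y) - (\sum_i u i * s i x) * s k y).
      rewrite mulr_suml -sumrB; apply: eq_bigr => i _.
      by rewrite /v rmorphM /=; ring.
    by rewrite !u_ann ?mul0r ?subr0 //; apply: EM.
  apply: leq_trans (lt_u : (_ <= n)%N); apply: proper_card.
  apply/properP; split; last first.
    by exists k; rewrite !inE // /v subrr mulr0 eqxx.
  by apply/fintype.subsetP => i; rewrite !inE /v mulf_eq0 negb_or => /andP[].
have one_supp i : i != i0 -> u i = 0.
  move=> /s_distinct[y Ey neq]; have /eqP := v0 i0 y Ey ui0 i.
  by rewrite mulf_eq0 subr_eq0 (negPf neq) orbF => /eqP.
have := u_ann 1 E1; rewrite (bigD1 i0) //= big1 => [|i /one_supp->].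
  by rewrite rmorph1 mulr1 addr0 => /eqP; rewrite (negPf ui0).
by rewrite mul0r.
Qed.

(** The rows (s j x)_j, for x in E, span the whole space: a vector orthogonal to
    all of them would be a linear relation between the s j. *)
Lemma dedekind_basis : exists b : 'I_#|I| -> L, (forall i, E (b i)) /\
  \matrix_(i, j) s (enum_val j) (b i) \in unitmx.
Proof.
pose rw x := \row_(j < #|I|) s (enum_val j) x.
suff free k : (k <= #|I|)%N -> exists b : 'I_k -> L, (forall i, E (b i)) /\
    row_free (\matrix_i rw (b i)).
  have [b [Eb freeb]] := free _ (leqnn _).
  exists b; split=> //; rewrite -row_free_unit.
  by congr row_free: freeb; apply/matrixP => i j; rewrite !mxE.
elim: k => [|k IHk] lekN.
  by exists (fun=> 0); split; [case | rewrite -row_leq_rank].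
have [b [Eb freeb]] := IHk (ltnW lekN).
set A := \matrix_i _ in freeb.
have [x Ex notin] : exists2 x, E x & ~~ (rw x <= A)%MS.
  apply: contrapT => noE.
  have coker0 : cokermx A = 0.
    apply/matrixP => i j; rewrite [RHS]mxE.
    pose u i := cokermx A (enum_rank i) j.
    suff /(_ (enum_val i)) : forall i, u i = 0 by rewrite /u enum_valK.
    apply: dedekind_indep => x Ex.
    have : (rw x <= A)%MS by apply/negPn/negP => ?; apply: noE; exists x.
    rewrite submxE => /eqP/rowP/(_ j) ann.
    transitivity ((rw x *m cokermx A) 0 j); last by rewrite ann mxE.
    rewrite mxE (reindex_onto (@enum_val _ I) enum_rank) => [|? _].
      rewrite (eq_bigl xpredT) => [|l]; last by rewrite enum_valK eqxx.
      by apply: eq_bigr => l _; rewrite /u enum_valK [rw x 0 l]mxE mulrC.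
    exact: enum_rankK.
  have := mxrank_coker A; rewrite coker0 mxrank0 (eqnP freeb).
  by move=> /esym/eqP; rewrite subn_eq0 leqNgt lekN.
pose b' (i : 'I_k.+1) := oapp b x (unlift ord_max i).
exists b'; split; first by move=> i; rewrite /b'; case: unlift => /=.
set B := \matrix_i _.
have leAB : (A + rw x <= B)%MS.
  rewrite addsmx_sub; apply/andP; split.
    apply/row_subP => i; rewrite rowK; apply: (eq_row_sub (lift ord_max i)).
    by rewrite rowK /b' liftK.
  by apply: (eq_row_sub ord_max); rewrite rowK /b' unlift_none.
rewrite -row_leq_rank; apply: leq_trans (mxrankS leAB).
rewrite -{1}(eqnP freeb); apply: rank_ltmx; rewrite ltmxE addsmxSl /=.
by apply: contra notin => /(submx_trans (addsmxSr _ _)).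
Qed.

End Dedekind.

Section GaloisDescent.
Variables (L : fieldType) (gT : finGroupType) (act : gT -> {rmorphism L -> L}).
Hypothesis act1 : forall x, act 1%g x = x.
Hypothesis actM : forall g h x, act (g * h)%g x = act g (act h x).

Definition act_fixed : set L := [set x | forall g, act g x = x].
Definition act_stable (E : set L) := forall g x, E x -> E (act g x).
Definition act_faithful (E : set L) :=
  forall g, g != 1%g -> exists2 x, E x & act g x != x.

Lemma act_distinct (E : set L) : act_faithful E ->
  forall g h, g != h -> exists2 x, E x & act g x != act h x.
Proof.
move=> fE g h neq; have [|x Ex nx] := fE (h^-1 * g)%g.
  by apply: contra neq => /eqP eq1; rewrite -(mulKVg h g) eq1 mulg1.
exists x => //; apply: contra nx => /eqP eqx.
by rewrite actM eqx -actM mulVg act1.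
Qed.

Lemma act_fixed_subfield : is_subfield act_fixed.
Proof.
split=> [g|x y fx fy g|x y fx fy g]; first exact: rmorph1.
  by rewrite rmorphB fx fy.
by rewrite fmorph_div fx fy.
Qed.

Lemma fixed_by_subfield g : is_subfield [set x | act g x = x].
Proof.
split=> [|x y /= fx fy|x y /= fx fy] /=; first exact: rmorph1.
  by rewrite rmorphB fx fy.
by rewrite fmorph_div fx fy.
Qed.

(** The coefficients of a polynomial over A are fixed, so g permutes its roots. *)
Lemma alg_over_stable (A : set L) : A `<=` act_fixed -> act_stable (alg_over A).
Proof.
move=> Afix g x [p [p0 Ap /rootP rp]]; exists p; split=> //; apply/rootP.
have -> : p = map_poly (act g) p.
  by apply/polyP => i; rewrite coef_map /=; apply/esym/Afix.
by rewrite horner_map rp rmorph0.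
Qed.

Section Artin.
Variables (E : set L) (hE : is_subfield E).
Hypotheses (Est : act_stable E).
Variable b : 'I_#|gT| -> L.
Hypothesis Eb : forall i, E (b i).
Let M := \matrix_(i, j) act (@enum_val gT gT j) (b i).
Hypothesis unitM : M \in unitmx.

(** The coordinates of x in the basis b are sought as the unique solution c of
    the linear system g x = sum_i c i * g (b i), g in G. *)
Lemma artin_system (c : 'I_#|gT| -> L) x :
  (forall g, act g x = \sum_i c i * act g (b i)) <->
  \row_i c i = \row_j act (@enum_val gT gT j) x *m invmx M.
Proof.
split=> [cE | cE g].
  rewrite -[LHS](mulmxK unitM); congr (_ *m _); apply/rowP => j.
  by rewrite !mxE cE; apply: eq_bigr => i _; rewrite !mxE.
have /rowP/(_ (enum_rank g)) : \row_i c i *m M = \row_j act (@enum_val gT gT j) x.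
  by rewrite cE mulmxKV.
by rewrite !mxE enum_rankK => <-; apply: eq_bigr => i _; rewrite !mxE enum_rankK.
Qed.

Lemma artin_fixed_system (c : 'I_#|gT| -> L) x :
  (forall i, act_fixed (c i)) -> x = \sum_i c i * b i ->
  forall g, act g x = \sum_i c i * act g (b i).
Proof.
move=> fc -> g; rewrite rmorph_sum; apply: eq_bigr => i _.
by rewrite rmorphM fc.
Qed.

(** Applying g to the system permutes its equations, so its unique solution is
    fixed by g; Cramer's rule keeps it in E. *)
Lemma artin_exists x : exists c : 'I_#|gT| -> L,
  [/\ forall i, act_fixed (c i), x = \sum_i c i * b i
    & E x -> forall i, E (c i)].
Proof.
pose X := \row_j act (@enum_val gT gT j) x *m invmx M.
exists (X 0); have sysX : forall g, act g x = \sum_i X 0 i * act g (b i).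
  by apply/artin_system/rowP => i; rewrite mxE.
split.
- move=> i g.
  have /artin_system/rowP/(_ i) :
      forall h, act h x = \sum_i act g (X 0 i) * act h (b i).
    move=> h; rewrite -[h in LHS](mulKVg g) actM sysX rmorph_sum.
    by apply: eq_bigr => k _; rewrite rmorphM -actM mulKVg.
  by rewrite mxE => ->.
- rewrite -[LHS]act1 sysX; apply: eq_bigr => i _; by rewrite act1.
- move=> Ex i; rewrite mxE; apply: (sf_sum hE) => j _; apply: (sfM hE).
    by rewrite mxE; apply: Est.
  by apply: (sf_invmx hE) => k l; rewrite mxE; apply: Est.
Qed.

Lemma artin_unique (c d : 'I_#|gT| -> L) :
  (forall i, act_fixed (c i)) -> (forall i, act_fixed (d i)) ->
  \sum_i c i * b i = \sum_i d i * b i -> c =1 d.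
Proof.
move=> fc fd eq_cd i.
have /artin_system/rowP/(_ i) := artin_fixed_system fc erefl.
have /artin_system/rowP/(_ i) := artin_fixed_system fd eq_cd.
by rewrite !mxE => -> ->.
Qed.

End Artin.

Lemma has_degree_fixed (E : set L) (b : 'I_#|gT| -> L) :
  is_subfield E -> act_stable E -> (forall i, E (b i)) ->
  \matrix_(i, j) act (@enum_val gT gT j) (b i) \in unitmx ->
  has_degree (E `&` act_fixed) E #|gT|.
Proof.
move=> hE Est Eb Ub; exists b; split=> // x Ex.
have [c [fc xE Ec]] := artin_exists hE Est Eb Ub x.
exists (finfun c); split=> [|d [fd xEd]].
  split=> [i|]; first by rewrite ffunE; split; [exact: Ec | exact: fc].
  by rewrite xE; apply: eq_bigr => i _; rewrite ffunE.
apply/ffunP => i; rewrite ffunE; apply: (artin_unique Ub fc) => [j|].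
  by case: (fd j).
by rewrite -xE.
Qed.

Lemma compression_defined_over (K : fieldType) (iota : {rmorphism K -> L})
    (E : set L) :
  is_subfield E -> range iota `<=` E -> range iota `<=` act_fixed ->
  act_stable E -> act_faithful E -> defined_over iota act_fixed (E `&` act_fixed).
Proof.
move=> hE KE Kfix Est Ef.
have [b [Eb Ub]] := dedekind_basis (sf1 hE) (sfM hE) (act_distinct Ef).
split; [|by move=> x Kx; split; [exact: KE | exact: Kfix]|by move=> x []|].
  split=> [|x y [Ex fx] [Ey fy]|x y [Ex fx] [Ey fy]].
  - by split; [exact: (sf1 hE) | exact: (sf1 act_fixed_subfield)].
  - by split; [exact: (sfB hE) | exact: (sfB act_fixed_subfield)].
  - by split; [exact: (sf_div hE) | exact: (sf_div act_fixed_subfield)].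
exists E; split=> //.
  exists #|gT|; split; last exact: has_degree_fixed Ub.
  by have := @has_degree_fixed [set: L] b; rewrite setTI; apply.
apply/seteqP; split=> // x _ F [hF sF].
have [c [fc -> _]] := artin_exists hE Est Eb Ub x.
apply: (sf_sum hF) => i _; apply: (sfM hF); apply: sF; first by right; apply: fc.
by left; apply: Eb.
Qed.

End GaloisDescent.

(** * Fields generated by finitely many elements *)
Section GeneratedField.
Variables (K L : fieldType) (iota : {rmorphism K -> L}).
Variables (d : nat) (t : 'I_d -> L).

Definition gen_field : set L :=
  [set x | exists f g : {mpoly K[d]},
    mmap iota t g != 0 /\ x = mmap iota t f / mmap iota t g].

Lemma gen_field_const c : gen_field (iota c).
Proof.
by exists c%:MP, 1; rewrite rmorph1 oner_neq0 divr1 mmapC.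
Qed.

Lemma gen_field_gen i : gen_field (t i).
Proof.
by exists 'X_i, 1; rewrite rmorph1 oner_neq0 divr1 mmapX mmap1U.
Qed.

Lemma gen_field_subfield : is_subfield gen_field.
Proof.
split=> [|_ _ [f [g [g0 ->]]] [f' [g' [g0' ->]]]|_ _ [f [g [g0 ->]]] [f' [g' [g0' ->]]]].
- by rewrite -(rmorph1 iota); apply: gen_field_const.
- exists (f * g' - f' * g), (g * g').
  rewrite rmorphM mulf_neq0 //; split=> //.
  by rewrite rmorphB !rmorphM /=; field; rewrite g0 g0'.
- have [f0|f0] := eqVneq (mmap iota t f') 0.
    by exists 0, 1; rewrite rmorph1 oner_neq0 f0 mul0r invr0 mulr0 rmorph0 mul0r.
  exists (f * g'), (g * f'); rewrite !rmorphM mulf_neq0 //; split=> //.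
  by rewrite invf_div mulf_div.
Qed.

(** Used as an induction principle: a property that defines a subfield holds on
    the field generated by t as soon as it holds for the constants and t. *)
Lemma gen_field_min (F : set L) : is_subfield F -> range iota `<=` F ->
  (forall i, F (t i)) -> gen_field `<=` F.
Proof.
move=> hF KF tF _ [f [g [_ ->]]].
have memF p : F (mmap iota t p).
  apply: (sf_sum hF) => m _; apply: (sfM hF); first by apply: KF; exists p@_m.
  by apply: (sf_prod hF) => i _; apply: (sfX hF).
by apply: (sf_div hF).
Qed.

Section TrdegBound.
Variables (n : nat) (b : 'I_n -> L).
Hypotheses (b_gen : forall i, gen_field (b i)) (b_ind : alg_independent iota b).

Let bounded D (p : {mpoly K[d]}) := forall m, m \in msupp p -> (mdeg m <= D)%N.

Let boundedM D D' p q : bounded D p -> bounded D' q -> bounded (D + D') (p * q).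
Proof.
move=> bp bq m /msuppM_le/allpairsP[[m1 m2] /= [/bp le1 /bq le2 ->]].
by rewrite mdegD leq_add.
Qed.

Let bounded1 D : bounded D 1.
Proof. by move=> m; rewrite msupp1 inE => /eqP->; rewrite mdeg0. Qed.

Let boundedX D k p : bounded D p -> bounded (k * D) (p ^+ k).
Proof.
move=> bp; elim: k => [|k IHk]; first exact: bounded1.
by rewrite exprS mulSn; apply: boundedM.
Qed.

Let bounded_prod (I : Type) (r : seq I) D (F : I -> {mpoly K[d]}) :
  (forall i, bounded D (F i)) -> bounded (size r * D) (\prod_(i <- r) F i).
Proof.
move=> bF; elim: r => [|i r IHr]; first by rewrite big_nil; apply: bounded1.
by rewrite big_cons mulSn; apply: boundedM.
Qed.

Lemma common_denominator : exists (f : 'I_n -> {mpoly K[d]}) (g : {mpoly K[d]}),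
  mmap iota t g != 0 /\ forall i, b i * mmap iota t g = mmap iota t (f i).
Proof.
have /choice[f /choice[g fg]] := b_gen.
exists (fun i => f i * \prod_(j | j != i) g j), (\prod_j g j).
have g0 j : mmap iota t (g j) != 0 by case: (fg j).
have TP : mmap iota t (\prod_j g j) = \prod_j (mmap iota t (g j) : L).
  exact: rmorph_prod.
split=> [|i]; first by rewrite TP; apply/prodf_neq0.
rewrite TP (bigD1 i) //= mulrA rmorphM rmorph_prod; congr (_ * _).
by case: (fg i) => _ ->; rewrite mulfVK.
Qed.

(** Over the common denominator g of the b i, the monomials in b with all
    exponents below N become polynomials in d variables whose exponents are
    O(N).  There are N ^ n of them in a space of dimension O(N ^ d), so they
    satisfy a linear relation when n > d and N is large. *)
Lemma gen_field_indep_size : (n <= d)%N.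
Proof.
rewrite leqNgt; apply/negP => lt_dn.
have [f [g [g0 bg]]] := common_denominator.
have [C [bC gC]] : exists C, (forall i, bounded C (f i)) /\ bounded C g.
  exists (\max_i msize (f i) + msize g)%N; split=> [i|] m /msize_mdeg_lt lt_m.
    apply: leq_trans (ltnW lt_m) (leq_trans _ (leq_addr _ _)).
    exact: (leq_bigmax i).
  exact: leq_trans (ltnW lt_m) (leq_addl _ _).
(* B * N bounds the exponents of h a, and (B * N) ^ d < N ^ d.+1 since B ^ d < N. *)
pose B := (n * C).+1; pose N := (B ^ d).+1; pose M := (N * B)%N.
pose h (a : {ffun 'I_n -> 'I_N}) := \prod_i (f i ^+ a i * g ^+ (N.-1 - a i)).
have bh a m i : m \in msupp (h a) -> (m i < M)%N.
  have bnd : bounded (n * (N.-1 * C)) (h a).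
    have sz : size (index_enum 'I_n) = n.
      by rewrite /index_enum unlock -enumT size_enum_ord.
    rewrite -[X in (X * _)%N]sz; apply: bounded_prod => j.
    have -> : (N.-1 * C = a j * C + (N.-1 - a j) * C)%N.
      by rewrite -mulnDl subnKC // -ltnS prednK // ltn_ord.
    by apply: boundedM; apply: boundedX.
  move=> ma; have := bnd _ ma; rewrite mdegE (bigD1 i) //= => le_m.
  apply: leq_ltn_trans (leq_trans (leq_addr _ _) le_m) _.
  by rewrite mulnCA [M]mulSn addSn ltnS (leq_trans _ (leq_addl _ _)) // leq_mul.
have cardlt : (#|{ffun 'I_d -> 'I_M}| < #|{ffun 'I_n -> 'I_N}|)%N.
  rewrite !card_ffun !card_ord /M expnMn.
  apply: leq_trans (_ : N ^ d.+1 <= _)%N; last exact: leq_pexp2l.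
  by rewrite expnS mulnC ltn_pmul2r ?expn_gt0.
pose mon k (e : {ffun 'I_k -> 'I_N}) : 'X_{1..k} := [multinom (e i : nat) | i < k].
pose mond (e : {ffun 'I_d -> 'I_M}) : 'X_{1..d} := [multinom (e i : nat) | i < d].
pose A := \matrix_(i < #|{ffun 'I_n -> 'I_N}|, j < #|{ffun 'I_d -> 'I_M}|)
  (h (enum_val i))@_(mond (enum_val j)).
have kerN0 : kermx A != 0.
  rewrite kermx_eq0 /row_free; apply: contraTneq cardlt => <-.
  by rewrite -leqNgt rank_leq_col.
have [c cA c0] : exists2 c : 'rV_#|{ffun 'I_n -> 'I_N}|, c *m A = 0 & c != 0.
  exists (nz_row (kermx A)); last by rewrite nz_row_eq0.
  by apply/sub_kermxP/nz_row_sub.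
have hc0 : \sum_i c 0 i *: h (enum_val i) = 0.
  apply/mpolyP => m; rewrite mcoeff0 raddf_sum /=.
  have [lt_m|] := boolP [forall i, (m i < M)%N].
    pose e : {ffun 'I_d -> 'I_M} := [ffun i => Ordinal (forallP lt_m i)].
    have -> : m = mond e by apply/mnmP => i; rewrite mnmE ffunE.
    transitivity ((c *m A) 0 (enum_rank e)); last by rewrite cA mxE.
    rewrite mxE; apply: eq_bigr => i _.
    by rewrite [A _ _]mxE enum_rankK mcoeffZ.
  rewrite negb_forall => /existsP[i nlt_m]; apply: big1 => j _.
  rewrite mcoeffZ memN_msupp_eq0 ?mulr0 //.
  by apply: contra nlt_m; apply: bh.
pose p := \sum_i c 0 i *: 'X_[mon n (enum_val i)].
have p0 : p = 0.
  apply: b_ind; apply: (mulIf (expf_neq0 (n * N.-1) g0)); rewrite mul0r.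
  rewrite -[RHS](rmorph0 (mmap iota t)) -hc0 !rmorph_sum mulr_suml.
  apply: eq_bigr => i _ /=; rewrite !mmapZ -mulrA; congr (_ * _).
  rewrite mmapX /mmap1 rmorph_prod mulnC exprM -[X in _ ^+ X]card_ord.
  rewrite -prodr_const -big_split; apply: eq_bigr => j _ /=.
  rewrite mnmE rmorphM !rmorphXn /= -bg exprMn -mulrA -exprD subnKC //.
  by rewrite -ltnS; apply: ltn_ord.
move/eqP: c0; apply; apply/rowP => i; rewrite mxE.
have : p@_(mon n (enum_val i)) = 0 by rewrite p0 mcoeff0.
rewrite raddf_sum (bigD1 i) //= mcoeffZ mcoeffX eqxx mulr1 big1 ?addr0 //.
move=> j neq; rewrite mcoeffZ mcoeffX; case: eqP => [eqm|]; last by rewrite mulr0.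
case/eqP: neq; apply: enum_val_inj; apply/ffunP => k; apply: val_inj.
by have /mnmP/(_ k) := eqm; rewrite !mnmE.
Qed.

End TrdegBound.

End GeneratedField.

(** * Generic points of a Galois orbit *)
Section LinePolynomials.
Variable L : fieldType.

Lemma nonroot_in_sequence (z : nat -> L) (p : {poly L}) :
  injective z -> p != 0 -> exists k, p.[z k] != 0.
Proof.
move=> injz p0; apply: contrapT => allroots.
have /(max_poly_roots p0) : all (root p) (map z (iota 0 (size p))).
  apply/allP => _ /mapP[k _ ->]; apply/rootP/eqP/negPn/negP => ?.
  by apply: allroots; exists k.
by rewrite map_inj_uniq // iota_uniq size_map size_iota ltnn => /(_ isT).
Qed.

(** Functions that are polynomial along every affine line.  All conditions of
    general position used below are of this kind, and their non-vanishing can be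
    arranged with polynomials in one variable. *)
Definition line_polynomial n (P : ('I_n -> L) -> L) := forall c e : 'I_n -> L,
  exists p : {poly L}, forall s, P (fun i => c i + s * e i) = p.[s].

Lemma line_polynomial_const n a : line_polynomial (fun _ : 'I_n -> L => a).
Proof. by move=> c e; exists a%:P => s; rewrite hornerC. Qed.

Lemma line_polynomial_coord n i : line_polynomial (fun y : 'I_n -> L => y i).
Proof.
by move=> c e; exists ((c i)%:P + 'X * (e i)%:P) => s; rewrite !hornerE.
Qed.

Lemma line_polynomialB n (P Q : ('I_n -> L) -> L) : line_polynomial P ->
  line_polynomial Q -> line_polynomial (fun y => P y - Q y).
Proof.
move=> lP lQ c e; have [p Pp] := lP c e; have [q Qq] := lQ c e.
by exists (p - q) => s; rewrite Pp Qq !hornerE.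
Qed.

Lemma line_polynomialM n (P Q : ('I_n -> L) -> L) : line_polynomial P ->
  line_polynomial Q -> line_polynomial (fun y => P y * Q y).
Proof.
move=> lP lQ c e; have [p Pp] := lP c e; have [q Qq] := lQ c e.
by exists (p * q) => s; rewrite Pp Qq !hornerE.
Qed.

Lemma line_polynomial_comp n m (A : 'I_m -> 'I_n -> L) (P : ('I_n -> L) -> L) :
  line_polynomial P -> line_polynomial (fun c => P (fun i => \sum_k c k * A k i)).
Proof.
move=> lP c e.
have [p Pp] := lP (fun i => \sum_k c k * A k i) (fun i => \sum_k e k * A k i).
exists p => s; rewrite -Pp; congr P; apply/funext => i.
rewrite mulr_sumr -big_split; apply: eq_bigr => k _ /=.
by rewrite mulrDl mulrA.
Qed.

Lemma line_polynomial_prod n (I : eqType) (r : seq I)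
    (P : I -> ('I_n -> L) -> L) :
  (forall i, line_polynomial (P i)) ->
  line_polynomial (fun y => \prod_(j <- r) P j y).
Proof.
move=> lP c e; elim: r => [|j s [p IHs]].
  by exists 1 => x; rewrite big_nil hornerC.
have [q Pq] := lP j c e.
by exists (q * p) => x; rewrite big_cons hornerM -IHs Pq.
Qed.

Variable z : nat -> L.
Hypothesis injz : injective z.

(** On the line through c and d, neither P nor Q vanishes identically. *)
Lemma line_polynomial_two_neq0 n (P Q : ('I_n -> L) -> L) c d :
  line_polynomial P -> line_polynomial Q -> P c != 0 -> Q d != 0 ->
  exists y, P y != 0 /\ Q y != 0.
Proof.
move=> lP lQ Pc Qd; have [p Pp] := lP c (fun i => d i - c i).
have [q Qq] := lQ c (fun i => d i - c i).
have [|k] := nonroot_in_sequence injz (_ : p * q != 0).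
  apply: mulf_neq0.
    apply: contraNneq Pc => p0; have := Pp 0; rewrite p0 horner0 => <-.
    by apply/eqP; congr P; apply/funext => i; rewrite mul0r addr0.
  apply: contraNneq Qd => q0; have := Qq 1; rewrite q0 horner0 => <-.
  by apply/eqP; congr Q; apply/funext => i; rewrite mul1r subrKC.
rewrite hornerM -Pp -Qq mulf_eq0 negb_or => /andP[? ?].
by eexists; split; eassumption.
Qed.

Lemma line_polynomial_family_neq0 n (I : eqType) (r : seq I)
    (P : I -> ('I_n -> L) -> L) :
  (forall i, line_polynomial (P i)) -> (forall i, exists y, P i y != 0) ->
  exists y, \prod_(i <- r) P i y != 0.
Proof.
move=> lP neq0; elim: r => [|i r [y IHr]].
  by exists (fun=> 0); rewrite big_nil oner_neq0.
have [x Px] := neq0 i.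
have [w [Pw rw]] := line_polynomial_two_neq0 (lP i) (line_polynomial_prod r lP) Px IHr.
by exists w; rewrite big_cons mulf_neq0.
Qed.

(** A point where P does not vanish is moved into F one coordinate at a time:
    on a line parallel to an axis P has finitely many zeros. *)
Lemma line_polynomial_dense (F : set L) n (P : ('I_n -> L) -> L) c :
  (forall k, F (z k)) -> line_polynomial P -> P c != 0 ->
  exists2 d, forall i, F (d i) & P d != 0.
Proof.
move=> Fz lP Pc.
suff dense k : (k <= n)%N ->
    exists d, (forall i : 'I_n, (i < k)%N -> F (d i)) /\ P d != 0.
  by have [d [Fd Pd]] := dense n (leqnn n); exists d => // i; apply: Fd.
elim: k => [|k IHk] lekn; first by exists c.
have [d [Fd Pd]] := IHk (ltnW lekn); pose i0 := Ordinal lekn.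
have [p Pp] := lP d (fun i => (i == i0)%:R).
have q0 : p \Po ('X - (d i0)%:P) != 0.
  apply: contraNneq Pd => q0; have <- : (p \Po ('X - (d i0)%:P)).[d i0] = P d.
    rewrite horner_comp !hornerE subrr -Pp; congr P.
    by apply/funext => i; rewrite mul0r addr0.
  by rewrite q0 horner0.
have [m] := nonroot_in_sequence injz q0; rewrite horner_comp !hornerE -Pp => Pm.
eexists; split; last exact: Pm.
move=> i /=; rewrite ltnS leq_eqVlt => /predU1P[ik|lt_ik].
  have -> : i = i0 by apply: val_inj.
  by rewrite eqxx mulr1 subrKC.
have /negPf-> : i != i0 by rewrite -val_eqE /= ltn_eqF.
by rewrite mulr0 addr0; apply: Fd.
Qed.

End LinePolynomials.

Section GenericOrbit.
Variables (L : fieldType) (n : nat) (act : 'S_n -> {rmorphism L -> L}).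
Hypothesis act1 : forall x, act 1%g x = x.
Hypothesis actM : forall g h x, act (g * h)%g x = act g (act h x).
Hypothesis act_faith : act_faithful act [set: L].
Variable z : nat -> L.
Hypotheses (injz : injective z) (z_fixed : forall k, act_fixed act (z k)).

(** Every x in L is sum_k c k * b k with fixed coefficients c k.  Summing the
    conjugates of x over the cosets { g | g i = i0 } gives elements that S_n
    permutes and that depend linearly on c; over L this linear map is onto,
    since the matrix of the g (b k) is invertible.  So P is a nonzero
    line polynomial in c, which has a nonzero value at some fixed c. *)
Lemma generic_orbit (P : ('I_n -> L) -> L) y : line_polynomial P -> P y != 0 ->
  exists a : 'I_n -> L,
    (forall s i, act s (a i) = a ((s^-1)%g i)) /\ P a != 0.
Proof.
move=> lP Py; have [n0|n_gt0] := posnP n.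
  exists y; split=> // s i; have := ltn_ord i; by rewrite {2}n0.
pose i0 : 'I_n := Ordinal n_gt0.
have [b [_ Ub]] : exists b : 'I_#|{: 'S_n}| -> L, (forall i, [set: L] (b i)) /\
    \matrix_(i, j) act (@enum_val 'S_n 'S_n j) (b i) \in unitmx.
  by apply: dedekind_basis => //; apply: (act_distinct act1 actM act_faith).
pose A k (i : 'I_n) := \sum_(g : 'S_n | g i == i0) act g (b k).
have [c Pc] : exists c, P (fun i => \sum_k c k * A k i) != 0.
  (* Prescribe g x = y l for the single g = tperm l i0 of the coset of l. *)
  pose Z := \row_(j < #|{: 'S_n}|)
    \sum_l (@enum_val 'S_n 'S_n j == tperm l i0)%:R * y l.
  exists ((Z *m invmx (\matrix_(i, j) act (@enum_val 'S_n 'S_n j) (b i))) 0).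
  set c := _ *m _; suff -> : (fun i => \sum_k c 0 k * A k i) = y by [].
  have ZE g : \sum_k c 0 k * act g (b k) = \sum_l (g == tperm l i0)%:R * y l.
    transitivity (Z 0 (enum_rank g)); last by rewrite mxE enum_rankK.
    rewrite -[Z](mulmxKV Ub) [RHS]mxE; apply: eq_bigr => k _.
    by rewrite [X in _ = _ * X]mxE enum_rankK.
  apply/funext => i.
  transitivity (\sum_(g : 'S_n | g i == i0) \sum_l (g == tperm l i0)%:R * y l).
    rewrite -(eq_bigr _ (fun g _ => ZE g)) exchange_big; apply: eq_bigr => k _.
    by rewrite mulr_sumr.
  rewrite (bigD1 (tperm i i0)) ?tpermL //= (bigD1 i) //= eqxx mul1r.
  rewrite big1 ?addr0 => [|l neq]; last first.
    case: eqP => [eqt|]; last by rewrite mul0r.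
    have li : l = i.
      by apply: (@perm_inj _ (tperm l i0)); rewrite tpermL -eqt tpermL.
    by rewrite li eqxx in neq.
  rewrite big1 ?addr0 // => g /andP[gi neqg]; apply: big1 => l _.
  case: eqP => [eqg|]; last by rewrite mul0r.
  have li : l = i.
    by apply: (@perm_inj _ (tperm l i0)); rewrite tpermL -eqg (eqP gi).
  by rewrite eqg li eqxx in neqg.
have [d Fd Pd] := line_polynomial_dense injz z_fixed (line_polynomial_comp A lP) Pc.
pose x := \sum_k d k * b k.
exists (fun i => \sum_(g : 'S_n | g i == i0) act g x); split; last first.
  suff -> : (fun i => \sum_(g : 'S_n | g i == i0) act g x)
    = (fun i => \sum_k d k * A k i) by [].
  apply/funext => i; under [RHS]eq_bigr do rewrite mulr_sumr.
  rewrite exchange_big; apply: eq_bigr => g _.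
  by rewrite rmorph_sum; apply: eq_bigr => k _; rewrite rmorphM Fd.
move=> s i; rewrite rmorph_sum [RHS](reindex_inj (mulgI s)) /=.
apply: eq_big => [g|g _]; last by rewrite actM.
by rewrite permM permKV.
Qed.

End GenericOrbit.

Section UpperBound.
Variables (K L : fieldType) (iota : {rmorphism K -> L}).

Lemma alg_independent0 (b : 'I_0 -> L) : alg_independent iota b.
Proof.
move=> p; have -> : p = (p@_0)%:MP.
  apply/mpolyP => m; have -> : m = 0%MM by apply/mnmP; case.
  by rewrite mcoeffC eqxx mulr1.
by rewrite mmapC => /eqP; rewrite fmorph_eq0 => /eqP->; rewrite mpolyC0.
Qed.

Lemma bounded_has_trdeg (E : set L) d :
  (forall n (b : 'I_n -> L), (forall i, E (b i)) -> alg_independent iota b ->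
    (n <= d)%N) -> exists2 e, has_trdeg iota E e & (e <= d)%N.
Proof.
move=> bnd; pose P n := `[< exists b : 'I_n -> L,
  (forall i, E (b i)) /\ alg_independent iota b >].
have exP : exists n, P n.
  exists 0%N; apply/asboolP; exists (fun=> 0); split; first by case.
  exact: alg_independent0.
have bndP n : P n -> (n <= d)%N by move=> /asboolP[b [Eb ib]]; apply: (bnd _ b).
case: (ex_maxnP exP bndP) => e /asboolP Pe maxe; exists e; last exact/bndP/asboolP.
by split=> // n b Eb ib; apply: maxe; apply/asboolP; exists b.
Qed.

Variables (gT : finGroupType) (act : gT -> {rmorphism L -> L}).
Hypothesis act1 : forall x, act 1%g x = x.
Hypothesis actM : forall g h x, act (g * h)%g x = act g (act h x).
Hypothesis act_const : forall g c, act g (iota c) = iota c.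

Lemma compression_trdeg d (t : 'I_d -> L) :
  (forall g i, gen_field iota t (act g (t i))) ->
  act_faithful act (gen_field iota t) ->
  exists E0 e, [/\ defined_over iota (act_fixed act) E0, has_trdeg iota E0 e
    & (e <= d)%N].
Proof.
move=> t_act t_faith; set E := gen_field iota t.
have hE : is_subfield E := gen_field_subfield _ _.
have KE : range iota `<=` E by move=> _ [c _ <-]; apply: gen_field_const.
have [e tre le_e] : exists2 e, has_trdeg iota (E `&` act_fixed act) e & (e <= d)%N.
  apply: bounded_has_trdeg => n b Eb; apply: (@gen_field_indep_size _ _ iota _ t) => i.
  by have [] := Eb i.
exists (E `&` act_fixed act), e; split=> //.
apply: compression_defined_over => //; first by move=> _ [c _ <-] g.
move=> g; apply: gen_field_min.
- have := @sf_div _ _ hE; have := @sfB _ _ hE; have := sf1 hE => E1 EB ED.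
  split=> [|x y|x y] /=; first by rewrite rmorph1.
    by rewrite rmorphB; apply: EB.
  by rewrite fmorph_div; apply: ED.
- by move=> _ [c _ <-] /=; rewrite act_const; apply: gen_field_const.
- by move=> i; apply: t_act.
Qed.

End UpperBound.

(** * The action of G on the rational functions *)
(** Morphisms out of a polynomial ring are determined by the variables. *)
Lemma mpoly_rmorph_eq (R : nzRingType) (S : comNzRingType) n
    (f g : {rmorphism {mpoly R[n]} -> S}) :
  (forall c, f c%:MP = g c%:MP) -> (forall i, f 'X_i = g 'X_i) -> f =1 g.
Proof.
move=> fgC fgX p; rewrite [p]mpolyE !rmorph_sum; apply: eq_bigr => m _.
rewrite -mul_mpolyC !rmorphM fgC mpolyXE_id !rmorph_prod; congr (_ * _).
by apply: eq_bigr => i _; rewrite !rmorphXn /= fgX.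
Qed.

Lemma subf_div (F : fieldType) (a b c d : F) : b != 0 -> d != 0 ->
  a / b - c / d = (a * d - c * b) / (b * d).
Proof. by move=> b0 d0; field; rewrite b0 d0. Qed.

Section FractionMap.
Variable R : idomainType.
Local Notation "x %:F" := (@FracField.tofrac R x).

Lemma frac_numden (f : {fraction R}) :
  f = (\n_(generic_quotient.repr f))%:F / (\d_(generic_quotient.repr f))%:F.
Proof.
set x := generic_quotient.repr f.
have dx : \d_x != 0 by exact: denom_ratioP.
have xF : (\d_x)%:F != 0 by rewrite tofrac_eq0.
apply: (mulIf xF); rewrite divfK // -[f]generic_quotient.reprK -/x.
unlock FracField.tofrac; rewrite -[LHS]FracField.pi_mul.
apply/generic_quotient.eqmodP => /=.
rewrite FracField.equivfE /FracField.mulf.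
by rewrite !numden_Ratio ?oner_neq0 ?mulr1 // mulrC.
Qed.

Lemma frac_ind (P : {fraction R} -> Prop) :
  (forall p q, q != 0 -> P (p%:F / q%:F)) -> forall f, P f.
Proof.
by move=> Pfrac f; rewrite [f]frac_numden; apply/Pfrac/denom_ratioP.
Qed.

Variables (S : fieldType) (phi : {rmorphism R -> S}).
Hypothesis phi_inj : injective phi.

Definition frac_map of injective phi := fun f : {fraction R} =>
  phi (\n_(generic_quotient.repr f)) / phi (\d_(generic_quotient.repr f)).

Lemma frac_map_neq0 q : q != 0 -> phi q != 0.
Proof. by rewrite -(inj_eq phi_inj) rmorph0. Qed.

Lemma frac_mapE p q : q != 0 -> frac_map phi_inj (p%:F / q%:F) = phi p / phi q.
Proof.
move=> q0; rewrite /frac_map; set x := generic_quotient.repr _.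
have dx : \d_x != 0 by exact: denom_ratioP.
have : p%:F / q%:F = (\n_x)%:F / (\d_x)%:F by exact: frac_numden.
have neqF r : r != 0 -> r%:F != 0 by rewrite tofrac_eq0.
move/eqP; rewrite eqr_div ?neqF // -!tofracM tofrac_eq => /eqP eqx.
by apply/eqP; rewrite eqr_div ?frac_map_neq0 // -!rmorphM eqx.
Qed.

Fact frac_map_zmod : zmod_morphism (frac_map phi_inj).
Proof.
elim/frac_ind=> p q q0; elim/frac_ind=> p' q' q0'.
have neqF r : r != 0 -> r%:F != 0 by rewrite tofrac_eq0.
have -> : p%:F / q%:F - p'%:F / q'%:F = (p * q' - p' * q)%:F / (q * q')%:F.
  by rewrite tofracB !tofracM subf_div ?neqF.
by rewrite !frac_mapE ?mulf_neq0 // rmorphB !rmorphM subf_div ?frac_map_neq0.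
Qed.

Fact frac_map_monoid : monoid_morphism (frac_map phi_inj).
Proof.
split.
  rewrite -[1](_ : 1%:F / 1%:F = 1) ?frac_mapE ?oner_neq0 //.
    by rewrite rmorph1 divr1.
  by rewrite tofrac1 divr1.
elim/frac_ind=> p q q0; elim/frac_ind=> p' q' q0'.
by rewrite mulf_div -!tofracM !frac_mapE ?mulf_neq0 // !rmorphM mulf_div.
Qed.

HB.instance Definition _ := GRing.isZmodMorphism.Build {fraction R} S
  (frac_map phi_inj) frac_map_zmod.
HB.instance Definition _ := GRing.isMonoidMorphism.Build {fraction R} S
  (frac_map phi_inj) frac_map_monoid.

End FractionMap.

Section LinearSubstitution.
Variable K : fieldType.

(** The i-th variable goes to the linear form with coefficients row i of M; a
    linear form, written as a row vector v, thus goes to v *m M, and M need not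
    be square. *)
Definition lin_subst p q (M : 'M[K]_(p, q)) :
    {rmorphism {mpoly K[p]} -> {mpoly K[q]}} :=
  comp_mpoly [tuple \sum_j M i j *: 'X_j | i < p].

Lemma lin_substX p q (M : 'M[K]_(p, q)) i :
  lin_subst M 'X_i = \sum_j M i j *: 'X_j.
Proof. by rewrite /= comp_mpolyXU (nth_map i) ?size_enum_ord // nth_ord_enum. Qed.

Lemma lin_substC p q (M : 'M[K]_(p, q)) c : lin_subst M c%:MP = c%:MP.
Proof. exact: comp_mpolyC. Qed.

Lemma lin_substZ p q (M : 'M[K]_(p, q)) c u :
  lin_subst M (c *: u) = c *: lin_subst M u.
Proof. exact: comp_mpolyZ. Qed.

Lemma lin_subst_comp p q r (M : 'M[K]_(p, q)) (N : 'M[K]_(q, r)) u :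
  lin_subst N (lin_subst M u) = lin_subst (M *m N) u.
Proof.
apply: (mpoly_rmorph_eq (f := lin_subst N \o lin_subst M)) => [c|i] /=.
  by rewrite !lin_substC.
rewrite !lin_substX rmorph_sum.
under eq_bigr do rewrite lin_substZ lin_substX scaler_sumr.
rewrite exchange_big; apply: eq_bigr => j _ /=; rewrite mxE scaler_suml.
by apply: eq_bigr => k _; rewrite scalerA.
Qed.

Lemma lin_subst1 p u : lin_subst (1%:M : 'M[K]_p) u = u.
Proof.
apply: (mpoly_rmorph_eq (g := idfun)) => [c|i] /=; first exact: lin_substC.
rewrite lin_substX (bigD1 i) //= mxE eqxx scale1r big1 ?addr0 // => j neq.
by rewrite mxE eq_sym (negPf neq) scale0r.
Qed.

Lemma lin_subst_inj p q (M : 'M[K]_(p, q)) (N : 'M[K]_(q, p)) :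
  M *m N = 1%:M -> injective (lin_subst M).
Proof.
move=> MN; apply: (can_inj (g := lin_subst N)) => u.
by rewrite lin_subst_comp MN lin_subst1.
Qed.

End LinearSubstitution.
#[global] Opaque lin_subst.

Section RationalFunctions.
Variables (K : fieldType) (gT : finGroupType) (m : nat).
Variable rG : mx_representation K [set: gT]%G m.
Local Notation R := {mpoly K[m]}.
Local Notation L := {fraction {mpoly K[m]}}.

(** Linear forms are dual to V, hence the transposes: g acts on the row vector
    of a linear form by (rG g)^T, and the order of products is reversed. *)
Lemma repr_trM g h : (rG h)^T *m (rG g)^T = (rG (g * h)%g)^T.
Proof. by rewrite repr_mxM ?inE // trmx_mul. Qed.

Lemma repr_tr1 : (rG 1%g)^T = 1%:M.
Proof. by rewrite repr_mx1 trmx1. Qed.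

Lemma poly_actE g u : poly_act rG g u = lin_subst (rG g)^T u.
Proof.
rewrite /poly_act /=; congr (_ \mPo _).
by apply: eq_from_tnth => i; rewrite !tnth_mktuple; apply: eq_bigr => j _; rewrite mxE.
Qed.

Lemma poly_act_inj g : injective (lin_subst (rG g)^T).
Proof.
by apply: (@lin_subst_inj _ _ _ _ (rG (g^-1)%g)^T); rewrite repr_trM mulVg repr_tr1.
Qed.

Definition frac_subst g : {rmorphism R -> L} :=
  @FracField.tofrac R \o lin_subst (rG g)^T.

Lemma frac_subst_inj g : injective (frac_subst g).
Proof.
by move=> u v /eqP; rewrite /= tofrac_eq => /eqP; apply: poly_act_inj.
Qed.

Definition ratact g : {rmorphism L -> L} := frac_map (@frac_subst_inj g).

Lemma ratactE g (p q : R) : q != 0 -> ratact g (tofrac p / tofrac q) =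
  tofrac (lin_subst (rG g)^T p) / tofrac (lin_subst (rG g)^T q).
Proof. by move=> q0; rewrite [LHS]frac_mapE. Qed.

Lemma ratact_tofrac g (p : R) : ratact g (tofrac p) = tofrac (lin_subst (rG g)^T p).
Proof.
by rewrite -[tofrac p]divr1 -tofrac1 ratactE ?oner_neq0 // !rmorph1 divr1.
Qed.

Lemma frac_actE g f : frac_act rG g f = ratact g f.
Proof. by rewrite /frac_act !poly_actE. Qed.

Opaque ratact.

Lemma fixed_fieldE : fixed_field rG = act_fixed ratact.
Proof.
apply/seteqP; split=> f ff g; first by rewrite -frac_actE; apply: ff; rewrite inE.
by move=> _; rewrite frac_actE; apply: ff.
Qed.

Lemma ratact1 f : ratact 1%g f = f.
Proof.
by elim/frac_ind: f => p q q0; rewrite ratactE // repr_tr1 !lin_subst1.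
Qed.

Lemma ratactM g h f : ratact (g * h)%g f = ratact g (ratact h f).
Proof.
elim/frac_ind: f => p q q0.
have q0' : lin_subst (rG h)^T q != 0.
  by rewrite -(inj_eq (@poly_act_inj h)) rmorph0 in q0.
have compE u : lin_subst (rG g)^T (lin_subst (rG h)^T u) = lin_subst (rG (g * h)%g)^T u.
  by rewrite -repr_trM; apply: lin_subst_comp.
transitivity (ratact g (tofrac (lin_subst (rG h)^T p) / tofrac (lin_subst (rG h)^T q))).
  have frac_eq (u u' v v' : R) : u' = u -> v' = v ->
      tofrac u / tofrac v = tofrac u' / tofrac v' by move=> -> ->.
  apply: etrans (ratactE _ p q0) _; apply: esym.
  apply: etrans (ratactE g _ q0') _; apply: esym.
  exact: frac_eq (compE p) (compE q).
by congr (ratact g _); apply/esym/ratactE.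
Qed.

Lemma ratact_const g c : ratact g (ratconst K m c) = ratconst K m c.
Proof. by rewrite /= ratact_tofrac lin_substC. Qed.

Hypothesis rG_faithful : mx_faithful rG.

Lemma ratact_faithful : act_faithful ratact [set: L].
Proof.
move=> g g1; have [i neq] : exists i : 'I_m, lin_subst (rG g)^T 'X_i != 'X_i.
  apply: contrapT => allX; case/eqP: g1.
  apply: (mx_faithful_inj rG_faithful); rewrite ?inE // repr_mx1.
  apply/trmx_inj; rewrite trmx1; apply/matrixP => i j.
  have : lin_subst (rG g)^T 'X_i = 'X_i.
    by apply/eqP/negPn/negP => ?; apply: allX; exists i.
  move/(congr1 (mcoeff U_(j))); rewrite lin_substX raddf_sum (bigD1 j) //=.
  rewrite mcoeffZ !mcoeffXU eqxx mulr1 big1 ?addr0 => [->|k neq]; first by rewrite mxE.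
  by rewrite mcoeffZ mcoeffXU (negPf neq) mulr0.
by exists (tofrac 'X_i) => //; rewrite ratact_tofrac tofrac_eq.
Qed.

Lemma lead_deg_gt0 (u : R) : (forall c, u != c%:MP) -> (0 < mdeg (mlead u))%N.
Proof.
move=> nonC; rewrite lt0n; apply/negP => /eqP deg0.
have u0 : u != 0 by rewrite -mpolyC0.
have := mlead_deg u0; rewrite deg0 => /esym/eqP/msize_poly1P[c _ uc].
by have := nonC c; rewrite uc eqxx.
Qed.

(** The powers of the norm of a coordinate, a fixed non-constant polynomial. *)
Lemma fixed_sequence : (0 < m)%N -> exists2 z : nat -> L,
  injective z & forall k, act_fixed ratact (z k).
Proof.
move=> m0; pose i0 := Ordinal m0.
pose N : R := \prod_(h : gT) lin_subst (rG h)^T 'X_i0.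
have nonC h c : lin_subst (rG h)^T 'X_i0 != c%:MP.
  rewrite -(lin_substC (rG h)^T c) (inj_eq (@poly_act_inj h)).
  apply/eqP => /(congr1 (mcoeff U_(i0))).
  rewrite mcoeffXU mcoeffC eqxx -mdeg_eq0 mdeg1 mulr0 => /eqP.
  by rewrite oner_eq0.
have neq0 h : lin_subst (rG h)^T 'X_i0 != 0 by rewrite -mpolyC0.
have N0 : N != 0 by apply/prodf_neq0.
have dN : (0 < mdeg (mlead N))%N.
  rewrite mlead_prod => [|h _ _]; last exact: neq0.
  by rewrite mdeg_sum (bigD1 1%g) //= addn_gt0 lead_deg_gt0.
exists (fun k => tofrac (N ^+ k)).
  move=> k l /eqP; rewrite tofrac_eq => /eqP/(congr1 (fun u => mdeg (mlead u))).
  by rewrite !mleadX // !mdegMn => /eqP; rewrite eqn_pmul2l // => /eqP.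
move=> k g; rewrite ratact_tofrac rmorphXn; congr (tofrac (_ ^+ k)).
rewrite rmorph_prod [RHS](reindex_inj (mulgI g)); apply: eq_bigr => h _ /=.
by rewrite -repr_trM; apply: lin_subst_comp.
Qed.

Lemma faithful_dim_gt0 : (exists g : gT, g != 1%g) -> (0 < m)%N.
Proof.
move=> [g g1]; rewrite lt0n; apply: contraNneq g1 => m0; apply/eqP.
apply: (mx_faithful_inj rG_faithful); rewrite ?inE //.
by apply/matrixP => i; have := ltn_ord i; rewrite {2}m0.
Qed.

End RationalFunctions.

(** * Valuations and algebraic extensions *)
Section LowerFrame.
Variables (K L : fieldType) (iota : {rmorphism K -> L}).
Variables (gT : finGroupType) (act : gT -> {rmorphism L -> L}).
Hypothesis act_faith : act_faithful act [set: L].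

(** An automorphism that is trivial on all elements algebraic over E0 fixes both
    E and L0, hence their compositum L. *)
Lemma defined_over_alg_closure (E0 : set L) : defined_over iota (act_fixed act) E0 ->
  [/\ is_subfield E0, range iota `<=` E0, E0 `<=` act_fixed act,
      act_stable act (alg_over E0) & act_faithful act (alg_over E0)].
Proof.
case=> hE0 KE0 E0fix [E [hE E0E [d [_ degE]] compEL]]; split=> //.
  exact: alg_over_stable.
move=> g /act_faith[x _ nx]; apply: contrapT => triv.
have fixF y : alg_over E0 y -> act g y = y.
  by move=> Fy; apply/eqP/negPn/negP => ny; apply: triv; exists y.
have : compositum E (act_fixed act) x by rewrite compEL.
move=> /(_ [set y | act g y = y]) /= fixx; case/negP: nx; apply/eqP/fixx; split.
  exact: (fixed_by_subfield act g).
by move=> y [/(has_degree_alg hE0 hE E0E degE)/fixF | fy] //; apply: fy.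
Qed.

End LowerFrame.

(** v_sum is the form in which the ultrametric inequality acts on polynomial
    relations: the terms of a relation cannot all have distinct values. *)
Section Valuation.
Variables (L : fieldType) (G : zmodType) (v : L -> G).
Hypothesis vM : forall x y, x != 0 -> y != 0 -> v (x * y) = v x + v y.
Hypothesis v_sum : forall (I : finType) (f : I -> L), \sum_i f i = 0 ->
  (exists i, f i != 0) ->
  exists i j, [/\ i != j, f i != 0, f j != 0 & v (f i) = v (f j)].

Lemma val1 : v 1 = 0.
Proof.
by apply: (addrI (v 1)); rewrite addr0 -vM ?oner_neq0 // mulr1.
Qed.

Lemma valX x n : x != 0 -> v (x ^+ n) = v x *+ n.
Proof.
move=> x0; elim: n => [|n IHn]; first by rewrite val1.
by rewrite exprS vM ?expf_neq0 // IHn mulrS.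
Qed.

Lemma valV x : x != 0 -> v x^-1 = - v x.
Proof.
move=> x0; apply: (addrI (v x)).
by rewrite -vM ?invr_neq0 // divff // val1 subrr.
Qed.

Lemma val_div x y : x != 0 -> y != 0 -> v (x / y) = v x - v y.
Proof. by move=> x0 y0; rewrite vM ?invr_neq0 ?valV. Qed.

Lemma val_prod (I : Type) (r : seq I) (F : I -> L) :
  (forall i, F i != 0) -> v (\prod_(i <- r) F i) = \sum_(i <- r) v (F i).
Proof.
move=> F0; elim: r => [|i r IHr]; first by rewrite !big_nil val1.
rewrite !big_cons vM // ?IHr //; elim: r {IHr} => [|j r IHr].
  by rewrite big_nil oner_neq0.
by rewrite big_cons mulf_neq0.
Qed.

(** In an equation sum_i p_i x ^ i = 0, two terms have the same value, which
    expresses a multiple of v x through the values of two coefficients. *)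
Lemma val_alg (A : set L) x : is_subfield A -> alg_over A x -> x != 0 ->
  exists n a, [/\ (0 < n)%N, A a, a != 0 & v a = v x *+ n].
Proof.
move=> hA [p [p0 Ap /rootP px]] x0.
have [||i0 [j0 [neq fi fj vij]]] := v_sum (f := fun i : 'I_(size p) => p`_i * x ^+ i).
- by rewrite -horner_coef px.
- have lt_p : ((size p).-1 < size p)%N by rewrite prednK ?size_poly_gt0.
  by exists (Ordinal lt_p); rewrite mulf_neq0 ?expf_neq0 // lead_coef_eq0.
wlog lt_ij : i0 j0 neq fi fj vij / (i0 < j0)%N.
  move=> IH; have [lt_ij|lt_ji|/val_inj eq_ij] := ltngtP i0 j0.
  - exact: (IH i0 j0).
  - by apply: (IH j0 i0) => //; rewrite eq_sym.
  - by rewrite eq_ij eqxx in neq.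
move: fi fj vij; rewrite !mulf_eq0 !expf_eq0 (negPf x0) !andbF !orbF => fi fj.
rewrite !vM ?expf_neq0 // !valX // => vij.
exists (j0 - i0)%N, (p`_i0 / p`_j0); split; first by rewrite subn_gt0.
- exact: (sf_div hA).
- by rewrite mulf_neq0 ?invr_neq0.
rewrite val_div // mulrnBr ?(ltnW lt_ij) //; apply/eqP.
rewrite subr_eq addrAC eq_sym subr_eq; apply/eqP.
by rewrite vij [RHS]addrC.
Qed.

(** Distinct monomials in e have distinct values, so no polynomial relation
    between the e i satisfies v_sum. *)
Lemma val_indep (K : fieldType) (iota : {rmorphism K -> L}) r (e : 'I_r -> L) :
  (forall c, c != 0 -> v (iota c) = 0) -> (forall i, e i != 0) ->
  (forall a b : 'I_r -> nat,
     \sum_i v (e i) *+ a i = \sum_i v (e i) *+ b i -> a =1 b) ->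
  alg_independent iota e.
Proof.
move=> vC e0 ve p pe0; apply/eqP; rewrite -msupp_eq0; apply/negPn/negP => supp0.
pose s := msupp p; pose f (i : 'I_(size s)) :=
  iota p@_(nth 0%MM s i) * \prod_j e j ^+ nth 0%MM s i j.
have f0 k : (k < size s)%N -> p@_(nth 0%MM s k) != 0.
  by move=> lt_k; rewrite -mcoeff_msupp mem_nth.
have {}f0 (i : 'I_(size s)) : p@_(nth 0%MM s i) != 0 by apply: f0; apply: ltn_ord.
have e_neq0 (m : 'X_{1..r}) : \prod_j e j ^+ m j != 0.
  by apply/prodf_neq0 => j _; rewrite expf_neq0.
have vf i : v (f i) = \sum_j v (e j) *+ nth 0%MM s i j.
  rewrite vM ?fmorph_eq0 // vC // add0r val_prod => [|j]; last by rewrite expf_neq0.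
  by apply: eq_bigr => j _; rewrite valX.
have [||i [j [neq _ _]]] := v_sum (f := f).
- rewrite -{}[RHS]pe0 /mmap (big_nth 0%MM) big_mkord.
  by apply: eq_bigr => i _; rewrite /f /mmap1.
- have s_gt0 : (0 < size s)%N by rewrite lt0n size_eq0.
  by exists (Ordinal s_gt0); rewrite mulf_neq0 ?fmorph_eq0.
rewrite !vf => /ve eqm; case/eqP: neq; apply: val_inj.
have /eqP : nth 0%MM s i = nth 0%MM s j by apply/mnmP.
by rewrite nth_uniq ?msupp_uniq // => /eqP.
Qed.

End Valuation.

Section FractionValuation.
Variables (R : idomainType) (G : zmodType) (deg : R -> G).
Hypothesis degM : forall p q, p != 0 -> q != 0 -> deg (p * q) = deg p + deg q.
Hypothesis deg_sum : forall (I : finType) (f : I -> R), \sum_i f i = 0 ->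
  (exists i, f i != 0) ->
  exists i j, [/\ i != j, f i != 0, f j != 0 & deg (f i) = deg (f j)].
Local Notation L := {fraction R}.
Local Notation "x %:F" := (@FracField.tofrac R x).

(** The value of a fraction is read off a representative; by frac_valE it does
    not depend on the choice. *)
Definition frac_val (f : L) : G :=
  deg (\n_(generic_quotient.repr f)) - deg (\d_(generic_quotient.repr f)).

Lemma frac_valE p q : p != 0 -> q != 0 -> frac_val (p%:F / q%:F) = deg p - deg q.
Proof.
move=> p0 q0; rewrite /frac_val; set x := generic_quotient.repr _.
have dx : \d_x != 0 by exact: denom_ratioP.
have neqF r : r != 0 -> r%:F != 0 by rewrite tofrac_eq0.
have : p%:F / q%:F = (\n_x)%:F / (\d_x)%:F by exact: frac_numden.
move/eqP; rewrite eqr_div ?neqF // -!tofracM tofrac_eq => /eqP eqx.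
have nx : \n_x != 0.
  apply/eqP => n0; move: eqx; rewrite n0 mul0r => /eqP.
  by rewrite mulf_eq0 (negPf p0) (negPf dx).
apply/eqP; rewrite subr_eq addrAC eq_sym subr_eq.
by rewrite -degM // -eqx degM.
Qed.

Lemma frac_val_tofrac p : p != 0 -> frac_val p%:F = deg p.
Proof.
move=> p0; rewrite -[p%:F]divr1 -tofrac1 frac_valE ?oner_neq0 //.
suff -> : deg 1 = 0 by rewrite subr0.
by apply: (addrI (deg 1)); rewrite addr0 -degM ?oner_neq0 // mulr1.
Qed.

Lemma frac_neq0 p q : q != 0 -> (p%:F / q%:F != 0) = (p != 0).
Proof. by move=> q0; rewrite mulf_eq0 invr_eq0 !tofrac_eq0 (negPf q0) orbF. Qed.

Lemma frac_valM f g : f != 0 -> g != 0 -> frac_val (f * g) = frac_val f + frac_val g.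
Proof.
elim/frac_ind: f => p q q0; elim/frac_ind: g => p' q' q0'.
rewrite !frac_neq0 // => p0 p0'; rewrite mulf_div -!tofracM !frac_valE ?mulf_neq0 //.
by rewrite !degM // opprD addrACA.
Qed.

Lemma common_denominator_frac (I : finType) (f : I -> L) :
  exists (p : I -> R) q, q != 0 /\ forall i, f i = (p i)%:F / q%:F.
Proof.
pose d i := \d_(generic_quotient.repr (f i)).
have d0 i : d i != 0 by exact: denom_ratioP.
have dF i : (d i)%:F != 0 by rewrite tofrac_eq0.
exists (fun i => \n_(generic_quotient.repr (f i)) * \prod_(j | j != i) d j).
exists (\prod_j d j); split=> [|i]; first by apply/prodf_neq0.
have dE : \prod_j d j = d i * \prod_(j | j != i) d j by rewrite (bigD1 i).
rewrite [LHS]frac_numden -/(d i) dE !tofracM.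
have prod0 : (\prod_(j | j != i) d j)%:F != 0.
  by rewrite tofrac_eq0; apply/prodf_neq0.
by rewrite -mulf_div divff // mulr1.
Qed.

Lemma frac_val_sum (I : finType) (f : I -> L) : \sum_i f i = 0 ->
  (exists i, f i != 0) ->
  exists i j, [/\ i != j, f i != 0, f j != 0 & frac_val (f i) = frac_val (f j)].
Proof.
have [p [q [q0 fE]]] := common_denominator_frac f.
have qF : q%:F != 0 by rewrite tofrac_eq0.
under eq_bigr do rewrite fE; rewrite -mulr_suml => /eqP.
rewrite mulf_eq0 invr_eq0 (negPf qF) orbF -rmorph_sum tofrac_eq0 => /eqP sum0.
move=> [i]; rewrite fE frac_neq0 // => pi0.
have [|k [l [neq pk pl eqd]]] := deg_sum sum0; first by exists i.
by exists k, l; rewrite !fE !frac_neq0 // !frac_valE // eqd.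
Qed.

End FractionValuation.

(** * Leading monomials and the field of constants *)
(** A term with maximal leading monomial would otherwise contribute its leading
    coefficient to the sum. *)
Lemma mlead_collision (K : fieldType) q (I : finType) (f : I -> {mpoly K[q]}) :
  \sum_i f i = 0 -> (exists i, f i != 0) ->
  exists i j, [/\ i != j, f i != 0, f j != 0 & mlead (f i) = mlead (f j)].
Proof.
move=> sum0 [i0 fi0].
case: (@Order.TotalTheory.arg_maxP _ _ _ i0 (fun i => f i != 0) (fun i => mlead (f i)) fi0).
move=> i fi maxi; apply: contrapT => noColl.
have : (\sum_j f j)@_(mlead (f i)) = 0 by rewrite sum0 mcoeff0.
rewrite raddf_sum (bigD1 i) //= big1 => [|j neq]; last first.
  have [->|fj] := eqVneq (f j) 0; first by rewrite mcoeff0.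
  apply: mcoeff_gt_mlead; rewrite Order.POrderTheory.lt_neqAle.
  apply/andP; split; last exact: maxi.
  by apply/eqP => eqm; apply: noColl; exists j, i.
by rewrite addr0 => /eqP; rewrite mleadc_eq0 (negPf fi).
Qed.

Section LexValuation.
Variables (K : fieldType) (m q : nat) (psi : {rmorphism {mpoly K[m]} -> {mpoly K[q]}}).
Hypothesis psi_inj : injective psi.
Hypothesis psiC : forall c, psi c%:MP = c%:MP.
Local Notation R := {mpoly K[m]}.
Local Notation L := {fraction {mpoly K[m]}}.
Local Notation iota := (ratconst K m).

Definition exponents (u : 'X_{1..q}) : 'rV[int]_q := \row_j (u j)%:Z.

Lemma exponents_inj : injective exponents.
Proof. by move=> u w /rowP eq; apply/mnmP => j; have := eq j; rewrite !mxE => -[]. Qed.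

(** The leading exponent after a change of variables psi, which below is a
    change to a basis of common eigenvectors. *)
Definition lex_deg (p : R) := exponents (mlead (psi p)).

Lemma psi_neq0 p : (psi p != 0) = (p != 0).
Proof. by rewrite -(inj_eq psi_inj) rmorph0. Qed.

Lemma lex_degM p p' : p != 0 -> p' != 0 -> lex_deg (p * p') = lex_deg p + lex_deg p'.
Proof.
rewrite -psi_neq0 -(psi_neq0 p') /lex_deg rmorphM => p0 p0'; rewrite mleadM //.
by apply/rowP => j; rewrite !mxE mnmDE PoszD.
Qed.

Lemma lex_deg_sum (I : finType) (f : I -> R) : \sum_i f i = 0 ->
  (exists i, f i != 0) ->
  exists i j, [/\ i != j, f i != 0, f j != 0 & lex_deg (f i) = lex_deg (f j)].
Proof.
move=> sum0 [i fi]; have [||k [l []]] := @mlead_collision K q I (psi \o f).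
- by rewrite /= -rmorph_sum sum0 rmorph0.
- by exists i; rewrite /= psi_neq0.
rewrite /= !psi_neq0 => neq fk fl eqm.
by exists k, l; rewrite /lex_deg eqm.
Qed.

Definition lex_val : L -> 'rV[int]_q := frac_val lex_deg.
Definition lex_valM := frac_valM lex_degM.
Definition lex_val_sum := frac_val_sum lex_degM lex_deg_sum.

Lemma lex_val_const c : c != 0 -> lex_val (iota c) = 0.
Proof.
move=> c0; rewrite /lex_val /= (frac_val_tofrac lex_degM) ?mpolyC_eq0 //.
by apply/rowP => j; rewrite /lex_deg psiC mleadC !mxE mnm0E.
Qed.

End LexValuation.

Lemma mulrn_int_row_eq0 q (u : 'rV[int]_q) n : (0 < n)%N -> u *+ n = 0 -> u = 0.
Proof.
move=> n0 /rowP un; apply/rowP => j; have := un j.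
rewrite mulmxnE !mxE => /eqP.
by rewrite Num.Theory.mulrn_eq0 (gtn_eqF n0) => /eqP.
Qed.

Section ConstantsAlgebraicallyClosed.
Variables (K : fieldType) (m : nat).
Local Notation iota := (ratconst K m).

Lemma range_subfield (F L : fieldType) (f : {rmorphism F -> L}) : is_subfield (range f).
Proof.
split=> [|_ _ [x _ <-] [y _ <-]|_ _ [x _ <-] [y _ <-]].
- by exists 1 => //; rewrite rmorph1.
- by exists (x - y) => //; rewrite rmorphB.
- by exists (x / y) => //; rewrite fmorph_div.
Qed.

(** An algebraic x has value 0, so x = p / q where p and q have the same leading
    monomial.  For c the quotient of the leading coefficients, x - c is
    algebraic too; a nonzero x - c would have a numerator p - c q with the
    same leading monomial, and that monomial cancels. *)
Lemma alg_over_constants x : alg_over (range iota) x -> range iota x.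
Proof.
pose v := lex_val (@idfun {mpoly K[m]} : {rmorphism {mpoly K[m]} -> {mpoly K[m]}}).
have idinj : injective (@idfun {mpoly K[m]}) by [].
have hK := range_subfield iota.
have v_alg y : alg_over (range iota) y -> y != 0 -> v y = 0.
  move=> ay y0.
  have [n [_ [n0 [c _ <-] c0 vn]]] :=
    val_alg (lex_valM idinj) (lex_val_sum idinj) hK ay y0.
  apply: (mulrn_int_row_eq0 n0); rewrite -vn; apply: lex_val_const => //.
  by apply: contraNneq c0 => ->; rewrite rmorph0.
elim/frac_ind: x => p q q0 ax.
have [p0|p0] := eqVneq p 0.
  by rewrite p0 tofrac0 mul0r; apply: (sf0 hK).
have degE r : r != 0 -> alg_over (range iota) (tofrac r / tofrac q) ->
    mlead r = mlead q.
  move=> r0 /v_alg; rewrite frac_neq0 // => /(_ r0); rewrite /v /lex_val.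
  rewrite (frac_valE (lex_degM idinj)) // => /eqP; rewrite subr_eq0 => /eqP.
  exact: exponents_inj.
have lead_pq := degE p p0 ax; pose c := mleadc p / mleadc q.
have qc : mleadc q != 0 by rewrite mleadc_eq0.
exists c => //; apply/eqP; rewrite eq_sym -subr_eq0.
have subE : tofrac p / tofrac q - iota c = tofrac (p - c *: q) / tofrac q.
  have qF : tofrac q != 0 by rewrite tofrac_eq0.
  by rewrite -mul_mpolyC tofracB tofracM mulrBl mulfK.
rewrite subE; apply: contraT; rewrite frac_neq0 // => r0.
have : mlead (p - c *: q) = mlead q.
  apply: degE; first exact: r0.
  rewrite -subE; apply: (sfB (alg_over_subfield hK)); first exact: ax.
  by apply: (alg_over_base hK); exists c.
move=> lead_r; move: r0; rewrite -mleadc_eq0 lead_r mcoeffB mcoeffZ.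
by rewrite /c lead_pq divfK // subrr eqxx.
Qed.

End ConstantsAlgebraicallyClosed.

(** A relation in one variable, rewritten as a univariate polynomial. *)
Lemma not_indep_alg (K L : fieldType) (iota : {rmorphism K -> L}) (x : L) :
  ~ alg_independent iota (fun _ : 'I_1 => x) -> alg_over (range iota) x.
Proof.
move=> /existsNP[p /not_implyP[px /eqP p0]].
pose r : {poly L} := \sum_(u <- msupp p) (iota p@_u)%:P * 'X^(u ord0).
have rE k : r`_k = \sum_(u <- msupp p) iota p@_u * (k == u ord0)%:R.
  by rewrite coef_sum; apply: eq_bigr => u _; rewrite coefCM coefXn.
exists r; split.
- have := mlead_supp p0; set u := mlead p => u_supp.
  apply: contraTneq isT => r0; have := rE (u ord0).
  rewrite r0 coef0 (bigD1_seq u) ?msupp_uniq //= eqxx mulr1 big1_seq ?addr0.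
    by move/esym/eqP; rewrite fmorph_eq0 mleadc_eq0 (negPf p0).
  move=> w /andP[neq _]; case: eqP => [eq|]; last by rewrite mulr0.
  by case/eqP: neq; apply/mnmP => i; rewrite ord1.
- move=> k; rewrite rE; apply: (sf_sum (range_subfield iota)) => u _.
  apply: (sfM (range_subfield iota)); first by exists p@_u.
  case: eqP => _; last exact: (sf0 (range_subfield iota)).
  exact: (sf1 (range_subfield iota)).
- apply/rootP; rewrite -[RHS]px horner_sum /mmap; apply: eq_bigr => u _.
  by rewrite hornerCM hornerXn /mmap1 big_ord1.
Qed.

Lemma alg_overS (L : fieldType) (A B : set L) : A `<=` B -> alg_over A `<=` alg_over B.
Proof. by move=> AB x [p [p0 Ap px]]; exists p; split=> // i; apply: AB. Qed.

Section TrdegPositive.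
Variables (K : fieldType) (gT : finGroupType) (m : nat).
Variable rG : mx_representation K [set: gT]%G m.
Hypothesis rG_faithful : mx_faithful rG.

Lemma trdeg_gt0 E0 d : (exists g : gT, g != 1%g) ->
  defined_over (ratconst K m) (fixed_field rG) E0 ->
  has_trdeg (ratconst K m) E0 d -> (0 < d)%N.
Proof.
move=> [g g1]; rewrite fixed_fieldE => def [_ maxd].
have [hE0 _ _ _ faith] :=
  defined_over_alg_closure (ratact_faithful rG_faithful) def.
rewrite lt0n; apply/negP => /eqP d0.
(* Every element of E0 is algebraic over K, hence a constant. *)
have E0K : E0 `<=` range (ratconst K m).
  move=> x E0x; apply: alg_over_constants; apply: not_indep_alg => indep.
  by have := maxd 1%N _ (fun=> E0x) indep; rewrite d0.
have [x Fx] := faith g g1.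
have [c _ <-] : range (ratconst K m) x.
  apply: alg_over_constants; apply: alg_overS Fx => y /E0K Ky.
  exact: Ky.
by rewrite ratact_const eqxx.
Qed.

End TrdegPositive.

(** * Commuting involutions and leading monomials *)
Section DiagonalSubstitution.
Variables (K : fieldType) (m : nat).

(** The scalar by which the diagonal substitution d multiplies a monomial. *)
Definition monomial_char (d : 'rV[K]_m) (u : 'X_{1..m}) := \prod_k d 0 k ^+ u k.

Lemma lin_subst_diag_coef (d : 'rV[K]_m) (p : {mpoly K[m]}) u :
  (lin_subst (diag_mx d) p)@_u = monomial_char d u * p@_u.
Proof.
have diagX i : lin_subst (diag_mx d) 'X_i = (d 0 i) *: 'X_i.
  rewrite lin_substX (bigD1 i) //= mxE eqxx big1 ?addr0 // => j neq.
  by rewrite mxE eq_sym (negPf neq) scale0r.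
have diagXm w : lin_subst (diag_mx d) 'X_[w] = monomial_char d w *: 'X_[w].
  rewrite mpolyXE_id rmorph_prod -scaler_prod; apply: eq_bigr => i _.
  by rewrite rmorphXn diagX exprZn.
rewrite [p in LHS]mpolyE rmorph_sum raddf_sum /=.
have -> : p@_u = (\sum_(w <- msupp p) p@_w *: 'X_[w])@_u by rewrite -mpolyE.
rewrite raddf_sum mulr_sumr; apply: eq_bigr => w _ /=.
rewrite lin_substZ diagXm !mcoeffZ mcoeffX; case: eqP => [->|_]; first exact: mulrCA.
by rewrite !mulr0.
Qed.

(** P / R is an eigenvector for a; comparing the coefficients at the sum of the
    leading monomials of P and R shows that these monomials differ by the
    character a. *)
Lemma diag_eigenvector_lead (d : 'rV[K]_m) (P R : {mpoly K[m]}) a :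
  P != 0 -> R != 0 ->
  lin_subst (diag_mx d) P * R = a *: (P * lin_subst (diag_mx d) R) ->
  monomial_char d (mlead P) = a * monomial_char d (mlead R).
Proof.
move=> P0 R0.
have lead_le r : (mlead (lin_subst (diag_mx d) r) <= mlead r)%O.
  have [->|r0] := eqVneq (lin_subst (diag_mx d) r) 0.
    by rewrite mlead0; apply: Order.BPreorderTheory.le0x.
  have := mlead_supp r0; rewrite mcoeff_msupp lin_subst_diag_coef mulf_eq0 negb_or.
  by case/andP => _; rewrite -mcoeff_msupp => /msupp_le_mlead.
move=> /(congr1 (mcoeff (mlead P + mlead R))); rewrite mcoeffZ.
rewrite !mleadcMW ?lead_le ?Order.POrderTheory.lexx //.
rewrite !lin_subst_diag_coef => eqPR.
have PR : mleadc P * mleadc R != 0 by rewrite mulf_neq0 // mleadc_eq0.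
by apply: (mulIf PR); rewrite mulrA eqPR -!mulrA; congr (_ * _); rewrite mulrCA.
Qed.

Lemma eigenvector_lead (M Q : 'M[K]_m) (d : 'rV[K]_m) (p q : {mpoly K[m]}) a :
  injective (lin_subst Q) -> M *m Q = Q *m diag_mx d -> p != 0 -> q != 0 ->
  lin_subst M p * q = a *: (p * lin_subst M q) ->
  monomial_char d (mlead (lin_subst Q p)) = a * monomial_char d (mlead (lin_subst Q q)).
Proof.
move=> Qinj MQ p0 q0 pq.
have neq0 r : r != 0 -> lin_subst Q r != 0 by rewrite -(inj_eq Qinj) rmorph0.
have compE w : lin_subst Q (lin_subst M w) = lin_subst (diag_mx d) (lin_subst Q w).
  apply: etrans (lin_subst_comp M Q w) _; rewrite MQ.
  exact/esym/lin_subst_comp.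
apply: diag_eigenvector_lead; [exact: neq0 | exact: neq0 |].
have subst_eq (A A' B B' C D : {mpoly K[m]}) : A = A' -> B = B' ->
    A * C = a *: (D * B) -> A' * C = a *: (D * B') by move=> <- <-.
apply: (subst_eq _ _ _ _ _ _ (compE p) (compE q)).
apply: etrans (esym (rmorphM (lin_subst Q) (lin_subst M p) q)) _.
apply: etrans (congr1 (lin_subst Q) pq) _.
apply: etrans (lin_substZ _ _ _) _; congr (a *: _).
exact: (rmorphM (lin_subst Q) p (lin_subst M q)).
Qed.

End DiagonalSubstitution.

Section Involutions.
Variable K : fieldType.
Hypothesis char2 : (2%:R : K) != 0.

Lemma neg1_neq1 : (-1 : K) != 1.
Proof. by rewrite -subr_eq0 -opprD oppr_eq0. Qed.

(** Every v is half of (v + v M) + (v - v M). *)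
Lemma involution_diagonalizable m (M : 'M[K]_m) : M *m M = 1%:M -> diagonalizable M.
Proof.
move=> MM; apply/diagonalizablePeigen; exists [:: 1; -1].
  by rewrite /= inE eq_sym neg1_neq1.
apply/eqmxP; rewrite submx1 /= big_cons big_seq1.
have inE1 : ((1%:M + M)%R <= eigenspace M 1)%MS.
  by apply/eigenspaceP; rewrite mulmxDl MM mul1mx scale1r addrC.
have inE2 : ((1%:M - M)%R <= eigenspace M (-1)%R)%MS.
  by apply/eigenspaceP; rewrite mulmxBl MM mul1mx scaleN1r opprB.
have -> : 1%:M = 2%:R^-1 *: ((1%:M + M) + (1%:M - M)) :> 'M[K]_m.
  by rewrite addrACA subrr addr0 -mulr2n -scaler_nat scalerA mulVf // scale1r.
by apply/scalemx_sub/addmx_sub_adds.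
Qed.

Lemma commuting_involutions_diagonalize m r (M : 'I_r -> 'M[K]_m) :
  (forall i, M i *m M i = 1%:M) -> (forall i j, M i *m M j = M j *m M i) ->
  exists (Q Q' : 'M[K]_m) (s : 'I_r -> 'I_m -> bool), Q *m Q' = 1%:M /\
    forall i, M i *m Q = Q *m diag_mx (\row_k (-1) ^+ s i k).
Proof.
move=> M2 MC.
have /codiagonalizableP[P Pu /allP PD] :
    {in map M (enum 'I_r) &, forall A B, comm_mx A B} /\
    {in map M (enum 'I_r), forall A, diagonalizable A}.
  split=> [_ _ /mapP[i _ ->] /mapP[j _ ->]|_ /mapP[i _ ->]]; first exact: MC.
  exact: involution_diagonalizable.
have MD i : exists d : 'rV[K]_m, P *m M i = diag_mx d *m P.
  have /diagonalizable_forPex[d /(simmxP Pu) PM] := PD (M i) (map_f M (mem_enum _ i)).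
  by exists d.
have /choice[d dE] := MD.
have d2 i k : (d i 0 k) ^+ 2 = 1.
  have /matrixP/(_ k k) : diag_mx (d i) *m diag_mx (d i) = 1%:M.
    apply: (can_inj (mulmxK Pu)).
    by rewrite -mulmxA -dE mulmxA -dE -mulmxA M2 mulmx1 mul1mx.
  by rewrite mulmx_diag !mxE eqxx expr2.
have d1 i k : d i 0 k = (-1) ^+ (d i 0 k != 1).
  have /eqP := d2 i k; rewrite sqrf_eq1 => /orP[]/eqP->; first by rewrite eqxx.
  by rewrite neg1_neq1.
(* The sign bit of an eigenvalue that is known to be 1 or -1. *)
exists (invmx P), P, (fun i k => d i 0 k != 1); split; first exact: mulVmx.
move=> i; have -> : \row_k (-1) ^+ (d i 0 k != 1) = d i.
  by apply/rowP => k; rewrite mxE -d1.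
by apply: (can_inj (mulKmx Pu)); rewrite mulmxA dE mulmxK // mulKVmx.
Qed.

End Involutions.

Section Flips.
Variable n : nat.
Local Notation r := n./2.

(** Exchanges 2k and 2k+1 when b holds; flip_perm does so for each k according to
    the k-th bit of a vector, which embeds (Z/2) ^ n./2 in S_n. *)
Definition flip (b : bool) x := if b then (if odd x then x.-1 else x.+1) else x.

Lemma half_flip b x : (flip b x)./2 = x./2.
Proof. by rewrite /flip; case: b => //; case: ifP => ox; lia. Qed.

Lemma flip_flip b c x : flip b (flip c x) = flip (b (+) c) x.
Proof.
case: b; case: c => //=; case ox: (odd x); rewrite /flip ?ox //=.
  by case: x ox => // x /= /negPf->.
by rewrite ox.
Qed.

Definition bits (b : {ffun 'I_r -> bool}) k := if insub k is Some i then b i else false.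

Lemma flip_lt b x : (x < n)%N -> (flip (bits b x./2) x < n)%N.
Proof.
rewrite /bits /flip => ltx; case: insubP => // i lt_r _.
by case: (b i) => //; case: ifP => ox; lia.
Qed.

Definition flip_ord b (x : 'I_n) : 'I_n := Ordinal (flip_lt b (ltn_ord x)).

Definition xorf (b c : {ffun 'I_r -> bool}) := [ffun i => b i (+) c i].

Lemma flip_ord_comp b c x : flip_ord b (flip_ord c x) = flip_ord (xorf b c) x.
Proof.
apply: val_inj; rewrite /= half_flip flip_flip /bits.
by case: insubP => // i _ _; rewrite ffunE.
Qed.

Lemma flip_ordK b : involutive (flip_ord b).
Proof.
move=> x; rewrite flip_ord_comp; apply: val_inj => /=; rewrite /bits.
by case: insubP => // i _ _; rewrite ffunE addbb.
Qed.

Definition flip_perm b : 'S_n := perm (inv_inj (flip_ordK b)).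

Lemma flip_permM b c : (flip_perm b * flip_perm c)%g = flip_perm (xorf b c).
Proof.
apply/permP => x; rewrite permM !permE flip_ord_comp; congr (flip_ord _ x).
by apply/ffunP => i; rewrite !ffunE addbC.
Qed.

Lemma xorfb b : xorf b b = [ffun=> false].
Proof. by apply/ffunP => i; rewrite !ffunE addbb. Qed.

Lemma flip_perm_inj : injective flip_perm.
Proof.
move=> b c /permP eqp; apply/ffunP => i.
have lti : ((i : nat).*2 < n)%N by have := ltn_ord i; lia.
have := congr1 val (eqp (Ordinal lti)).
rewrite !permE /= /bits doubleK; case: insubP => [j _ vj|]; last by rewrite ltn_ord.
have -> : j = i by apply: val_inj.
by rewrite /flip odd_double; case: (b i); case: (c i) => //; lia.
Qed.

Lemma flip_perm0 : flip_perm [ffun=> false] = 1%g.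
Proof.
apply/permP => x; rewrite permE perm1; apply: val_inj => /=.
by rewrite /bits; case: insubP => // i _ _; rewrite ffunE.
Qed.

Definition single (i : 'I_r) : {ffun 'I_r -> bool} := [ffun j => j == i].

End Flips.

(** * The bound n./2 outside characteristic 2 *)
Section FlipEigenvectors.
Variables (L : fieldType) (n : nat) (act : 'S_n -> {rmorphism L -> L}).
Hypothesis act1 : forall x, act 1%g x = x.
Hypothesis actM : forall g h x, act (g * h)%g x = act g (act h x).
Variables (F : set L) (hF : is_subfield F).
Hypotheses (Fst : act_stable act F) (Ffaith : act_faithful act F).

(** The projection of x on the j-th character of (Z/2) ^ n./2 is a sum of
    distinct automorphisms with nonzero coefficients, so it is nonzero for some
    x in F. *)
Lemma flip_eigenvector (j : 'I_n./2) : exists f : L, [/\ F f, f != 0 &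
  forall i, act (flip_perm (single i)) f = (-1) ^+ (i == j) * f].
Proof.
pose f x := \sum_(b : {ffun 'I_n./2 -> bool}) (-1) ^+ b j * act (flip_perm b) x.
have [x Fx fx] : exists2 x, F x & f x != 0.
  apply: contrapT => f0.
  suff /(_ [ffun=> false])/eqP :
      forall b : {ffun 'I_n./2 -> bool}, ((-1) ^+ b j : L) = 0.
    by rewrite signr_eq0.
  apply: (dedekind_indep (s := fun b => act (flip_perm b)) (sf1 hF) (sfM hF)).
    move=> b c neq; apply: (act_distinct act1 actM Ffaith).
    by rewrite (inj_eq (@flip_perm_inj n)).
  by move=> x Fx; apply/eqP/negPn/negP => fx; apply: f0; exists x.
exists (f x); split=> // [|i].
  apply: (sf_sum hF) => b _; apply: (sfM hF); last exact: Fst.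
  by apply/(sfX hF)/(sfN hF)/(sf1 hF).
have xorK : involutive (xorf (single i)).
  by move=> b; apply/ffunP => k; rewrite !ffunE addKb.
rewrite /f rmorph_sum mulr_sumr [RHS](reindex_inj (inv_inj xorK)).
apply: eq_bigr => b _; rewrite rmorphM rmorphXn rmorphN rmorph1 -actM flip_permM.
by rewrite ffunE ffunE [j == i]eq_sym signr_addb mulrA signrMK.
Qed.

End FlipEigenvectors.

Lemma natr_F2 k : (k%:R : 'F_2) = (odd k)%:R.
Proof.
apply: val_inj; rewrite /= (val_Fp_nat (isT : prime 2)) modn2.
by rewrite (val_Fp_nat (isT : prime 2)) modn2 oddb.
Qed.

Lemma parity_F2 m (s : 'I_m -> bool) (A B : 'I_m -> nat) (b : bool) :
  odd (\sum_k s k * A k)%N = b (+) odd (\sum_k s k * B k)%N ->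
  ((\sum_k (s k)%:Z * ((A k)%:Z - (B k)%:Z))%:~R : 'F_2) = b%:R.
Proof.
move=> parity.
have -> : \sum_k (s k)%:Z * ((A k)%:Z - (B k)%:Z) =
    (\sum_k s k * A k)%N%:Z - (\sum_k s k * B k)%N%:Z.
  rewrite !(big_morph Posz PoszD (erefl 0%:Z)) -sumrB.
  by apply: eq_bigr => k _; rewrite !PoszM mulrBr.
rewrite intrB -!pmulrn [X in X - _]natr_F2 [X in _ - X]natr_F2 parity.
by case: b {parity}; case: (odd _); apply/val_inj.
Qed.

Lemma int_scale_diff (x : int) (a b n : nat) :
  ((a%:Z - b%:Z) * n%:Z) * x = x *+ n *+ a - x *+ n *+ b.
Proof. by rewrite -!mulrnA -!(mulr_natr x) !natz !PoszM; ring. Qed.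

Section HalfBound.
Variables (K : fieldType) (n m : nat).
Hypothesis char2 : (2%:R : K) != 0.
Variable rG : mx_representation K [set: 'S_n]%G m.
Local Notation R := {mpoly K[m]}.
Local Notation L := {fraction {mpoly K[m]}}.

Lemma sign_inj (b c : bool) : (-1) ^+ b = (-1) ^+ c :> K -> b = c.
Proof.
have := negPf (neg1_neq1 char2).
case: b c => [] [] // neq /eqP; first by rewrite expr1 expr0 neq.
by rewrite expr1 expr0 eq_sym neq.
Qed.

Lemma monomial_char_sign (s : 'I_m -> bool) (u : 'X_{1..m}) :
  monomial_char (\row_k (-1) ^+ s k : 'rV[K]_m) u = (-1) ^+ odd (\sum_k s k * u k)%N.
Proof.
rewrite signr_odd expr_sum; apply: eq_bigr => k _.
by rewrite mxE -exprM.
Qed.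

(** s marks the eigenvectors negated by g, so the sum is the number of negated
    factors in the leading monomial of f; its parity is the sign of g on f. *)
Lemma lex_val_parity g (Q : 'M[K]_m) (s : 'I_m -> bool) (f : L) (b : bool) :
  injective (lin_subst Q) ->
  (rG g)^T *m Q = Q *m diag_mx (\row_k (-1) ^+ s k) -> f != 0 ->
  ratact rG g f = (-1) ^+ b * f ->
  ((\sum_k (s k)%:Z * lex_val (lin_subst Q) f 0 k)%:~R : 'F_2) = b%:R.
Proof.
move=> Qinj MQ; elim/frac_ind: f => p q q0; rewrite frac_neq0 // => p0.
set M := (rG g)^T in MQ *.
have Mq0 : lin_subst M q != 0 by rewrite -(inj_eq (@poly_act_inj _ _ _ rG g)) rmorph0 in q0.
move=> /(etrans (esym (ratactE rG g p q0))) actf.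
have pq : lin_subst M p * q = (-1) ^+ b *: (p * lin_subst M q).
  have signF : ((-1) ^+ b * (tofrac p / tofrac q) : L) =
      tofrac ((-1) ^+ b *: p) / tofrac q.
    by rewrite mulrA scaler_sign mulr_sign; case: (b); rewrite ?tofracN.
  move/eqP: actf; rewrite signF eqr_div ?tofrac_eq0 // -!tofracM tofrac_eq.
  by move=> /eqP ->; rewrite scalerAl.
have := eigenvector_lead Qinj MQ p0 q0 pq.
rewrite !monomial_char_sign -signr_addb => /sign_inj parity.
have valE k : lex_val (lin_subst Q) (tofrac p / tofrac q) 0 k =
    (mlead (lin_subst Q p) k)%:Z - (mlead (lin_subst Q q) k)%:Z.
  rewrite /lex_val (frac_valE (lex_degM Qinj)) // /lex_deg.
  by rewrite !mxE.
apply: etrans (parity_F2 parity).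
by congr (_%:~R); apply: eq_bigr => k _; rewrite valE.
Qed.

(** U *m S is the identity modulo 2, so its determinant is odd. *)
Lemma int_rows_free r q (U : 'M[int]_(r, q)) (S : 'M[int]_(q, r)) (z : 'rV[int]_r) :
  (forall i j, ((U *m S) i j)%:~R = (i == j)%:R :> 'F_2) -> z *m U = 0 -> z = 0.
Proof.
move=> US zU; have detUS : \det (U *m S) != 0.
  have : (\det (U *m S))%:~R = 1 :> 'F_2.
    rewrite -[LHS](det_map_mx (intmul (1 : 'F_2))) -[RHS](det1 'F_2 r).
    by congr (\det _); apply/matrixP => i j; apply: etrans (mxE _ _ i j) (etrans (US i j) _); rewrite mxE.
  by apply: contra_eq_neq => ->; rewrite mulr0z eq_sym oner_eq0.
have : z *m (U *m S) *m \adj (U *m S) = 0 by rewrite mulmxA zU !mul0mx.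
rewrite -mulmxA mul_mx_adj mul_mx_scalar => /eqP.
by rewrite scalemx_eq0 (negPf detUS) => /eqP.
Qed.

(** The exponents of the eigenfunctions f j are linearly independent, and
    suitable positive multiples of them are the exponents of elements of E0. *)
Lemma trdeg_ge_half E0 d : mx_faithful rG ->
  defined_over (ratconst K m) (fixed_field rG) E0 ->
  has_trdeg (ratconst K m) E0 d -> (n./2 <= d)%N.
Proof.
move=> rG_faithful; rewrite fixed_fieldE => def [_ maxd].
have [hE0 KE0 E0fix Fst Ff] :=
  defined_over_alg_closure (ratact_faithful rG_faithful) def.
have hF := alg_over_subfield hE0.
pose T (i : 'I_n./2) := flip_perm (single i).
have /choice[f fP] :=
  flip_eigenvector (@ratact1 _ _ _ rG) (@ratactM _ _ _ rG) hF Fst Ff.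
have T2 i : (T i * T i)%g = 1%g by rewrite flip_permM xorfb flip_perm0.
have TC i j : (T i * T j)%g = (T j * T i)%g.
  rewrite !flip_permM; congr flip_perm.
  by apply/ffunP => k; rewrite !ffunE addbC.
have [Q [Q' [s [QQ' MQ]]]] :
    exists (Q Q' : 'M[K]_m) (s : 'I_n./2 -> 'I_m -> bool), Q *m Q' = 1%:M /\
    forall i, (rG (T i))^T *m Q = Q *m diag_mx (\row_k (-1) ^+ s i k).
  apply: commuting_involutions_diagonalize => // [i|i j].
    by rewrite repr_trM T2 repr_tr1.
  by rewrite !repr_trM TC.
have Qinj := lin_subst_inj QQ'.
pose v := lex_val (lin_subst Q).
have vM := lex_valM Qinj; have vS := lex_val_sum Qinj.
have /choice[ne neP] : forall j, exists ne : nat * {fraction {mpoly K[m]}},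
    [/\ (0 < ne.1)%N, E0 ne.2, ne.2 != 0 & v ne.2 = v (f j) *+ ne.1].
  move=> j; have [Ff_j f0 _] := fP j.
  have [k [e [k0 E0e e0 ve]]] := val_alg vM vS hE0 Ff_j f0.
  by exists (k, e).
apply: (maxd _ (fun j => (ne j).2)) => [j|]; first by case: (neP j).
apply: (val_indep vM vS) => [c|j|a b].
- exact: (lex_val_const Qinj (lin_substC Q)).
- by case: (neP j).
rewrite -/v => vab.
pose U := \matrix_(j < n./2) v (f j).
pose S := \matrix_(k < m, i < n./2) (s i k)%:Z.
pose z := \row_(j < n./2) (((a j)%:Z - (b j)%:Z) * (ne j).1%:Z).
have US i j : ((U *m S) i j)%:~R = (i == j)%:R :> 'F_2.
  have [_ fi0 /(_ j) actf] := fP i.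
  have <- := lex_val_parity Qinj (MQ j) fi0 (etrans actf _).
    rewrite mxE; congr (_%:~R); apply: eq_bigr => k _.
    by rewrite !mxE mulrC.
  by rewrite eq_sym.
have zU : z *m U = 0.
  rewrite mulmx_sum_row; transitivity (\sum_j (v (ne j).2 *+ a j - v (ne j).2 *+ b j)).
    apply: eq_bigr => j _; have [_ _ _ ->] := neP j.
    rewrite mxE rowK; apply/rowP => k.
    rewrite [RHS]mxE mulmxnE mulmxnE; apply: etrans (mxE _ _ 0 k) _.
    rewrite [X in _ = _ + X]mxE mulmxnE mulmxnE; exact: int_scale_diff.
  by rewrite sumrB vab subrr.
have /rowP z0 := int_rows_free US zU.
move=> j; have [k0 _ _ _] := neP j; have := z0 j; rewrite !mxE => /eqP.
rewrite mulf_eq0 subr_eq0 eqz_nat => /orP[/eqP//|].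
by rewrite eqz_nat gtn_eqF.
Qed.

End HalfBound.

(** * Valuations invariant under a rotation of order 3 *)
Import Num.Theory Order.TTheory.

Section DiscreteValuation.
Variables (K L : fieldType) (iota : {rmorphism K -> L}) (w : L -> int).
Hypothesis wM : forall x y, x != 0 -> y != 0 -> w (x * y) = w x + w y.
Hypothesis w_sum : forall (I : finType) (f : I -> L), \sum_i f i = 0 ->
  (exists i, f i != 0) ->
  exists i j, [/\ i != j, f i != 0, f j != 0 & w (f i) = w (f j)].
(** Makes 0 smaller than everything; k = 0 and k = -1 give the valuation ring
    and its maximal ideal. *)
Definition val_le x (k : int) := (x == 0) || (w x <= k).
Hypothesis val_leD : forall x y k, val_le x k -> val_le y k -> val_le (x + y) k.
Hypothesis wC : forall c, c != 0 -> w (iota c) = 0.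

Definition has_residue x c := val_le (x - iota c) (-1).

Hypothesis algebraic_residue : forall x (r : {poly K}), x != 0 -> w x = 0 ->
  r != 0 -> val_le (map_poly iota r).[x] (-1) -> exists c, has_residue x c.

Lemma val_leN x k : val_le (- x) k = val_le x k.
Proof.
rewrite /val_le oppr_eq0; have [//|x0] := eqVneq x 0.
suff -> : w (- x) = w x by [].
by rewrite -mulN1r -(rmorphN1 iota) wM ?fmorph_eq0 ?oppr_eq0 ?oner_neq0 //
   wC ?oppr_eq0 ?oner_neq0 // add0r.
Qed.

Lemma val_leB x y k : val_le x k -> val_le y k -> val_le (x - y) k.
Proof. by move=> lx ly; apply: val_leD => //; rewrite val_leN. Qed.

Lemma val_leM x y k l : val_le x k -> val_le y l -> val_le (x * y) (k + l).
Proof.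
rewrite /val_le mulf_eq0; have [//|x0] := eqVneq x 0; have [//|y0] := eqVneq y 0.
by rewrite wM //= => lx ly; apply: lerD.
Qed.

Lemma val_leM_int x y k : val_le x k -> val_le y 0 -> val_le (x * y) k.
Proof. by move=> lx ly; rewrite -[k]addr0; apply: val_leM. Qed.

Lemma val_le_trans x k l : (k <= l)%R -> val_le x k -> val_le x l.
Proof. by move=> lekl /orP[x0|le]; apply/orP; [left | right; apply: le_trans lekl]. Qed.

Lemma val_le_sum (I : Type) (r : seq I) (P : pred I) (F : I -> L) k :
  (forall i, P i -> val_le (F i) k) -> val_le (\sum_(i <- r | P i) F i) k.
Proof.
move=> FP; elim/big_ind: _ => //; first by rewrite /val_le eqxx.
by move=> x y; apply: val_leD.
Qed.

Lemma val_leC c : val_le (iota c) 0.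
Proof. by rewrite /val_le; have [->|c0] := eqVneq c 0; rewrite ?rmorph0 ?eqxx // wC ?orbT. Qed.

Lemma val_leX x k : val_le x 0 -> val_le (x ^+ k) 0.
Proof.
move=> lx; elim: k => [|k IHk]; first by rewrite expr0 -(rmorph1 iota) val_leC.
by rewrite exprS; apply: val_leM_int.
Qed.

Lemma val_le1 x : val_le x 0 -> ~~ val_le x (-1) -> x != 0 /\ w x = 0.
Proof.
rewrite /val_le negb_or; have [//|x0] /= := eqVneq x 0 => le0 nle.
by split=> //; lia.
Qed.

Lemma has_residueC c : has_residue (iota c) c.
Proof. by rewrite /has_residue subrr /val_le eqxx. Qed.

Lemma has_residue_int x c : has_residue x c -> val_le x 0.
Proof.
move=> rx; rewrite -[x](subrK (iota c)); apply: val_leD; last exact: val_leC.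
exact: val_le_trans rx.
Qed.

Lemma has_residueD x y c d :
  has_residue x c -> has_residue y d -> has_residue (x + y) (c + d).
Proof.
move=> rx ry; rewrite /has_residue rmorphD opprD addrACA.
exact: val_leD.
Qed.

Lemma has_residueM x y c d :
  has_residue x c -> has_residue y d -> has_residue (x * y) (c * d).
Proof.
move=> rx ry; rewrite /has_residue rmorphM.
have -> : x * y - iota c * iota d = (x - iota c) * y + iota c * (y - iota d) by ring.
apply: val_leD; first by apply: val_leM_int => //; apply: has_residue_int ry.
by rewrite mulrC; apply: val_leM_int => //; apply: val_leC.
Qed.

Lemma has_residue_uniq x c d : has_residue x c -> has_residue x d -> c = d.
Proof.
move=> rc rd; apply/eqP; rewrite -subr_eq0; apply: contraT => cd0.
have : val_le (iota (c - d)) (-1).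
  have -> : iota (c - d) = (x - iota d) - (x - iota c) by rewrite rmorphB; ring.
  exact: val_leB.
by rewrite /val_le fmorph_eq0 (negPf cd0) wC.
Qed.

(** E0 has transcendence degree at most 1 and contains tau of nonzero value.
    Then no room is left for a transcendental residue. *)
Section SmallSubfield.
Variable E0 : set L.
Hypotheses (hE0 : is_subfield E0).
Hypothesis E0_dep : forall b : 'I_2 -> L, (forall i, E0 (b i)) ->
  ~ alg_independent iota b.
Variable tau : L.
Hypotheses (E0tau : E0 tau) (tau0 : tau != 0) (w_tau : w tau != 0).
Let F := alg_over E0.
Let hF : is_subfield F := alg_over_subfield hE0.

(** Sort a relation between tau and u by powers of tau: sum_i tau^i r_i(u) = 0.
    If no r_i(u) with r_i <> 0 has a zero residue, the terms have the distinct
    values i * w tau.  Otherwise the residue of u is a root of some r_i. *)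
Lemma unit_residue_base u : E0 u -> u != 0 -> w u = 0 -> exists c, has_residue u c.
Proof.
move=> E0u u0 wu.
pose b (i : 'I_2) := if i == ord0 then tau else u.
have E0b i : E0 (b i) by rewrite /b; case: ifP.
have /existsNP[p /not_implyP[pb /eqP p0]] := E0_dep E0b.
pose r i : {poly K} := \sum_(m <- msupp p | m ord0 == i) p@_m *: 'X^(m ord_max).
pose N := msize p.
have suppN m : m \in msupp p -> (m ord0 < N)%N.
  move=> /msize_mdeg_lt; apply: leq_ltn_trans.
  by rewrite mdegE (bigD1 ord0) //= leq_addr.
have mnm2P (m m' : 'X_{1..2}) : m ord0 = m' ord0 -> m ord_max = m' ord_max -> m = m'.
  move=> eq0 eq1; apply/mnmP => i; have [->//|i0] := eqVneq i ord0.
  by have -> : i = ord_max by apply/val_inj => /=; case: i i0 => -[|[]].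
have sum0 : \sum_(i < N) tau ^+ i * (map_poly iota (r i)).[u] = 0.
  transitivity (\sum_(i < N) \sum_(m <- msupp p | m ord0 == i)
      iota p@_m * (tau ^+ m ord0 * u ^+ m ord_max)).
    apply: eq_bigr => i _; rewrite rmorph_sum horner_sum mulr_sumr.
    apply: eq_bigr => m /eqP->; rewrite /= map_polyZ map_polyXn hornerZ hornerXn.
    by rewrite mulrCA.
  rewrite (exchange_big_dep xpredT) //= -[RHS]pb /mmap !big_seq.
  apply: eq_bigr => m /suppN lt_m; rewrite (big_pred1 (Ordinal lt_m)) => [|i].
    by rewrite /mmap1 !big_ord_recl big_ord0 mulr1 /b /=; congr (_ * (_ * u ^+ m _)); apply: val_inj.
  by rewrite /= -val_eqE eq_sym.
have [i ri] : exists i : 'I_N, r i != 0.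
  have m_supp := mlead_supp p0; exists (Ordinal (suppN _ m_supp)).
  apply: contraTneq isT => r0; have := mleadc_eq0 p; rewrite (negPf p0) => /negP[].
  have : (r (mlead p ord0))`_(mlead p ord_max) = 0 by rewrite r0 coef0.
  rewrite coef_sum.
  rewrite -big_filter (bigD1_seq (mlead p)) ?filter_uniq ?msupp_uniq //=; last first.
    by rewrite mem_filter eqxx.
  rewrite coefZ coefXn eqxx mulr1 big1_seq ?addr0 => [->//|m].
  rewrite mem_filter => /and3P[neq /eqP eq0 _]; rewrite coefZ coefXn.
  case: eqP => [eq1|_]; last by rewrite mulr0.
  by case/eqP: neq; apply: mnm2P.
apply: contrapT => noRes.
have big_r j : r j != 0 -> (map_poly iota (r j)).[u] != 0 /\ w (map_poly iota (r j)).[u] = 0.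
  move=> rj; apply: val_le1; last by apply/negP => /(algebraic_residue u0 wu rj).
  rewrite horner_coef; apply: val_le_sum => k _; rewrite coef_map.
  by apply: val_leM_int; [exact: val_leC | apply: val_leX; rewrite /val_le wu orbT].
have [||k [l [neq fk fl]]] := w_sum (f := fun i : 'I_N => tau ^+ i * (map_poly iota (r i)).[u]).
- exact: sum0.
- by exists i; rewrite mulf_neq0 ?expf_neq0 //; case: (big_r i ri).
move: fk fl; rewrite !mulf_eq0 !negb_or => /andP[tk rk] /andP[tl rl].
have rneq0 j : (map_poly iota (r j)).[u] != 0 -> r j != 0.
  by apply: contraNneq => ->; rewrite rmorph0 horner0.
have [_ wk] := big_r _ (rneq0 _ rk); have [_ wl] := big_r _ (rneq0 _ rl).
rewrite !wM // wk wl !addr0 !(valX wM) // => /eqP.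
rewrite -subr_eq0 -!(mulr_natr (w tau)) -mulrBr mulf_eq0 (negPf w_tau) subr_eq0 /=.
by rewrite eqr_nat val_eqE (negPf neq).
Qed.

Lemma integral_residue_base u : E0 u -> val_le u 0 -> exists c, has_residue u c.
Proof.
move=> E0u u_int; have [small|big] := boolP (val_le u (-1)).
  by exists 0; rewrite /has_residue rmorph0 subr0.
by have [u0 wu] := val_le1 u_int big; apply: unit_residue_base.
Qed.

(** Divide an equation of f over E0 by its coefficient of largest value; the
    residues of the new coefficients form a nonzero polynomial over K that has
    the residue of f as a root. *)
Lemma unit_residue f : F f -> f != 0 -> w f = 0 -> exists c, has_residue f c.
Proof.
move=> [p [p0 Ep /rootP pf]] f0 wf.
have sz_gt0 : (0 < size p)%N by rewrite size_poly_gt0.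
have lt_top : ((size p).-1 < size p)%N by rewrite prednK.
have top0 : p`_(Ordinal lt_top) != 0 by rewrite lead_coef_eq0.
case: (@arg_maxP _ _ _ (Ordinal lt_top) (fun i : 'I_(size p) => p`_i != 0)
  (fun i => w p`_i) top0) => k pk maxk.
have int_e (j : 'I_(size p)) : val_le (p`_j / p`_k) 0.
  have [->|pj] := eqVneq p`_j 0; first by rewrite mul0r /val_le eqxx.
  apply/orP; right; rewrite (val_div wM) // subr_le0; exact: maxk.
have /choice[c cP] : forall j : 'I_(size p), exists c, has_residue (p`_j / p`_k) c.
  by move=> j; apply: integral_residue_base => //; apply: (sf_div hE0).
pose r := \poly_(j < size p) (if insub j is Some i then c i else 0).
have rE (j : 'I_(size p)) : r`_j = c j by rewrite coef_poly ltn_ord valK.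
apply: (algebraic_residue (r := r)) => //.
  apply: contraTneq isT => r0; have := cP k; rewrite -rE r0 coef0 divff //.
  move=> res0; have res1 := has_residueC 1; rewrite rmorph1 in res1.
  by have /eqP := has_residue_uniq res1 res0; rewrite oner_eq0.
have -> : (map_poly iota r).[f] =
    \sum_(j < size p) (iota (c j) - p`_j / p`_k) * f ^+ j.
  have p_sum : \sum_(j < size p) (p`_j / p`_k) * f ^+ j = 0.
    transitivity (p.[f] / p`_k); last by rewrite pf mul0r.
    by rewrite horner_coef mulr_suml; apply: eq_bigr => j _; rewrite mulrAC.
  transitivity ((map_poly iota r).[f] - \sum_(j < size p) (p`_j / p`_k) * f ^+ j).
    by rewrite p_sum subr0.
  rewrite (@horner_coef_wide _ (size p)); last first.
    by rewrite size_map_poly size_poly.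
  by rewrite -sumrB; apply: eq_bigr => j _; rewrite coef_map /= rE mulrBl.
apply: val_le_sum => j _; apply: val_leM_int.
  by rewrite -opprB val_leN; apply: cP.
by apply: val_leX; rewrite /val_le wf orbT.
Qed.

End SmallSubfield.
Section InvariantValuation.
Variables (gT : finGroupType) (act : gT -> {rmorphism L -> L}).
Hypothesis act1 : forall x, act 1%g x = x.
Hypothesis actM : forall g h x, act (g * h)%g x = act g (act h x).
Hypothesis act_const : forall g c, act g (iota c) = iota c.
Variable E0 : set L.
Hypotheses (hE0 : is_subfield E0).
Hypothesis E0_dep : forall b : 'I_2 -> L, (forall i, E0 (b i)) ->
  ~ alg_independent iota b.
Let F := alg_over E0.
Let hF : is_subfield F := alg_over_subfield hE0.
Hypotheses (Fst : act_stable act F) (Ffaith : act_faithful act F).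

(** If w vanished on E0 it would vanish on F; but for x in F with a x <> x the
    element a x - x of F has negative value, because a is trivial on residues. *)
Lemma nontrivial_on_base (a : gT) : a != 1%g ->
  (forall x, x != 0 -> w x = 0 -> val_le (act a x - x) (-1)) ->
  exists tau, [/\ E0 tau, tau != 0 & w tau != 0].
Proof.
move=> a1 a_res; apply: contrapT => noTau.
have wF x : F x -> x != 0 -> w x = 0.
  move=> Fx x0; have [n [e [n0 E0e e0 we]]] := val_alg wM w_sum hE0 Fx x0.
  have we0 : w e = 0.
    by apply/eqP/negPn/negP => we0; apply: noTau; exists e.
  move/eqP: we; rewrite we0 eq_sym mulrn_eq0 (gtn_eqF n0) /=.
  by move=> /eqP.
have [x Fx nx] := Ffaith a1.
have x0 : x != 0 by apply: contraNneq nx => ->; rewrite rmorph0.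
have := a_res x x0 (wF x Fx x0).
have y0 : act a x - x != 0 by rewrite subr_eq0.
rewrite /val_le (negPf y0) wF //.
by apply: (sfB hF) => //; apply: Fst.
Qed.

Variables s1 s2 : gT.
Hypotheses (w_s1 : forall x, x != 0 -> w (act s1 x) = w x).
Hypotheses (w_s2 : forall x, x != 0 -> w (act s2 x) = w x).
Hypotheses (s1_sq : (s1 * s1)%g = 1%g) (s2_sq : (s2 * s2)%g = 1%g).
Let c := (s1 * s2)%g.
Hypotheses (c_cube : (c * c * c)%g = 1%g) (c_neq1 : c != 1%g).
Hypothesis char3 : (3%:R : K) != 0.
Variable tau : L.
Hypotheses (E0tau : E0 tau) (tau0 : tau != 0) (w_tau : w tau != 0).

Let F_residue := unit_residue hE0 E0_dep E0tau tau0 w_tau.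

Let act_neq0 g x : x != 0 -> act g x != 0.
Proof. by rewrite fmorph_eq0. Qed.

Lemma w_rotation x : x != 0 -> w (act c x) = w x.
Proof. by move=> x0; rewrite actM w_s1 ?act_neq0 // w_s2. Qed.

Lemma has_residue_act g x d : (forall y, y != 0 -> w (act g y) = w y) ->
  has_residue x d -> has_residue (act g x) d.
Proof.
move=> wg rx; rewrite /has_residue -(act_const g) -rmorphB /val_le fmorph_eq0.
case: eqP => //= /eqP neq0; rewrite wg //.
by move: rx; rewrite /has_residue /val_le (negPf neq0).
Qed.

Let F_ratio g x : (forall y, y != 0 -> w (act g y) = w y) -> F x -> x != 0 ->
  exists d, has_residue (act g x / x) d.
Proof.
move=> wg Fx x0; apply: F_residue.
- by apply: (sf_div hF) => //; apply: Fst.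
- by rewrite mulf_neq0 ?invr_neq0 ?act_neq0.
- by rewrite (val_div wM) ?act_neq0 // wg // subrr.
Qed.

(** Let x and k be the residues of c t / t and s1 t / t.  Elements of K are fixed,
    so c s1 c = s1 gives x * k * x = k, and c ^ 3 = 1 gives x ^ 3 = 1. *)
Lemma rotation_residue1 t : F t -> t != 0 -> has_residue (act c t / t) 1.
Proof.
move=> Ft t0; have [x xP] := F_ratio w_rotation Ft t0.
have [k kP] := F_ratio w_s1 Ft t0.
set A := act c t / t in xP *; set B := act s1 t / t in kP *.
have cE : act c t = A * t by rewrite /A divfK.
have sE : act s1 t = B * t by rewrite /B divfK.
have k0 : k != 0.
  apply: contraTneq kP => ->; rewrite /has_residue rmorph0 subr0 /val_le.
  have B0 : B != 0 by rewrite mulf_neq0 ?invr_neq0 ?act_neq0.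
  by rewrite (negPf B0) /B (val_div wM) ?act_neq0 // w_s1 // subrr.
clearbody A B.
have sq : x * k * x = k.
  have rel : act c (act s1 A) * act c B * A = B.
    apply: (mulIf t0); rewrite -sE -!mulrA -cE -(rmorphM (act c)) -sE.
    rewrite -(rmorphM (act c)) -(rmorphM (act s1)) -cE -!actM; congr (act _ t).
    by rewrite /c mulgA -[(s1 * s2 * s1 * s1)%g]mulgA s1_sq mulg1 -mulgA s2_sq mulg1.
  apply: (has_residue_uniq (x := B)) => //; rewrite -rel.
  apply: has_residueM => //; apply: has_residueM.
    apply: has_residue_act; first exact: w_rotation.
    exact: has_residue_act.
  by apply: has_residue_act; first exact: w_rotation.
have cube : x * x * x = 1.
  have rel : act c (act c A) * act c A * A = 1.
    apply: (mulIf t0); rewrite -!mulrA -cE -(rmorphM (act c)) -cE.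
    rewrite -!(rmorphM (act c)) -cE.
    by rewrite -!actM c_cube act1 mul1r.
  apply: (has_residue_uniq (x := 1)); last by rewrite -(rmorph1 iota); apply: has_residueC.
  rewrite -{}rel; apply: has_residueM => //.
  have rc y d : has_residue y d -> has_residue (act c y) d.
    by apply: has_residue_act; apply: w_rotation.
  by apply: has_residueM; [apply/rc/rc | apply/rc].
have x2 : x * x = 1 by apply: (mulIf k0); rewrite mul1r mulrAC.
suff x1 : x = 1 by rewrite -x1.
by rewrite -cube x2 mul1r.
Qed.

(** For y = f - c f the terms of y + c y + c c y = 0 all have the leading term
    of y, so 3 = 0 in K. *)
Lemma invariant_valuation_absurd : False.
Proof.
have [f Ff nf] := Ffaith c_neq1; pose y := f - act c f.
have y0 : y != 0 by rewrite subr_eq0 eq_sym.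
have Fy : F y by apply: (sfB hF) => //; apply: Fst.
have rA := rotation_residue1 Fy y0; set A := act c y / y in rA.
have cE : act c y = A * y by rewrite /A divfK.
clearbody A.
have rel : 1 + A + act c A * A = 0.
  apply: (mulIf y0); rewrite mul0r !mulrDl mul1r -mulrA -cE -(rmorphM (act c)) -cE.
  rewrite /y !rmorphB -!actM [(c * (c * c))%g]mulgA c_cube act1 /=.
  by ring.
have r3 : has_residue (1 + A + act c A * A) (1 + 1 + 1 * 1).
  apply: has_residueD; last first.
    apply: has_residueM => //; apply: has_residue_act => //; exact: w_rotation.
  by apply: has_residueD => //; rewrite -(rmorph1 iota); apply: has_residueC.
have r0 : has_residue (1 + A + act c A * A) 0.
  by rewrite rel -(rmorph0 iota); apply: has_residueC.
have := has_residue_uniq r3 r0; rewrite mulr1 => /eqP.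
by rewrite -addrA -[1 + (1 + 1)]/(3%:R) (negPf char3).
Qed.

End InvariantValuation.
End DiscreteValuation.

(** * The valuation attached to a degree *)
Import Num.Theory Order.TTheory.

(** As for leading monomials, with the degree of a univariate polynomial. *)
Lemma size_collision (A : idomainType) (I : finType) (f : I -> {poly A}) :
  \sum_i f i = 0 -> (exists i, f i != 0) ->
  exists i j, [/\ i != j, f i != 0, f j != 0 & size (f i) = size (f j)].
Proof.
move=> sum0 [i0 fi0].
case: (@arg_maxP _ nat _ i0 (fun i => f i != 0) (fun i => size (f i)) fi0).
move=> i fi maxi; apply: contrapT => noColl.
have : (\sum_j f j)`_(size (f i)).-1 = 0 by rewrite sum0 coef0.
rewrite coef_sum (bigD1 i) //= big1 => [|j neq]; last first.
  have [->|fj] := eqVneq (f j) 0; first by rewrite coef0.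
  apply: nth_default; rewrite -ltnS prednK ?size_poly_gt0 // ltn_neqAle.
  rewrite [X in _ && X](maxi j fj) andbT.
  by apply/eqP => eqm; apply: noColl; exists j, i.
by rewrite addr0 => /eqP; rewrite -lead_coefE lead_coef_eq0 (negPf fi).
Qed.

Lemma expf_homogenize (F : fieldType) (a b : F) j n : (j <= n)%N -> b != 0 ->
  (a / b) ^+ j * b ^+ n = a ^+ j * b ^+ (n - j).
Proof.
move=> le_jn b0; rewrite -{1}(subnKC le_jn) exprD mulrA -exprMn divfK //.
Qed.

Lemma nat_pred2 a b c : (a < b)%N -> ((a + c).-1 <= (b + c).-2)%N.
Proof. lia. Qed.

Lemma nat_pred_int (z a b : nat) : (z <= (a + b).-2)%N -> (0 < z)%N ->
  a.-1 = b.-1 -> (0 < a)%N -> (0 < b)%N ->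
  z.-1%:Z <= -1 + (b.-1%:Z + b.-1%:Z).
Proof. lia. Qed.

(** The variable of {poly {mpoly K[q]}} records the weight, and the leading
    coefficient in it is the leading form of an element of R. *)
Section DegreeValuation.
Variables (K : fieldType) (m q : nat).
Local Notation R := {mpoly K[m]}.
Local Notation A := {mpoly K[q]}.
Local Notation L := {fraction {mpoly K[m]}}.
Local Notation iota := (ratconst K m).
Variable Phi : {rmorphism R -> {poly A}}.
Hypothesis Phi_inj : injective Phi.
Hypothesis PhiZ : forall c p, Phi (c *: p) = c%:MP *: Phi p.

Lemma Phi_neq0 p : (Phi p != 0) = (p != 0).
Proof. by rewrite -(inj_eq Phi_inj) rmorph0. Qed.

Definition pdeg (p : R) : int := (size (Phi p)).-1%:Z.

Lemma pdegE p : p != 0 -> size (Phi p) = (size (Phi p)).-1.+1.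
Proof. by rewrite -Phi_neq0 -size_poly_gt0 => /prednK. Qed.

Lemma pdegM p p' : p != 0 -> p' != 0 -> pdeg (p * p') = pdeg p + pdeg p'.
Proof.
move=> p0 p0'; rewrite /pdeg (rmorphM Phi) size_mul ?Phi_neq0 //.
by rewrite pdegE // (pdegE p0') addnS /= PoszD.
Qed.

Lemma pdeg_sum (I : finType) (f : I -> R) : \sum_i f i = 0 ->
  (exists i, f i != 0) ->
  exists i j, [/\ i != j, f i != 0, f j != 0 & pdeg (f i) = pdeg (f j)].
Proof.
move=> sum0 [i fi]; have [||k [l []]] := @size_collision A I (Phi \o f).
- by rewrite /= -rmorph_sum sum0 rmorph0.
- by exists i; rewrite /= Phi_neq0.
rewrite /= !Phi_neq0 => neq fk fl eqm.
by exists k, l; rewrite /pdeg eqm.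
Qed.

Definition deg_val : L -> int := frac_val pdeg.
Definition deg_valM := frac_valM pdegM.
Definition deg_val_sum := frac_val_sum pdegM pdeg_sum.
Definition deg_valE := frac_valE pdegM.

Lemma deg_val_le p r k : r != 0 -> val_le deg_val (tofrac p / tofrac r) k =
  (p == 0) || (pdeg p - pdeg r <= k).
Proof.
move=> r0; rewrite /val_le -[X in X || _]negbK frac_neq0 // negbK.
have [//|p0] /= := eqVneq p 0.
by rewrite /deg_val deg_valE.
Qed.

Lemma pdeg_le p (k : nat) : (p == 0) || (pdeg p <= k%:Z) = (size (Phi p) <= k.+1)%N.
Proof.
have [->|p0] /= := eqVneq p 0; first by rewrite rmorph0 size_poly0.
by rewrite /pdeg lez_nat [in RHS]pdegE.
Qed.

Lemma deg_val_leD x y k : val_le deg_val x k -> val_le deg_val y k ->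
  val_le deg_val (x + y) k.
Proof.
have [p [r [r0 pE]]] := common_denominator_frac (fun b : bool => if b then x else y).
have rF : tofrac r != 0 by rewrite tofrac_eq0.
have -> : x = tofrac (p true) / tofrac r by exact: (pE true).
have -> : y = tofrac (p false) / tofrac r by exact: (pE false).
rewrite -mulrDl -tofracD !deg_val_le // !lerBlDr.
(* A negative bound leaves only the zero numerator. *)
case: (k + pdeg r) => [j|j]; first rewrite !pdeg_le => le1 le2.
  rewrite (rmorphD Phi); apply: leq_trans (size_polyD _ _) _.
  by rewrite geq_max le1.
have neg (u : R) : (u == 0) || (pdeg u <= Negz j) -> u = 0.
  by case/orP => [/eqP//|].
by move=> /neg-> /neg->; rewrite addr0 eqxx.
Qed.

Lemma deg_val_const c : c != 0 -> deg_val (iota c) = 0.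
Proof.
move=> c0; rewrite /deg_val /= (frac_val_tofrac pdegM) ?mpolyC_eq0 //.
have C1 : c%:MP_[m] = c *: 1 by rewrite -mul_mpolyC mulr1.
rewrite /pdeg C1 PhiZ rmorph1 size_scale ?size_poly1 //.
by rewrite mpolyC_eq0.
Qed.

Lemma lead_coef_prodX (P Q : {poly A}) s j k : size P = s.+1 -> size Q = s.+1 ->
  (P ^+ j * Q ^+ k)`_((j + k) * s) = lead_coef P ^+ j * lead_coef Q ^+ k.
Proof.
move=> sP sQ; have P0 : P != 0 by rewrite -size_poly_gt0 sP.
have Q0 : Q != 0 by rewrite -size_poly_gt0 sQ.
rewrite -!lead_coef_exp -lead_coefM lead_coefE size_mul ?expf_neq0 //.
have sz (X : {poly A}) i : X != 0 -> size X = s.+1 -> size (X ^+ i) = (s * i).+1.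
  move=> X0 sX; rewrite -[s]/(s.+1.-1) -sX -size_exp prednK //.
  by rewrite size_poly_gt0 expf_neq0.
by rewrite !sz // addnS /= mulnDl ![(s * _)%N]mulnC.
Qed.

(** If r (p / d) has negative value, then the leading forms al of p and be of d
    satisfy the homogenized equation of r, so al / be is algebraic over K and
    therefore a constant c, and the leading form of p - c d cancels. *)
Lemma deg_val_algebraic_residue x (r : {poly K}) : x != 0 -> deg_val x = 0 ->
  r != 0 -> val_le deg_val (map_poly iota r).[x] (-1) ->
  exists c, has_residue iota deg_val x c.
Proof.
elim/frac_ind: x => p d d0; rewrite frac_neq0 // => p0.
rewrite /deg_val deg_valE // => /eqP; rewrite subr_eq0 /pdeg eqz_nat => /eqP sz_eq r0.
set s := (size (Phi d)).-1 in sz_eq.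
have sP : size (Phi p) = s.+1 by rewrite -sz_eq; apply: pdegE.
have sD : size (Phi d) = s.+1 by exact: pdegE.
have dF : tofrac d != 0 by rewrite tofrac_eq0.
pose n := size r.
pose rho := \sum_(j < n) r`_j *: (p ^+ j * d ^+ (n - j)).
have -> : (map_poly iota r).[tofrac p / tofrac d] = tofrac rho / tofrac (d ^+ n).
  rewrite horner_coef size_map_poly /rho rmorph_sum mulr_suml.
  apply: eq_bigr => j _; rewrite coef_map /= -mul_mpolyC !tofracM !tofracXn.
  rewrite -mulrA; congr (_ * _); apply: (mulIf (expf_neq0 n dF)).
  by rewrite (expf_homogenize _ (ltnW (ltn_ord j)) dF) divfK ?expf_neq0.
rewrite deg_val_le ?expf_neq0 // lerBlDr => rho_le.
have size_rho : (size (Phi rho) <= n * s)%N.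
  have pdX : pdeg (d ^+ n) = (n * s)%N.
    by rewrite /pdeg (rmorphXn Phi) size_exp mulnC.
  have [->|rho0] := eqVneq rho 0; first by rewrite rmorph0 size_poly0.
  move: rho_le; rewrite (negPf rho0) pdX /= /pdeg pdegE //.
  move: (size _) => k; lia.
have lead0 : \sum_(j < n) (r`_j)%:MP * (lead_coef (Phi p) ^+ j * lead_coef (Phi d) ^+ (n - j)) = 0.
  transitivity ((Phi rho)`_(n * s)); last by rewrite nth_default.
  rewrite /rho (rmorph_sum Phi) coef_sum; apply: eq_bigr => j _.
  rewrite PhiZ coefZ (rmorphM Phi) !(rmorphXn Phi) -(lead_coef_prodX _ _ sP sD).
  by rewrite subnKC // ltnW.
set al := lead_coef (Phi p) in lead0; set be := lead_coef (Phi d) in lead0.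
have be0 : be != 0 by rewrite lead_coef_eq0 Phi_neq0.
have beF : tofrac be != 0 by rewrite tofrac_eq0.
have [c _ cE] : range (ratconst K q) (tofrac al / tofrac be).
  apply: alg_over_constants; exists (map_poly (ratconst K q) r); split.
  - by rewrite map_poly_eq0.
  - by move=> i; rewrite coef_map; exists r`_i.
  apply/rootP; apply: (mulIf (expf_neq0 n beF)); rewrite mul0r.
  rewrite horner_coef size_map_poly mulr_suml.
  rewrite -[RHS](rmorph0 (@FracField.tofrac A)) -lead0 rmorph_sum.
  apply: eq_bigr => j _; rewrite coef_map rmorphM rmorphM !rmorphXn /=.
  rewrite -mulrA; congr (_ * _).
  exact: expf_homogenize (ltnW (ltn_ord j)) beF.
have alE : al = c%:MP * be.
  apply/eqP; rewrite -tofrac_eq tofracM; apply/eqP.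
  by apply: (mulIf (invr_neq0 beF)); rewrite mulfK // -cE.
exists c; rewrite /has_residue.
have -> : tofrac p / tofrac d - iota c = tofrac (p - c *: d) / tofrac d.
  by rewrite -mul_mpolyC tofracB tofracM mulrBl mulfK.
rewrite deg_val_le // lerBlDr.
have szr : (size (Phi (p - c *: d)%R) <= s)%N.
  apply/leq_sizeP => j; rewrite leq_eqVlt => /predU1P[<-|lt_j].
    rewrite (rmorphB Phi) PhiZ coefB coefZ.
    have -> : (Phi p)`_s = al by rewrite /al lead_coefE sP.
    have -> : (Phi d)`_s = be by rewrite /be lead_coefE sD.
    by rewrite alE subrr.
  rewrite (rmorphB Phi) PhiZ coefB coefZ !nth_default ?sP ?sD //.
  by rewrite mulr0 subrr.
have [//|z0] /= := eqVneq (p - c *: d) 0.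
move: szr; rewrite /pdeg -/s pdegE //=.
by move: (size _) => k; lia.
Qed.

(** sg is an automorphism of the polynomial ring and act the induced one on
    fractions. *)
Section SemilinearBounds.
Variable sg : {rmorphism R -> R}.
Hypothesis sg_inj : injective sg.
Variable act : {rmorphism L -> L}.
Hypothesis actE : forall p r, r != 0 ->
  act (tofrac p / tofrac r) = tofrac (sg p) / tofrac (sg r).

Lemma sg_neq0 p : (sg p != 0) = (p != 0).
Proof. by rewrite -[in RHS](inj_eq sg_inj) rmorph0. Qed.

Lemma deg_val_act : (forall p, size (Phi (sg p)) = size (Phi p)) ->
  forall x, x != 0 -> deg_val (act x) = deg_val x.
Proof.
move=> sz x; elim/frac_ind: x => p r r0; rewrite frac_neq0 // => p0.
by rewrite actE // /deg_val !deg_valE ?sg_neq0 // /pdeg !sz.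
Qed.

(** sg preserves leading forms, so they cancel in the numerator
    sg p * r - p * sg r of act x - x. *)
Lemma deg_val_act_residue : (forall p, size (Phi (sg p)) = size (Phi p)) ->
  (forall p, p != 0 -> (size (Phi (sg p) - Phi p)%R < size (Phi p))%N) ->
  forall x, x != 0 -> deg_val x = 0 -> val_le deg_val (act x - x) (-1).
Proof.
move=> sz lt_sz x; elim/frac_ind: x => p r r0; rewrite frac_neq0 // => p0.
rewrite /deg_val deg_valE // => /eqP; rewrite subr_eq0 /pdeg eqz_nat => /eqP sz_eq.
rewrite actE //; have sr0 : sg r != 0 by rewrite sg_neq0.
have neqF u : u != 0 -> tofrac u != 0 by rewrite tofrac_eq0.
rewrite subf_div ?neqF // -!tofracM -tofracB deg_val_le ?mulf_neq0 // lerBlDr.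
set z := sg p * r - p * sg r.
have [//|z0] /= := eqVneq z 0.
have zE : Phi z = (Phi (sg p) - Phi p) * Phi r - Phi p * (Phi (sg r) - Phi r).
  rewrite (rmorphB Phi) !(rmorphM Phi) mulrBl mulrBr opprB addrA subrK.
  by [].
rewrite pdegM // /pdeg sz.
have := lt_sz p p0; have := lt_sz r r0.
set P := Phi p in zE sz_eq *; set Q := Phi r in zE sz_eq *.
set P' := _ - P in zE *; set Q' := _ - Q in zE *.
move=> ltQ ltP; rewrite zE.
have sz1 : (size (P' * Q)%R <= (size P + size Q).-2)%N.
  exact: leq_trans (size_polyMleq _ _) (nat_pred2 _ ltP).
have sz2 : (size (P * Q')%R <= (size P + size Q).-2)%N.
  by apply: leq_trans (size_polyMleq _ _) _; rewrite addnC [(size P + _)%N]addnC nat_pred2.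
have szZ : (size (P' * Q - P * Q')%R <= (size P + size Q).-2)%N.
  apply: leq_trans (size_polyD _ _) _.
  by rewrite geq_max sz1 size_polyN.
have Z_gt0 : (0 < size (P' * Q - P * Q')%R)%N by rewrite -zE size_poly_gt0 Phi_neq0.
exact: nat_pred_int szZ Z_gt0 sz_eq (leq_ltn_trans (leq0n _) ltP)
  (leq_ltn_trans (leq0n _) ltQ).
Qed.

End SemilinearBounds.
End DegreeValuation.

(** * Weighted degrees and adapted bases *)
Opaque lin_subst.

Section WeightedSubstitution.
Variables (K : fieldType) (q : nat) (wt : 'I_q -> nat).
Local Notation A := {mpoly K[q]}.

(** Multiplying each variable by a power of the new indeterminate turns the
    weighted degree into the degree of a univariate polynomial. *)
Definition weighted : {rmorphism A -> {poly A}} :=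
  mmap (@polyC A \o @mpolyC q K) (fun i => 'X_i *: 'X^(wt i)).

Definition wdeg (u : 'X_{1..q}) := (\sum_i wt i * u i)%N.

Lemma weightedC c : weighted c%:MP = (c%:MP)%:P.
Proof. by rewrite /weighted /= mmapC. Qed.

Lemma weightedXm u : weighted 'X_[u] = 'X_[u] *: 'X^(wdeg u).
Proof.
rewrite /weighted /= mmapX /mmap1 /wdeg [in RHS]mpolyXE_id.
rewrite (big_morph (fun k => 'X^k : {poly A}) (exprD _) (expr0 _)).
rewrite -scaler_prod; apply: eq_bigr => i _.
by rewrite exprZn exprM.
Qed.

Lemma weightedX i : weighted 'X_i = 'X_i *: 'X^(wt i).
Proof. by rewrite /weighted /= mmapX mmap1U. Qed.

Lemma weightedZ c p : weighted (c *: p) = c%:MP *: weighted p.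
Proof. by rewrite -mul_mpolyC rmorphM weightedC mul_polyC. Qed.

Opaque weighted.

Lemma weighted_coef p D u : ((weighted p)`_D)@_u = p@_u *+ (wdeg u == D).
Proof.
rewrite [p in LHS]mpolyE rmorph_sum coef_sum raddf_sum /=.
have -> : p@_u = (\sum_(v <- msupp p) p@_v *: 'X_[v])@_u by rewrite -mpolyE.
rewrite raddf_sum /= -sumrMnl; apply: eq_bigr => v _.
rewrite weightedZ weightedXm !coefZ coefXn mul_mpolyC !mcoeffZ mulr_natr mcoeffMn.
rewrite mcoeffX mulrnAr [D == _]eq_sym; case: (v =P u) => [->//|_].
by rewrite mulr0 !mul0rn.
Qed.

Lemma weighted_inj : injective weighted.
Proof.
apply: raddf_inj => p p0; apply/mpolyP => u.
have := weighted_coef p (wdeg u) u.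
by rewrite p0 coef0 !mcoeff0 eqxx mulr1n.
Qed.

Lemma wdeg_lt_size p u : u \in msupp p -> (wdeg u < size (weighted p))%N.
Proof.
rewrite mcoeff_msupp ltnNge; apply: contra => le_sz.
have := weighted_coef p (wdeg u) u.
by rewrite nth_default // mcoeff0 eqxx mulr1n => <-.
Qed.

Lemma size_mul_bound (B : idomainType) (P Q : {poly B}) a b :
  (size P <= a.+1)%N -> (size Q <= b.+1)%N -> (size (P * Q)%R <= (a + b).+1)%N.
Proof. by move=> lea leb; apply: leq_trans (size_polyMleq _ _) _; lia. Qed.

Lemma size_sum_bound (B : nzRingType) (I : eqType) (r : seq I) (F : I -> {poly B}) k :
  (forall i, i \in r -> (size (F i) <= k)%N) -> (size (\sum_(i <- r) F i)%R <= k)%N.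
Proof.
move=> leF; rewrite big_seq; elim/big_ind: _ => //; first by rewrite size_poly0.
by move=> x y lex ley; apply: leq_trans (size_polyD _ _) _; rewrite geq_max lex.
Qed.

Section Triangular.
Variable N : 'M[K]_q.
Hypothesis N_lower : forall i j, N i j != 0 -> (wt j <= wt i)%N.

Lemma weighted_lin_substX i : (size (weighted (lin_subst N 'X_i)) <= (wt i).+1)%N.
Proof.
rewrite lin_substX rmorph_sum; apply: size_sum_bound => j _ /=.
rewrite weightedZ weightedX scalerA.
have [->|Nij] := eqVneq (N i j) 0.
  by rewrite mpolyC0 mul0r scale0r size_poly0.
apply: leq_trans (size_scale_leq _ _) _; rewrite size_polyXn ltnS.
exact: N_lower.
Qed.

Lemma weighted_lin_subst_monomial u :
  (size (weighted (lin_subst N 'X_[u])) <= (wdeg u).+1)%N.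
Proof.
rewrite mpolyXE_id !rmorph_prod /wdeg.
elim/big_ind2: _ => [|P a Q b leP leQ|i _]; first by rewrite size_poly1.
  exact: size_mul_bound.
rewrite !rmorphXn /=; elim: (u i) => [|k IHk]; first by rewrite expr0 muln0 size_poly1.
by rewrite exprS mulnS; apply: size_mul_bound => //; apply: weighted_lin_substX.
Qed.

(** Each variable goes to a combination of variables of no larger weight. *)
Lemma weighted_lin_subst_size p :
  (size (weighted (lin_subst N p)) <= size (weighted p))%N.
Proof.
rewrite [X in lin_subst N X]mpolyE (rmorph_sum (lin_subst N)) (rmorph_sum weighted); apply: size_sum_bound => u u_supp /=.
rewrite lin_substZ weightedZ; apply: leq_trans (size_scale_leq _ _) _.
exact: leq_trans (weighted_lin_subst_monomial u) (wdeg_lt_size u_supp).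
Qed.

Hypothesis N_unip : forall i j, (N - 1%:M) i j != 0 -> (wt j < wt i)%N.

Lemma size_prod_diff (B : idomainType) (P P' Q Q' : {poly B}) a b :
  (size P <= a.+1)%N -> (size Q' <= b.+1)%N -> (size (P - P')%R <= a)%N ->
  (size (Q - Q')%R <= b)%N -> (size (P * Q - P' * Q')%R <= a + b)%N.
Proof.
move=> leP leQ' dP dQ.
have -> : P * Q - P' * Q' = P * (Q - Q') + (P - P') * Q' by ring.
apply: leq_trans (size_polyD _ _) _; rewrite geq_max.
by apply/andP; split; apply: leq_trans (size_polyMleq _ _) _; lia.
Qed.

Lemma weighted_lin_substX_diff i :
  (size (weighted (lin_subst N 'X_i) - weighted 'X_i)%R <= wt i)%N.
Proof.
have -> : lin_subst N 'X_i = lin_subst (N - 1%:M) 'X_i + 'X_i.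
  apply: etrans (lin_substX N i) _; apply: esym.
  apply: etrans (congr2 +%R (lin_substX _ i) (esym (lin_subst1 'X_i))) _.
  apply: etrans (congr1 (+%R _) (lin_substX _ i)) _.
  by rewrite -big_split /=; apply: eq_bigr => j _; rewrite -scalerDl !mxE subrK.
rewrite (rmorphD weighted) addrK lin_substX rmorph_sum.
apply: size_sum_bound => j _ /=; rewrite weightedZ weightedX scalerA.
have [->|Nij] := eqVneq ((N - 1%:M) i j) 0.
  by rewrite mpolyC0 mul0r scale0r size_poly0.
by apply: leq_trans (size_scale_leq _ _) _; rewrite size_polyXn; apply: N_unip.
Qed.

Lemma weighted_lin_subst_monomial_diff u :
  (size (weighted (lin_subst N 'X_[u]) - weighted 'X_[u])%R <= wdeg u)%N.
Proof.
have sz1 i k : (size (weighted ('X_i ^+ k : A)) <= (wt i * k).+1)%N.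
  rewrite rmorphXn weightedX; elim: k => [|k IHk]; first by rewrite expr0 muln0 size_poly1.
  rewrite exprS mulnS; apply: size_mul_bound => //.
  by apply: leq_trans (size_scale_leq _ _) _; rewrite size_polyXn.
have sz2 i k : (size (weighted (lin_subst N ('X_i ^+ k))) <= (wt i * k).+1)%N.
  rewrite !rmorphXn /=; elim: k => [|k IHk]; first by rewrite expr0 muln0 size_poly1.
  by rewrite exprS mulnS; apply: size_mul_bound => //; apply: weighted_lin_substX.
have szd i k : (size (weighted (lin_subst N ('X_i ^+ k)) - weighted ('X_i ^+ k : A))%R <= wt i * k)%N.
  elim: k => [|k IHk]; first by rewrite !expr0 !rmorph1 subrr size_poly0.
  rewrite exprS mulnS (rmorphM (lin_subst N)) !(rmorphM weighted).
  apply: size_prod_diff => //; [exact: weighted_lin_substX | exact: weighted_lin_substX_diff].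
pose B P Q k := [/\ (size (P : {poly A}) <= k.+1)%N, (size (Q : {poly A}) <= k.+1)%N
  & (size (P - Q)%R <= k)%N].
have B1 : B 1 1 0%N.
  split; [by rewrite size_poly1 | by rewrite size_poly1 |].
  by rewrite (subrr (1 : {poly A})) size_poly0.
suff [] : B (weighted (lin_subst N 'X_[u])) (weighted 'X_[u]) (wdeg u) by [].
rewrite mpolyXE_id !rmorph_prod /wdeg.
apply: (big_ind3 B) => [|P Q a P' Q' b [P1 Q1 PQ1] [P2 Q2 PQ2]|i _] /=.
- exact: B1.
- by split; [exact: size_mul_bound | exact: size_mul_bound | exact: size_prod_diff].
- by split; [exact: sz2 | exact: sz1 | exact: szd].
Qed.

(** Modulo variables of smaller weight N is the identity, so it preserves the
    leading form. *)
Lemma weighted_lin_subst_diff p : p != 0 ->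
  (size (weighted (lin_subst N p) - weighted p)%R < size (weighted p))%N.
Proof.
move=> p0; have sz_gt0 : (0 < size (weighted p))%N.
  by rewrite size_poly_gt0 -(inj_eq weighted_inj) rmorph0 in p0 *.
rewrite -(prednK sz_gt0) ltnS.
rewrite [X in lin_subst N X]mpolyE [X in _ - weighted X]mpolyE.
rewrite (rmorph_sum (lin_subst N)) !(rmorph_sum weighted) -sumrB.
apply: size_sum_bound => u u_supp /=; rewrite lin_substZ !weightedZ -scalerBr.
apply: leq_trans (size_scale_leq _ _) _.
apply: leq_trans (weighted_lin_subst_monomial_diff u) _.
by rewrite -ltnS prednK // wdeg_lt_size.
Qed.

End Triangular.
End WeightedSubstitution.

Section AdaptedBasis.
Variables (K : fieldType) (m : nat) (U1 U2 : 'M[K]_m).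
Hypothesis U21 : (U2 <= U1)%MS.

(** A flag U2 <= U1 <= V of row spaces, indexed by weight. *)
Definition flag k : 'M[K]_m := match k with 0 => U2 | 1 => U1 | _ => 1%:M end.

(** The rows of P are bases of U2, of a complement of U2 in U1 and of a
    complement of U1; they get the weights 0, 1 and 2, and Q computes
    coordinates in this basis. *)
Lemma adapted_basis : exists q (P : 'M[K]_(q, m)) (Q : 'M[K]_(m, q)) (wt : 'I_q -> nat),
  [/\ P *m Q = 1%:M, Q *m P = 1%:M, forall i, (row i P <= flag (wt i))%MS
    & forall k (v : 'rV_m), (v <= flag k)%MS -> forall j, (k < wt j)%N -> (v *m Q) 0 j = 0].
Proof.
pose k2 := \rank U2; pose k1 := \rank (U1 :\: U2)%MS; pose k0 := \rank (U1^C)%MS.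
pose P := col_mx (row_base U2) (col_mx (row_base (U1 :\: U2)%MS) (row_base (U1^C)%MS)).
have U1E : (U2 + (U1 :\: U2) :=: U1)%MS.
  apply/eqmxP/andP; split; first by rewrite addsmx_sub U21 diffmxSl.
  rewrite -(addsmx_diff_cap_eq U1 U2) addsmxC addsmxS ?capmxSr //.
have Pfull : row_full P.
  rewrite -sub1mx; apply: submx_trans (_ : U1 + U1^C <= _)%MS.
    by rewrite sub1mx addsmx_compl_full.
  have bases : (P :=: U2 + (U1 :\: U2 + U1^C))%MS.
    apply: eqmx_trans (eqmx_sym (addsmxE _ _)) _.
    apply: adds_eqmx; first exact: eq_row_base.
    apply: eqmx_trans (eqmx_sym (addsmxE _ _)) _.
    by apply: adds_eqmx; apply: eq_row_base.
  rewrite bases addsmx_sub; apply/andP; split.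
    have leU1 : (U1 <= U2 + (U1 :\: U2))%MS by rewrite U1E.
    by apply: submx_trans leU1 _; apply: addsmxS => //; apply: addsmxSl.
  exact: submx_trans (addsmxSr _ _) (addsmxSr _ _).
have dimP : (k2 + (k1 + k0) = m)%N.
  have capE : (U1 :&: U2 :=: U2)%MS.
    by apply/eqmxP; rewrite capmxSr sub_capmx submx_refl U21.
  have := mxrank_cap_compl U1 U2; rewrite capE.
  rewrite -/k1 -/k2 => r1; have := mxrank_compl U1; rewrite -/k0 => r0.
  by have := rank_leq_row U1; lia.
have Pfree : row_free P by rewrite /row_free (eqnP Pfull) dimP.
pose wt (i : 'I_(k2 + (k1 + k0))) : nat :=
  match split i with inl _ => 0 | inr j => match split j with inl _ => 1 | inr _ => 2 end end.
exists (k2 + (k1 + k0))%N, P, (pinvmx P), wt; split.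
- exact: mulmxVp.
- exact: mulVpmx.
- move=> i; rewrite /wt; case: (split_ordP i) => [j ->|j ->].
    by rewrite rowKu (submx_trans (row_sub _ _)) // eq_row_base.
  rewrite rowKd; case: (split_ordP j) => [l ->|l ->].
    by rewrite rowKu (submx_trans (row_sub _ _)) // eq_row_base diffmxSl.
  by rewrite submx1.
move=> k v vk j; have PQ := mulmxVp Pfree.
case: k vk => [|[|k]] /= vk; last first.
- by rewrite /wt; case: split => // a; case: split.
- have /submxP[c ->] : (v <= col_mx (row_base U2) (row_base (U1 :\: U2)%MS))%MS.
    rewrite -addsmxE; apply: submx_trans vk _.
    by rewrite (adds_eqmx (eq_row_base _) (eq_row_base _)) U1E.
  rewrite -[c]hsubmxK mul_row_col.
  have -> : lsubmx c *m row_base U2 + rsubmx c *m row_base (U1 :\: U2)%MS =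
      row_mx (lsubmx c) (row_mx (rsubmx c) 0) *m P.
    by rewrite !mul_row_col mul0mx addr0.
  rewrite -mulmxA PQ mulmx1 /wt; case: (split_ordP j) => [a ->//|a ->].
  by rewrite row_mxEr; case: (split_ordP a) => [b ->//|b ->]; rewrite row_mxEr mxE.
- have /submxP[c ->] : (v <= row_base U2)%MS by rewrite eq_row_base.
  have -> : c *m row_base U2 = row_mx c 0 *m P by rewrite mul_row_col mul0mx addr0.
  rewrite -mulmxA PQ mulmx1 /wt; case: (split_ordP j) => [a ->//|a ->].
  by rewrite row_mxEr mxE.
Qed.

End AdaptedBasis.

(** * The Klein four-group in characteristic 2 *)
Opaque lin_subst weighted.

Section KleinFiltration.
Variables (K : fieldType) (m : nat) (Ma Mb S1 S2 : 'M[K]_m).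
Hypothesis char2 : (2%:R : K) = 0.
Hypotheses (Ma2 : Ma *m Ma = 1%:M) (Mb2 : Mb *m Mb = 1%:M).
Hypothesis (Mab : Ma *m Mb = Mb *m Ma).
Hypotheses (MaS1 : Ma *m S1 = S1 *m Ma) (MbS1 : Mb *m S1 = S1 *m (Mb *m Ma)).
Hypotheses (MaS2 : Ma *m S2 = S2 *m Mb) (MbS2 : Mb *m S2 = S2 *m Ma).
Local Notation A := (Ma - 1%:M).
Local Notation B := (Mb - 1%:M).

(** I V for the augmentation ideal I = (A, B) of the group generated by Ma and
    Mb; klein_flag2 is I^2 V, since A and B have square 0 in characteristic 2. *)
Definition klein_flag1 : 'M[K]_m := (A + B)%MS.
Definition klein_flag2 : 'M[K]_m := A *m B.
Local Notation fl := (flag klein_flag1 klein_flag2).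

Lemma involution_sub1_sq (M : 'M[K]_m) : M *m M = 1%:M ->
  (M - 1%:M) *m (M - 1%:M) = 0.
Proof.
move=> M2; rewrite mulmxBl mulmxBr M2 mulmx1 mul1mx opprB.
by rewrite -mulr2n -scaler_nat char2 scale0r.
Qed.

Lemma klein_comm : A *m B = B *m A.
Proof. by rewrite !mulmxBl !mulmxBr !mulmx1 !mul1mx Mab !opprB addrACA [RHS]addrACA [- Ma - Mb]addrC. Qed.

Lemma klein_flag21 : (klein_flag2 <= klein_flag1)%MS.
Proof. exact: submx_trans (submxMl _ _) (addsmxSr _ _). Qed.

Lemma klein_flag_unip k : (fl k *m A <= if k is k'.+1 then fl k' else 0)%MS.
Proof.
case: k => [|[|[|k]]] /=; last by rewrite submx1.
- by rewrite /klein_flag2 klein_comm -mulmxA involution_sub1_sq // mulmx0 sub0mx.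
- rewrite /klein_flag1 addsmxMr addsmx_sub involution_sub1_sq // sub0mx.
  by rewrite /klein_flag2 klein_comm submx_refl.
- by rewrite mul1mx /klein_flag1 addsmxSl.
Qed.

(** Conjugation by S1 fixes Ma and exchanges Mb with their product, so it
    preserves I. *)
Lemma klein_flag_S1 k : (fl k *m S1 <= fl k)%MS.
Proof.
have AS : A *m S1 = S1 *m A by rewrite mulmxBl mulmxBr MaS1 mulmx1 mul1mx.
have BS : B *m S1 = S1 *m (B *m A + A + B).
  rewrite mulmxBl MbS1 mul1mx; have -> : B *m A + A + B = Mb *m Ma - 1%:M.
    rewrite mulmxBl mulmxBr mulmx1 mul1mx; apply/matrixP => i j; rewrite !mxE; ring.
  by rewrite mulmxBr mulmx1.
case: k => [|[|k]] /=; last by rewrite submx1.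
- rewrite /klein_flag2 -mulmxA BS mulmxA AS -mulmxA.
  have nil (X Y : 'M[K]_m) : X *m X = 0 -> X *m Y = Y *m X ->
      X *m (Y *m X + X + Y) = X *m Y.
    by move=> XX XY; rewrite !mulmxDr XX addr0 -XY mulmxA XX mul0mx add0r.
  by rewrite nil ?involution_sub1_sq ?klein_comm // submxMl.
- rewrite /klein_flag1 addsmxMr addsmx_sub AS BS; apply/andP; split.
    exact: submx_trans (submxMl _ _) (addsmxSl _ _).
  apply: submx_trans (submxMl _ _) _.
  apply: addmx_sub; last exact: addsmxSr.
  apply: addmx_sub; last exact: addsmxSl.
  exact: submx_trans (submxMl _ _) (addsmxSl _ _).
Qed.

(** Conjugation by S2 exchanges Ma and Mb. *)
Lemma klein_flag_S2 k : (fl k *m S2 <= fl k)%MS.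
Proof.
have AS : A *m S2 = S2 *m B by rewrite mulmxBl mulmxBr MaS2 mulmx1 mul1mx.
have BS : B *m S2 = S2 *m A by rewrite mulmxBl mulmxBr MbS2 mulmx1 mul1mx.
case: k => [|[|k]] /=; last by rewrite submx1.
- by rewrite /klein_flag2 -mulmxA BS mulmxA AS -mulmxA -klein_comm submxMl.
- rewrite /klein_flag1 addsmxMr addsmx_sub AS BS; apply/andP; split.
    exact: submx_trans (submxMl _ _) (addsmxSr _ _).
  exact: submx_trans (submxMl _ _) (addsmxSl _ _).
Qed.

End KleinFiltration.

Section FilteredSubstitution.
Variables (K : fieldType) (m q : nat) (U1 U2 : 'M[K]_m).
Variables (P : 'M[K]_(q, m)) (Q : 'M[K]_(m, q)) (wt : 'I_q -> nat).
Hypotheses (PQ : P *m Q = 1%:M) (QP : Q *m P = 1%:M).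
Hypothesis rowP_flag : forall i, (row i P <= flag U1 U2 (wt i))%MS.
Hypothesis coord_flag : forall k (v : 'rV_m), (v <= flag U1 U2 k)%MS ->
  forall j, (k < wt j)%N -> (v *m Q) 0 j = 0.

Definition weighted_subst : {rmorphism {mpoly K[m]} -> {poly {mpoly K[q]}}} :=
  weighted K wt \o lin_subst Q.

Lemma weighted_subst_inj : injective weighted_subst.
Proof. by apply: inj_comp; [exact: weighted_inj | exact: lin_subst_inj QP]. Qed.

Lemma weighted_substZ c p : weighted_subst (c *: p) = c%:MP *: weighted_subst p.
Proof. by rewrite /= lin_substZ weightedZ. Qed.

(** P *m M *m Q is the matrix of M in the adapted basis. *)
Lemma weighted_subst_conj (M : 'M[K]_m) p :
  weighted_subst (lin_subst M p) = weighted K wt (lin_subst (P *m M *m Q) (lin_subst Q p)).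
Proof.
rewrite /=; congr (weighted K wt _).
apply: etrans (lin_subst_comp _ _ _) _; apply: esym.
by apply: etrans (lin_subst_comp _ _ _) _; rewrite -mulmxA mulmxA QP mul1mx.
Qed.

Opaque weighted_subst.

Lemma conj_coord (M : 'M[K]_m) i j : (P *m M *m Q) i j = (row i P *m M *m Q) 0 j.
Proof. by rewrite -row_mul -row_mul [RHS]mxE. Qed.

(** M is triangular in the adapted basis, and so is its inverse M'. *)
Lemma filtered_size (M M' : 'M[K]_m) : M *m M' = 1%:M ->
  (forall k, (flag U1 U2 k *m M <= flag U1 U2 k)%MS) ->
  (forall k, (flag U1 U2 k *m M' <= flag U1 U2 k)%MS) ->
  forall p, size (weighted_subst (lin_subst M p)) = size (weighted_subst p).
Proof.
have lower (N : 'M[K]_m) : (forall k, (flag U1 U2 k *m N <= flag U1 U2 k)%MS) ->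
    forall p, (size (weighted_subst (lin_subst N p)) <= size (weighted_subst p))%N.
  move=> Nflag p; rewrite weighted_subst_conj; apply: weighted_lin_subst_size => i j.
  rewrite conj_coord leqNgt; apply: contra => lt_ij; apply/eqP.
  apply: coord_flag lt_ij; apply: submx_trans (Nflag _).
  exact: submxMr.
move=> MM' Mf M'f p; apply/eqP; rewrite eqn_leq; apply/andP; split.
  exact: lower.
have pE : lin_subst M' (lin_subst M p) = p.
  by apply: etrans (lin_subst_comp _ _ _) _; rewrite MM' lin_subst1.
by rewrite -[X in (size (weighted_subst X) <= _)%N]pE; apply: lower.
Qed.

(** M is unitriangular in the adapted basis. *)
Lemma filtered_diff (M : 'M[K]_m) :
  (forall k, (flag U1 U2 k *m (M - 1%:M) <=
     if k is k'.+1 then flag U1 U2 k' else 0)%MS) ->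
  forall p, p != 0 ->
  (size (weighted_subst (lin_subst M p) - weighted_subst p)%R < size (weighted_subst p))%N.
Proof.
move=> Munip p p0; rewrite weighted_subst_conj.
have unip i j : (P *m M *m Q - 1%:M) i j != 0 -> (wt j < wt i)%N.
  have -> : P *m M *m Q - 1%:M = P *m (M - 1%:M) *m Q.
    by rewrite mulmxBr mulmx1 mulmxBl PQ.
  rewrite conj_coord ltnNge; apply: contra => le_ij; apply/eqP.
  have := submx_trans (submxMr (M - 1%:M) (rowP_flag i)) (Munip (wt i)).
  case: (wt i) le_ij => [|k] le_ij; last by move=> /coord_flag; apply.
  by rewrite submx0 => /eqP->; rewrite mul0mx mxE.
apply: weighted_lin_subst_diff => [i j Nij||].
- have [->//|neq] := eqVneq i j; apply/ltnW/unip.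
  by rewrite !mxE (negPf neq) subr0; move: Nij; rewrite !mxE.
- exact: unip.
- by rewrite -(inj_eq (lin_subst_inj QP)) rmorph0 in p0.
Qed.

End FilteredSubstitution.

(** klein_a and klein_b generate the normal Klein four-group of the symmetric
    group on u0, ..., u3, and swap1, swap2 generate a complement. *)
Section FourPoints.
Variables (n : nat) (u0 u1 u2 u3 : 'I_n).
Hypothesis uniq_u : uniq [:: u0; u1; u2; u3].

Definition klein_a : 'S_n := (tperm u0 u1 * tperm u2 u3)%g.
Definition klein_b : 'S_n := (tperm u0 u2 * tperm u1 u3)%g.
Definition swap1 : 'S_n := tperm u0 u1.
Definition swap2 : 'S_n := tperm u1 u2.

Lemma four_neq : ((u0 == u1) = false) * ((u0 == u2) = false) * ((u0 == u3) = false) *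
  ((u1 == u2) = false) * ((u1 == u3) = false) * ((u2 == u3) = false) *
  ((u1 == u0) = false) * ((u2 == u0) = false) * ((u3 == u0) = false) *
  ((u2 == u1) = false) * ((u3 == u1) = false) * ((u3 == u2) = false).
Proof.
rewrite [u1 == u0]eq_sym [u2 == u0]eq_sym [u3 == u0]eq_sym.
rewrite [u2 == u1]eq_sym [u3 == u1]eq_sym [u3 == u2]eq_sym.
move: uniq_u; rewrite /= !inE !negb_or andbT.
case/andP=> /and3P[/negPf e1 /negPf e2 /negPf e3] /andP[/andP[/negPf e4 /negPf e5] /negPf e6].
by do !split.
Qed.

Lemma four_perm_eq (s t : 'S_n) : s u0 = t u0 -> s u1 = t u1 -> s u2 = t u2 ->
  s u3 = t u3 ->
  (forall y, u0 != y -> u1 != y -> u2 != y -> u3 != y -> s y = t y) -> s = t.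
Proof.
move=> e0 e1 e2 e3 eqy; apply/permP => y.
have [<-//|n0] := eqVneq u0 y; have [<-//|n1] := eqVneq u1 y.
by have [<-//|n2] := eqVneq u2 y; have [<-//|n3] := eqVneq u3 y; apply: eqy.
Qed.

Ltac four_points :=
  rewrite /klein_a /klein_b /swap1 /swap2;
  apply: four_perm_eq => [||||y *]; rewrite ?(perm1, permM);
  [do 6?[rewrite !permE /= ?(eqxx, four_neq) /=; rewrite ?(eqxx, four_neq) /=]; try done ..| by rewrite !tpermD].

Lemma klein_aa : (klein_a * klein_a)%g = 1%g.
Proof. four_points. Qed.
Lemma klein_bb : (klein_b * klein_b)%g = 1%g.
Proof. four_points. Qed.
Lemma klein_ab : (klein_a * klein_b)%g = (klein_b * klein_a)%g.
Proof. four_points. Qed.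
Lemma swap1_a : (swap1 * klein_a)%g = (klein_a * swap1)%g.
Proof. four_points. Qed.
Lemma swap1_b : (swap1 * klein_b)%g = (klein_a * klein_b * swap1)%g.
Proof. four_points. Qed.
Lemma swap2_a : (swap2 * klein_a)%g = (klein_b * swap2)%g.
Proof. four_points. Qed.
Lemma swap2_b : (swap2 * klein_b)%g = (klein_a * swap2)%g.
Proof. four_points. Qed.
Lemma swap_cube : (swap1 * swap2 * (swap1 * swap2) * (swap1 * swap2))%g = 1%g.
Proof. four_points. Qed.

Lemma swap_neq1 : (swap1 * swap2)%g != 1%g.
Proof.
apply/eqP => /permP/(_ u0); rewrite permM perm1 tpermL tpermL => /eqP.
by rewrite four_neq.
Qed.

Lemma klein_a_neq1 : klein_a != 1%g.
Proof.
apply/eqP => /permP/(_ u0); rewrite permM perm1 tpermL tpermD ?four_neq // => /eqP.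
by rewrite four_neq.
Qed.

End FourPoints.

Section CharTwoBound.
Variables (K : fieldType) (n m : nat).
Hypothesis char2 : (2%:R : K) = 0.
Variable rG : mx_representation K [set: 'S_n]%G m.

Lemma trdeg_ge2_char2 E0 d : mx_faithful rG -> (4 <= n)%N ->
  defined_over (ratconst K m) (fixed_field rG) E0 ->
  has_trdeg (ratconst K m) E0 d -> (2 <= d)%N.
Proof.
move=> rG_faithful n4; rewrite fixed_fieldE => def [_ maxd].
have [hE0 KE0 E0fix Fst Ff] :=
  defined_over_alg_closure (ratact_faithful rG_faithful) def.
rewrite leqNgt; apply/negP => lt_d2.
have E0_dep (b : 'I_2 -> {fraction {mpoly K[m]}}) : (forall i, E0 (b i)) ->
    ~ alg_independent (ratconst K m) b.
  by move=> E0b indep; have := maxd 2%N b E0b indep; rewrite leqNgt lt_d2.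
pose u k (lt_k : (k < 4)%N) : 'I_n := Ordinal (leq_trans lt_k n4).
pose u0 := u 0%N isT; pose u1 := u 1%N isT; pose u2 := u 2%N isT; pose u3 := u 3%N isT.
have uniq_u : uniq [:: u0; u1; u2; u3] by [].
pose a := klein_a u0 u1 u2 u3; pose b := klein_b u0 u1 u2 u3.
pose s1 := swap1 u0 u1; pose s2 := swap2 u1 u2.
pose M g : 'M[K]_m := (rG g)^T.
have ME g h : M h *m M g = M (g * h)%g by exact: repr_trM.
have M1 : M 1%g = 1%:M by exact: repr_tr1.
have s1s1 : (s1 * s1)%g = 1%g by exact: tperm2.
have s2s2 : (s2 * s2)%g = 1%g by exact: tperm2.
have Ma2 : M a *m M a = 1%:M by rewrite ME klein_aa.
have Mb2 : M b *m M b = 1%:M by rewrite ME klein_bb.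
have Mab : M a *m M b = M b *m M a by rewrite !ME klein_ab.
have MaS1 : M a *m M s1 = M s1 *m M a by rewrite !ME swap1_a.
have MbS1 : M b *m M s1 = M s1 *m (M b *m M a) by rewrite !ME swap1_b.
have MaS2 : M a *m M s2 = M s2 *m M b by rewrite !ME swap2_a.
have MbS2 : M b *m M s2 = M s2 *m M a by rewrite !ME swap2_b.
have [q [P [Q [wt [PQ QP rowP_flag coord_flag]]]]] :=
  adapted_basis (klein_flag21 (M a) (M b)).
pose Phi := weighted_subst Q wt.
have Phi_inj : injective Phi by exact: weighted_subst_inj QP.
have PhiZ c p : Phi (c *: p) = c%:MP *: Phi p by exact: weighted_substZ.
pose w := deg_val Phi.
have unip := klein_flag_unip char2 Ma2 Mab.
have flagS1 := klein_flag_S1 char2 Ma2 Mab MaS1 MbS1.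
have flagS2 := klein_flag_S2 Mab MaS2 MbS2.
have size_s1 := filtered_size QP rowP_flag coord_flag
  (etrans (ME s1 s1) (etrans (congr1 M s1s1) M1)) flagS1 flagS1.
have size_s2 := filtered_size QP rowP_flag coord_flag
  (etrans (ME s2 s2) (etrans (congr1 M s2s2) M1)) flagS2 flagS2.
have flagA k : (flag (klein_flag1 (M a) (M b)) (klein_flag2 (M a) (M b)) k *m M a <=
    flag (klein_flag1 (M a) (M b)) (klein_flag2 (M a) (M b)) k)%MS.
  rewrite -[X in _ *m X](subrK 1%:M) mulmxDr mulmx1 addmx_sub //.
  apply: submx_trans (unip k) _; case: k => [|[|k]] /=; first exact: sub0mx.
    exact: klein_flag21.
  exact: submx1.
have size_a := filtered_size QP rowP_flag coord_flag Ma2 flagA flagA.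
have diff_a := filtered_diff PQ QP rowP_flag coord_flag unip.
have vM := deg_valM Phi_inj; have vS := deg_val_sum Phi_inj.
have vD := deg_val_leD Phi_inj; have vC := deg_val_const Phi_inj PhiZ.
have vR := deg_val_algebraic_residue Phi_inj PhiZ.
have sg_inj g : injective (lin_subst (M g)) by exact: poly_act_inj.
have w_s1 := deg_val_act Phi_inj (sg_inj s1) (ratactE rG s1) size_s1.
have w_s2 := deg_val_act Phi_inj (sg_inj s2) (ratactE rG s2) size_s2.
have a_res := deg_val_act_residue Phi_inj (sg_inj a) (ratactE rG a) size_a diff_a.
have [tau [E0tau tau0 w_tau]] :=
  nontrivial_on_base vM vS hE0 Fst Ff (klein_a_neq1 uniq_u) a_res.
(* The order of the rotation is invertible: 3 = 1 in K. *)
have char3 : (3%:R : K) != 0 by rewrite -natr1 char2 add0r oner_neq0.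
exact: (invariant_valuation_absurd vM vS vD vC vR (@ratact1 _ _ _ rG)
  (@ratactM _ _ _ rG) (@ratact_const _ _ _ rG) hE0 E0_dep Fst Ff w_s1 w_s2 s1s1 s2s2
  (swap_cube uniq_u) (swap_neq1 uniq_u) char3 E0tau tau0 w_tau).
Qed.

End CharTwoBound.

(** * Affine ratios and cross-ratios of a generic orbit *)
Section OrbitInvariants.
Variable L : fieldType.

Lemma line_polynomial_diff n i j : line_polynomial (fun y : 'I_n -> L => y i - y j).
Proof. by apply: line_polynomialB; apply: line_polynomial_coord. Qed.

Section Ratios.
Variables (n : nat) (s : 'S_n).
Local Notation s' := (s^-1)%g.

Definition ratio (y : 'I_n -> L) i j k := (y i - y k) / (y j - y k).

(** Vanishes exactly when s fixes ratio y i j k, once s acts on y by permuting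
    indices and denominators are cleared. *)
Definition ratio_gap i j k (y : 'I_n -> L) :=
  (y i - y k) * (y (s' j) - y (s' k)) - (y (s' i) - y (s' k)) * (y j - y k).

Lemma ratio_gap_line i j k : line_polynomial (ratio_gap i j k).
Proof.
by apply: line_polynomialB; apply: line_polynomialM; apply: line_polynomial_diff.
Qed.

Lemma avoid (r : seq 'I_n) : (size r < n)%N -> exists i, i \notin r.
Proof.
move=> lt_r; apply: contrapT => all_r.
have : (#|'I_n| <= size r)%N.
  apply: leq_trans (card_size r); apply/subset_leq_card/fintype.subsetP => i _.
  by apply/negPn/negP => ?; apply: all_r; exists i.
by rewrite card_ord leqNgt lt_r.
Qed.

Lemma moved_point : s != 1%g -> exists j, s j != j.
Proof.
move=> s1; apply: contrapT => fix_s; case/eqP: s1; apply/permP => j; rewrite perm1.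
by apply/eqP/negPn/negP => ?; apply: fix_s; exists j.
Qed.

(** At the indicator function of a point j moved by s, with i = s j and k another
    point, only the second product survives. *)
Lemma ratio_gap_neq0 : (3 <= n)%N -> s != 1%g ->
  exists i j k, j != k /\ exists y, ratio_gap i j k y != 0.
Proof.
move=> n3 /moved_point[j sj]; have [k] := avoid (r := [:: j; s j]) n3.
rewrite !inE negb_or => /andP[kj ksj]; exists (s j), j, k; split; first by rewrite eq_sym.
exists (fun i => (i == j)%:R); rewrite /ratio_gap permK eqxx (negPf sj) (negPf kj).
have /negPf-> : s' k != j by rewrite -(inj_eq (@perm_inj _ s)) permKV.
by rewrite subrr mul0r !subr0 sub0r mulr1 oppr_eq0 oner_neq0.
Qed.

Definition cross (y : 'I_n -> L) i j k l :=
  ((y i - y k) * (y j - y l)) / ((y i - y l) * (y j - y k)).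

(** The analogue of ratio_gap for cross y i j k l. *)
Definition cross_gap i j k l (y : 'I_n -> L) :=
  ((y i - y k) * (y j - y l)) * ((y (s' i) - y (s' l)) * (y (s' j) - y (s' k))) -
  ((y (s' i) - y (s' k)) * (y (s' j) - y (s' l))) * ((y i - y l) * (y j - y k)).

Lemma cross_gap_line i j k l : line_polynomial (cross_gap i j k l).
Proof.
by apply: line_polynomialB; apply: line_polynomialM; apply: line_polynomialM;
  apply: line_polynomial_diff.
Qed.

(** If i is moved by s and j, k, l avoid i and s i, then i is none of the indices
    of the permuted cross-ratio.  Choose y injective except for y i = y k: the
    first cross-ratio is then 0 and the permuted one is not. *)
Lemma cross_gap_neq0 (z : nat -> L) : injective z -> (5 <= n)%N -> s != 1%g ->
  exists i j k l, uniq [:: i; j; k; l] /\ exists y, cross_gap i j k l y != 0.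
Proof.
move=> injz n5 /moved_point[i si].
have [j] := avoid (r := [:: i; s i]) (leq_trans (isT : (2 < 5)%N) n5).
have [k] := avoid (r := [:: i; s i; j]) (leq_trans (isT : (3 < 5)%N) n5).
have [l] := avoid (r := [:: i; s i; j; k]) n5.
rewrite !inE !negb_or => /and4P[li lsi lj lk] /and3P[ki ksi kj] /andP[ji jsi].
exists i, j, k, l; split.
  by rewrite /= !inE !negb_or ![i == _]eq_sym ji ki li ![j == _]eq_sym kj lj eq_sym lk.
pose y p := if p == i then z k else z p.
have yE p q : p != i -> q != i -> p != q -> y p - y q != 0.
  move=> pi qi pq; rewrite /y (negPf pi) (negPf qi) subr_eq0 (inj_eq injz).
  exact: pq.
have s'i p : p != s i -> s' p != i.
  by move=> psi; rewrite -(inj_eq (@perm_inj _ s)) permKV.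
have s'si : s' i != i by rewrite -(inj_eq (@perm_inj _ s)) permKV eq_sym.
have s'_neq p q : p != q -> s' p != s' q by rewrite (inj_eq perm_inj).
have yik : y i - y k = 0 by rewrite /y eqxx (negPf ki) subrr.
exists y; rewrite /cross_gap yik !mul0r sub0r oppr_eq0.
have yil : y i - y l != 0.
  by rewrite /y eqxx (negPf li) subr_eq0 (inj_eq injz) eq_sym.
apply: mulf_neq0; apply: mulf_neq0.
- by apply: yE; rewrite ?s'i ?s'_neq // eq_sym.
- by apply: yE; rewrite ?s'i ?s'_neq // eq_sym.
- exact: yil.
- by apply: yE; rewrite // eq_sym.
Qed.

End Ratios.

Section GenericConfiguration.
Variables (n : nat) (act : 'S_n -> {rmorphism L -> L}).
Hypothesis act1 : forall x, act 1%g x = x.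
Hypothesis actM : forall g h x, act (g * h)%g x = act g (act h x).
Hypothesis act_faith : act_faithful act [set: L].
Variable z : nat -> L.
Hypotheses (injz : injective z) (z_fixed : forall k, act_fixed act (z k)).

(** Distinctness of the a i is added to the list of conditions. *)
Lemma generic_configuration (I : finType) (P : I -> ('I_n -> L) -> L) :
  (forall i, line_polynomial (P i)) -> (forall i, exists y, P i y != 0) ->
  exists a : 'I_n -> L, [/\ forall s i, act s (a i) = a ((s^-1)%g i),
    injective a & forall i, P i a != 0].
Proof.
move=> lP P0.
pose Q (c : 'I_n * 'I_n + I) : ('I_n -> L) -> L := match c with
  | inl ij => if ij.1 == ij.2 then fun=> 1 else fun y => y ij.1 - y ij.2
  | inr i => P i end.
have lQ c : line_polynomial (Q c).
  case: c => [[i j]|i] /=; last exact: lP.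
  by case: ifP => _; [apply: line_polynomial_const | apply: line_polynomial_diff].
have Q0 c : exists y, Q c y != 0.
  case: c => [[i j]|i] /=; last exact: P0.
  case: (eqVneq i j) => [_|neq]; first by exists (fun=> 0); rewrite oner_neq0.
  exists (fun p => (p == i)%:R); rewrite /= eqxx [j == i]eq_sym (negPf neq).
  by rewrite subr0 oner_neq0.
have [y Qy] := line_polynomial_family_neq0 injz (enum {: 'I_n * 'I_n + I}) lQ Q0.
have [a [aE]] := generic_orbit act1 actM act_faith injz z_fixed
  (line_polynomial_prod _ lQ) Qy.
rewrite prodf_seq_neq0 => /allP allQ.
exists a; split=> // [i j aij|i]; last exact: (allQ (inr i) (mem_enum _ _)).
apply/eqP/negPn/negP => neq; have /= := allQ (inl (i, j)) (mem_enum _ _).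
by rewrite (negPf neq) aij subrr eqxx.
Qed.

Variables (K : fieldType) (iota : {rmorphism K -> L}).
Hypothesis act_const : forall g c, act g (iota c) = iota c.

(** The coordinates T i of the a i in the affine frame (a_0, a_1) generate all
    ratios, and T 0 = 0, T 1 = 1 are constants. *)
Lemma affine_compression : (3 <= n)%N ->
  exists E0 e, [/\ defined_over iota (act_fixed act) E0, has_trdeg iota E0 e
    & (e <= n - 2)%N].
Proof.
move=> n3.
have /choice[f fP] : forall s : 'S_n, exists ijk : 'I_n * 'I_n * 'I_n, s != 1%g ->
    ijk.1.2 != ijk.2 /\ exists y, ratio_gap s ijk.1.1 ijk.1.2 ijk.2 y != 0.
  move=> s; have i0 : 'I_n by apply: Ordinal (ltnW (ltnW n3)).
  have [->|s1] := eqVneq s 1%g; first by exists (i0, i0, i0); rewrite eqxx.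
  by have [i [j [k ijk]]] := ratio_gap_neq0 n3 s1; exists (i, j, k).
pose P s y : L := if s == 1%g then 1 else ratio_gap s (f s).1.1 (f s).1.2 (f s).2 y.
have [a [aE a_inj aP]] : exists a : 'I_n -> L, [/\ forall s i, act s (a i) = a ((s^-1)%g i),
    injective a & forall s, P s a != 0].
  apply: generic_configuration => s; rewrite /P; case: (eqVneq s 1%g) => [_|s1].
  - exact: line_polynomial_const.
  - exact: ratio_gap_line.
  - by exists (fun=> 0); rewrite oner_neq0.
  - by case: (fP s s1).
pose u0 : 'I_n := Ordinal (ltnW (ltnW n3)); pose u1 : 'I_n := Ordinal (ltnW n3).
have a_neq i j : i != j -> a i - a j != 0 by rewrite subr_eq0 (inj_eq a_inj).
have a10 : a u1 - a u0 != 0 by exact: a_neq.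
pose T i := (a i - a u0) / (a u1 - a u0).
have lt2 (k : 'I_(n - 2)) : (k.+2 < n)%N by have := ltn_ord k; lia.
pose t k := T (Ordinal (lt2 k)).
have hE := gen_field_subfield iota t.
have ET i : gen_field iota t (T i).
  have [->|i0] := eqVneq i u0; first by rewrite /T subrr mul0r; apply: (sf0 hE).
  have [->|i1] := eqVneq i u1; first by rewrite /T divff //; apply: (sf1 hE).
  have lt_i : (i - 2 < n - 2)%N.
    have := ltn_ord i; move: i0 i1; rewrite -!val_eqE /=; lia.
  have -> : T i = t (Ordinal lt_i); last exact: gen_field_gen.
  congr T; apply: val_inj => /=.
  by move: i0 i1; rewrite -!val_eqE /=; lia.
have [w w0 aT] : exists2 w, w != 0 & forall i j, a i - a j = (T i - T j) * w.
  exists (a u1 - a u0) => // i j.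
  by rewrite /T -mulrBl divfK // opprB addrA subrK.
have Eratio i j k : gen_field iota t (ratio a i j k).
  rewrite /ratio !aT -mulf_div divff // mulr1.
  by apply: (sf_div hE); apply: (sfB hE).
have act_ratio s i j k :
    act s (ratio a i j k) = ratio a ((s^-1)%g i) ((s^-1)%g j) ((s^-1)%g k).
  by rewrite /ratio fmorph_div !rmorphB !aE.
apply: (compression_trdeg act1 actM act_const (t := t)) => [s k|s s1].
  by have -> : t k = ratio a (Ordinal (lt2 k)) u1 u0 by []; rewrite act_ratio; apply: Eratio.
have := aP s; rewrite /P (negPf s1); have [jk _] := fP s s1.
set i := (f s).1.1; set j := (f s).1.2; set k := (f s).2 in jk *.
rewrite /ratio_gap subr_eq0 => gap.
exists (ratio a i j k); first exact: Eratio.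
rewrite act_ratio /ratio eqr_div ?a_neq ?(inj_eq perm_inj) //.
by rewrite eq_sym.
Qed.

(** The coordinates T i = cross a i 1 0 2 of the a i in the projective frame that
    sends a_0, a_1, a_2 to 0, 1 and infinity generate all cross-ratios. *)
Lemma cross_compression : (5 <= n)%N ->
  exists E0 e, [/\ defined_over iota (act_fixed act) E0, has_trdeg iota E0 e
    & (e <= n - 3)%N].
Proof.
move=> n5.
have lt_n k : (k < 5)%N -> (k < n)%N by move=> lt_k; apply: leq_trans n5.
pose u0 : 'I_n := Ordinal (lt_n 0%N isT); pose u1 : 'I_n := Ordinal (lt_n 1%N isT).
pose u2 : 'I_n := Ordinal (lt_n 2%N isT).
have /choice[f fP] : forall s : 'S_n, exists q : 'I_n * 'I_n * ('I_n * 'I_n), s != 1%g ->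
    uniq [:: q.1.1; q.1.2; q.2.1; q.2.2] /\
    exists y, cross_gap s q.1.1 q.1.2 q.2.1 q.2.2 y != 0.
  move=> s; have [->|s1] := eqVneq s 1%g; first by exists (u0, u0, (u0, u0)) => /eqP[].
  have [i [j [k [l ijkl]]]] := cross_gap_neq0 injz n5 s1.
  by exists (i, j, (k, l)).
pose P s y : L := if s == 1%g then 1 else
  cross_gap s (f s).1.1 (f s).1.2 (f s).2.1 (f s).2.2 y.
have [a [aE a_inj aP]] : exists a : 'I_n -> L, [/\ forall s i, act s (a i) = a ((s^-1)%g i),
    injective a & forall s, P s a != 0].
  apply: generic_configuration => s; rewrite /P; case: (eqVneq s 1%g) => [_|s1].
  - exact: line_polynomial_const.
  - exact: cross_gap_line.
  - by exists (fun=> 0); rewrite oner_neq0.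
  - by case: (fP s s1).
have a_neq i j : i != j -> a i - a j != 0 by rewrite subr_eq0 (inj_eq a_inj).
have a10 : a u1 - a u0 != 0 by exact: a_neq.
have a12 : a u1 - a u2 != 0 by exact: a_neq.
have a02 : a u0 - a u2 != 0 by exact: a_neq.
pose T i := cross a i u1 u0 u2.
have lt3 (k : 'I_(n - 3)) : (k.+3 < n)%N by have := ltn_ord k; lia.
pose t k := T (Ordinal (lt3 k)).
have hE := gen_field_subfield iota t.
have ET i : i != u2 -> gen_field iota t (T i).
  move=> i2.
  have [->|i0] := eqVneq i u0.
    by rewrite /T /cross subrr !mul0r; apply: (sf0 hE).
  have [->|i1] := eqVneq i u1.
    rewrite /T /cross [X in _ / X]mulrC divff ?mulf_neq0 //; exact: (sf1 hE).
  have lt_i : (i - 3 < n - 3)%N.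
    have := ltn_ord i; move: i0 i1 i2; rewrite -!val_eqE /=; lia.
  have -> : T i = t (Ordinal lt_i); last exact: gen_field_gen.
  congr T; apply: val_inj => /=.
  by move: i0 i1 i2; rewrite -!val_eqE /=; lia.
(* The determinant of T i and T j as points of the projective line, where T i is
   (T i, 1) except that the point sent to infinity is (1, 0). *)
pose D i j := if i == u2 then (if j == u2 then 0 else 1) else
  if j == u2 then -1 else T i - T j.
have ED i j : gen_field iota t (D i j).
  rewrite /D; have [_|i2] := eqVneq i u2; have [_|j2] := eqVneq j u2.
  - exact: (sf0 hE).
  - exact: (sf1 hE).
  - exact/(sfN hE)/(sf1 hE).
  - by apply: (sfB hE); apply: ET.
pose c := (a u1 - a u0) / ((a u1 - a u2) * (a u0 - a u2)).
have c0 : c != 0 by rewrite mulf_neq0 ?invr_neq0 ?mulf_neq0.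
(* Scaling factors relating the points (a i, 1) to the T i: see aD. *)
pose lam i := if i == u2 then - c^-1 else a i - a u2.
have lam0 i : lam i != 0.
  rewrite /lam; have [_|i2] := eqVneq i u2; first by rewrite oppr_eq0 invr_neq0.
  exact: a_neq.
have aD i j : a i - a j = (c * lam i * lam j) * D i j.
  rewrite /lam /D; have [->|i2] := eqVneq i u2; have [->|j2] := eqVneq j u2.
  - by rewrite mulr0 subrr.
  - by field.
  - by field.
  - rewrite /T /cross /c.
    have := a_neq _ _ i2; have := a_neq _ _ j2 => aj ai.
    by field; rewrite ?a10 ?a12 ?a02 ?aj ?ai.
have Ecross i j k l : gen_field iota t (cross a i j k l).
  have -> : cross a i j k l = (D i k * D j l) / (D i l * D j k).
    rewrite /cross !aD.
    rewrite mulrACA [X in _ / X]mulrACA.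
    have -> : c * lam i * lam k * (c * lam j * lam l) =
        c * lam i * lam l * (c * lam j * lam k) by ring.
    rewrite -mulf_div divff ?mul1r //.
    by apply: mulf_neq0; apply: mulf_neq0; rewrite ?lam0 // mulf_neq0 ?lam0.
  by apply: (sf_div hE); apply: (sfM hE).
have act_cross s i j k l : act s (cross a i j k l) =
    cross a ((s^-1)%g i) ((s^-1)%g j) ((s^-1)%g k) ((s^-1)%g l).
  by rewrite /cross fmorph_div !rmorphM !rmorphB !aE.
apply: (compression_trdeg act1 actM act_const (t := t)) => [s k|s s1].
  rewrite /t /T act_cross; exact: Ecross.
have := aP s; rewrite /P (negPf s1); have [] := fP s s1.
set i := (f s).1.1; set j := (f s).1.2; set k := (f s).2.1; set l := (f s).2.2.
rewrite /= !inE !negb_or => /and4P[/and3P[ij ik il] /andP[jk jl] kl _] _.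
rewrite /cross_gap subr_eq0 => gap.
exists (cross a i j k l); first exact: Ecross.
rewrite act_cross /cross eqr_div ?mulf_neq0 ?a_neq ?(inj_eq perm_inj) //.
by rewrite eq_sym.
Qed.

End GenericConfiguration.
Section PairCompression.
Variables (act : 'S_2 -> {rmorphism L -> L}).
Hypothesis act1 : forall x, act 1%g x = x.
Hypothesis actM : forall g h x, act (g * h)%g x = act g (act h x).
Hypothesis act_faith : act_faithful act [set: L].
Variable z : nat -> L.
Hypotheses (injz : injective z) (z_fixed : forall k, act_fixed act (z k)).
Variables (K : fieldType) (iota : {rmorphism K -> L}).
Hypothesis act_const : forall g c, act g (iota c) = iota c.

Lemma ord2P (i : 'I_2) : i = ord0 \/ i = ord_max.
Proof. by case: i => [[|[|k]] lt_k] //; [left | right]; apply: val_inj. Qed.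

Lemma perm2P (s : 'S_2) : s ord0 = ord0 /\ s ord_max = ord_max \/
  s ord0 = ord_max /\ s ord_max = ord0.
Proof.
case: (ord2P (s ord0)) => e0; case: (ord2P (s ord_max)) => e1; [|by left|by right|];
  by have /perm_inj := etrans e0 (esym e1).
Qed.

(** The nontrivial element inverts a_0 / a_1. *)
Lemma pair_compression :
  exists E0 e, [/\ defined_over iota (act_fixed act) E0, has_trdeg iota E0 e
    & (e <= 1)%N].
Proof.
pose P (c : 'I_2 + unit) : ('I_2 -> L) -> L := match c with
  | inl i => fun y => y i
  | inr _ => fun y => y ord0 * y ord0 - y ord_max * y ord_max end.
have [a [aE _ aP]] : exists a : 'I_2 -> L, [/\ forall s i, act s (a i) = a ((s^-1)%g i),
    injective a & forall c, P c a != 0].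
  apply: (generic_configuration act1 actM act_faith injz z_fixed) => -[i|c] /=.
  - exact: line_polynomial_coord.
  - by apply: line_polynomialB; apply: line_polynomialM; apply: line_polynomial_coord.
  - by exists (fun=> 1); rewrite oner_neq0.
  - by exists (fun i => (i == ord0)%:R); rewrite /= mulr1 mulr0 subr0 oner_neq0.
have a0 : a ord0 != 0 := aP (inl ord0); have a1 : a ord_max != 0 := aP (inl ord_max).
pose t (_ : 'I_1) := a ord0 / a ord_max.
have act_t s i : act s (t i) = a ((s^-1)%g ord0) / a ((s^-1)%g ord_max).
  by rewrite fmorph_div !aE.
have hE := gen_field_subfield iota t.
apply: (compression_trdeg act1 actM act_const (t := t)) => [s i|s s1].
  rewrite act_t; have Et := gen_field_gen iota t ord0.
  case: (perm2P (s^-1)%g) => -[-> ->]; first exact: Et.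
  by rewrite -invf_div; apply: (sfV hE).
exists (t ord0); first exact: gen_field_gen.
rewrite act_t; case: (perm2P (s^-1)%g) => -[e0 e1].
  case/eqP: s1; apply/invg_inj/permP => i; rewrite invg1 perm1.
  by case: (ord2P i) => ->.
rewrite e0 e1 eqr_div // eq_sym -subr_eq0.
by have := aP (inr tt).
Qed.

End PairCompression.
End OrbitInvariants.

(** * Essential dimension of the symmetric groups *)
Section EssentialDimension.
Variables (K L : fieldType) (iota : {rmorphism K -> L}) (L0 : set L).

Lemma is_ed_eq d :
  (exists E0 e, [/\ defined_over iota L0 E0, has_trdeg iota E0 e & (e <= d)%N]) ->
  (forall E0 e, defined_over iota L0 E0 -> has_trdeg iota E0 e -> (d <= e)%N) ->
  is_ed iota L0 d.
Proof.
move=> [E0 [e [def tr le_e]]] lower; split=> //; exists E0; split=> //.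
by have /eqP <- : e == d by rewrite eqn_leq le_e (lower E0).
Qed.

Lemma is_ed_le b :
  (exists E0 e, [/\ defined_over iota L0 E0, has_trdeg iota E0 e & (e <= b)%N]) ->
  exists d, is_ed iota L0 d /\ (d <= b)%N.
Proof.
move=> [E0 [e [def tr le_e]]].
pose P d := `[< exists E0, defined_over iota L0 E0 /\ has_trdeg iota E0 d >].
have exP : exists d, P d by exists e; apply/asboolP; exists E0.
case: (ex_minnP exP) => d /asboolP Pd min_d; exists d; split; last first.
  by apply: leq_trans le_e; apply: min_d; apply/asboolP; exists E0.
split=> // E1 d' def1 tr1; apply: min_d; apply/asboolP; by exists E1.
Qed.

End EssentialDimension.

Section SymmetricGroup.
Variables (K : fieldType) (n m : nat) (rG : mx_representation K [set: 'S_n]%G m).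
Hypothesis rG_faithful : mx_faithful rG.

Lemma sym_nontrivial : (2 <= n)%N -> exists g : 'S_n, g != 1%g.
Proof.
move=> n2; pose i : 'I_n := Ordinal (ltnW n2); pose j : 'I_n := Ordinal n2.
exists (tperm i j); apply/eqP => /permP/(_ i); rewrite tpermL perm1.
by move=> /eqP.
Qed.

Lemma sym_fixed_sequence : (2 <= n)%N -> exists2 z : nat -> {fraction {mpoly K[m]}},
  injective z & forall k, act_fixed (ratact rG) (z k).
Proof.
by move=> n2; apply: fixed_sequence; apply: (faithful_dim_gt0 rG_faithful); apply: sym_nontrivial.
Qed.

Local Notation bounded_by b := (exists E0 e,
  [/\ defined_over (ratconst K m) (fixed_field rG) E0,
      has_trdeg (ratconst K m) E0 e & (e <= b)%N]).

Lemma sym_affine_bound : (3 <= n)%N -> bounded_by (n - 2)%N.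
Proof.
move=> n3; have [z injz fz] := sym_fixed_sequence (ltnW n3).
rewrite fixed_fieldE.
exact: (affine_compression (@ratact1 _ _ _ rG) (@ratactM _ _ _ rG)
  (ratact_faithful rG_faithful) injz fz (@ratact_const _ _ _ rG) n3).
Qed.

Lemma sym_cross_bound : (5 <= n)%N -> bounded_by (n - 3)%N.
Proof.
move=> n5; have [z injz fz] := sym_fixed_sequence (leq_trans (isT : (1 < 5)%N) n5).
rewrite fixed_fieldE.
exact: (cross_compression (@ratact1 _ _ _ rG) (@ratactM _ _ _ rG)
  (ratact_faithful rG_faithful) injz fz (@ratact_const _ _ _ rG) n5).
Qed.

Lemma sym_trdeg_ge2 E0 d : (4 <= n)%N ->
  defined_over (ratconst K m) (fixed_field rG) E0 ->
  has_trdeg (ratconst K m) E0 d -> (2 <= d)%N.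
Proof.
move=> n4 def tr; have [char2|char2] := eqVneq (2%:R : K) 0.
  exact: (trdeg_ge2_char2 char2 rG_faithful n4 def tr).
by apply: leq_trans (trdeg_ge_half char2 rG_faithful def tr); lia.
Qed.

End SymmetricGroup.

Lemma sym2_pair_bound (K : fieldType) (m : nat)
    (rG : mx_representation K [set: 'S_2]%G m) : mx_faithful rG ->
  exists E0 e, [/\ defined_over (ratconst K m) (fixed_field rG) E0,
    has_trdeg (ratconst K m) E0 e & (e <= 1)%N].
Proof.
move=> rGf; have [z injz fz] := sym_fixed_sequence rGf (leqnn 2).
rewrite fixed_fieldE.
exact: (pair_compression (@ratact1 _ _ _ rG) (@ratactM _ _ _ rG)
  (ratact_faithful rGf) injz fz (@ratact_const _ _ _ rG)).
Qed.

Local Close Scope classical_set_scope.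
Local Close Scope ring_scope.
Unset Implicit Arguments.

Theorem theorem1p2 (K : fieldType) :
  [/\ (forall n : nat, 5 <= n -> ed_group_le K [set: 'S_n]%G (n - 3)),
      [/\ ed_group_eq K [set: 'S_2]%G 1, ed_group_eq K [set: 'S_3]%G 1,
          ed_group_eq K [set: 'S_4]%G 2 & ed_group_eq K [set: 'S_5]%G 2]
    & (2 \notin [pchar K]%R -> ed_group_eq K [set: 'S_6]%G 3)].
Proof.
split.
- by move=> n n5 m rG rGf; apply/is_ed_le/sym_cross_bound.
- split=> m rG rGf; apply: is_ed_eq.
  + exact: sym2_pair_bound.
  + by move=> E0 e; apply: trdeg_gt0 => //; apply: sym_nontrivial.
  + exact: sym_affine_bound.
  + by move=> E0 e; apply: trdeg_gt0 => //; apply: sym_nontrivial.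
  + exact: sym_affine_bound.
  + by move=> E0 e; apply: sym_trdeg_ge2.
  + exact: sym_cross_bound.
  + by move=> E0 e; apply: sym_trdeg_ge2.
move=> char2 m rG rGf; apply: is_ed_eq; first exact: sym_cross_bound.
have two_neq0 : (2%:R != 0 :> K)%R.
  by apply: contra char2 => char2; rewrite inE /= char2.
by move=> E0 e; apply: trdeg_ge_half.
Qed.
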